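(* Let $W$ be a discrete memoryless channel with finite input alphabet $\mathcal X$ and finite output alphabet $\mathcal Y$, let $c:\mathcal X\to\mathbb R$ be a cost function and $K\in\mathbb R$ such that some distribution $P$ on $\mathcal X$ satisfies $\mathrm E_Pc\le K$, and assume $V_{W,c,K}^->0$. Then for every real $a$, \[ C_p^{\mathrm{DM}}(a\mid W,c,K)=\begin{cases} G\big(a/\sqrt{V_{W,c,K}^+}\big) & a\ge0,\\ G\big(a/\sqrt{V_{W,c,K}^-}\big) & a<0,\end{cases} \] and for every $0<\epsilon<1$, \[ C^{\mathrm{DM}}(\epsilon\mid W,c,K)=\begin{cases} \sqrt{V_{W,c,K}^+}\,G^{-1}(\epsilon) & \epsilon\ge1/2,\\ \sqrt{V_{W,c,K}^-}\,G^{-1}(\epsilon) & \epsilon<1/2.\end{cases} \]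
   Context: A channel $W$ is a family of probability distributions $W_x$ on $\mathcal Y$, $x\in\mathcal X$; $W^{\times n}(y|x)=\prod_iW(y_i|x_i)$. Logarithms are natural. A code for $W^{\times n}$ is $\Phi=(N,\phi,\{\mathcal D_i\}_{i=1}^N)$ with $\phi:\{1,\dots,N\}\to\mathcal X^n$ and disjoint $\mathcal D_i\subset\mathcal Y^n$; $|\Phi|=N$, $\mathrm{supp}(\Phi)=\{\phi(1),\dots,\phi(N)\}$, $P_{e,W^{\times n}}(\Phi)=\frac1N\sum_i(1-W^{\times n}_{\phi(i)}(\mathcal D_i))$. $W_P(y)=\sum_xP(x)W(y|x)$, $D(\cdot\|\cdot)$ is relative entropy, $I(P,W)=\sum_xP(x)D(W_x\|W_P)$, $V_{P,W}=\sum_xP(x)\sum_yW_x(y)\big(\log\frac{W_x(y)}{W_P(y)}-D(W_x\|W_P)\big)^2$. $\mathcal X^n_{c,K}=\{x\in\mathcal X^n:\sum_{i=1}^nc(x_i)\le nK\}$. $C_{W,c,K}=\max_{P:\mathrm E_Pc(x)\le K}I(P,W)$; $\mathcal V_{c,K}=\{P: I(P,W)=C_{W,c,K},\ \mathrm E_Pc(x)\le K\}$; $V^+_{W,c,K}=\max_{P\in\mathcal V_{c,K}}V_{P,W}$, $V^-_{W,c,K}=\min_{P\in\mathcal V_{c,K}}V_{P,W}$. $G$ is the standard normal distribution function. Over all code sequences $\{\Phi_n\}$ with $\mathrm{supp}(\Phi_n)\subset\mathcal X^n_{c,K}$ for all $n$: $C_p^{\mathrm{DM}}(a|W,c,K)=\inf\{\limsup_nP_{e,W^{\times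 n}}(\Phi_n):\liminf_n\frac1{\sqrt n}(\log|\Phi_n|-nC_{W,c,K})\ge a\}$, $C^{\mathrm{DM}}(\epsilon|W,c,K)=\sup\{\liminf_n\frac1{\sqrt n}(\log|\Phi_n|-nC_{W,c,K}):\limsup_nP_{e,W^{\times n}}(\Phi_n)\le\epsilon\}$. *)

(* Defs.v *)
From Stdlib Require Import Reals ClassicalEpsilon.
From mathcomp Require Import all_boot.
Set Implicit Arguments. Unset Strict Implicit. Unset Printing Implicit Defensive.

Local Open Scope R_scope.

Definition rsum (T : finType) (F : T -> R) : R := \big[Rplus/0]_(i : T) F i.
Definition rsum_in (T : finType) (A : {set T}) (F : T -> R) : R :=
  \big[Rplus/0]_(i in A) F i.

Definition is_distr (T : finType) (P : T -> R) : Prop :=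
  (forall x, 0 <= P x) /\ rsum P = 1.

Definition is_channel (X Y : finType) (W : X -> Y -> R) : Prop :=
  forall x, is_distr (W x).

Definition expect (X : finType) (P : X -> R) (c : X -> R) : R :=
  rsum (fun x => P x * c x).

Definition outdist (X Y : finType) (W : X -> Y -> R) (P : X -> R) (y : Y) : R :=
  rsum (fun x => P x * W x y).

(* relative entropy D(Q||S) (natural log); terms with Q y = 0 vanish *)
Definition relent (Y : finType) (Q S : Y -> R) : R :=
  rsum (fun y => Q y * ln (Q y / S y)).

Definition mutinf (X Y : finType) (P : X -> R) (W : X -> Y -> R) : R :=
  rsum (fun x => P x * relent (W x) (outdist W P)).

Definition dispersion (X Y : finType) (P : X -> R) (W : X -> Y -> R) : R :=
  rsum (fun x => P x *
    rsum (fun y => W x y *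
      Rsqr (ln (W x y / outdist W P y) - relent (W x) (outdist W P)))).

Definition feasible (X : finType) (c : X -> R) (K : R) (P : X -> R) : Prop :=
  is_distr P /\ expect P c <= K.

Definition capacity (X Y : finType) (W : X -> Y -> R) (c : X -> R) (K : R) : R :=
  epsilon (inhabits 0) (fun C =>
    (exists P, feasible c K P /\ mutinf P W = C) /\
    (forall P, feasible c K P -> mutinf P W <= C)).

Definition cap_achieving (X Y : finType) (W : X -> Y -> R) (c : X -> R) (K : R)
  (P : X -> R) : Prop :=
  feasible c K P /\ mutinf P W = capacity W c K.

Definition Vplus (X Y : finType) (W : X -> Y -> R) (c : X -> R) (K : R) : R :=
  epsilon (inhabits 0) (fun v =>
    (exists P, cap_achieving W c K P /\ dispersion P W = v) /\
    (forall P, cap_achieving W c K P -> dispersion P W <= v)).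

Definition Vminus (X Y : finType) (W : X -> Y -> R) (c : X -> R) (K : R) : R :=
  epsilon (inhabits 0) (fun v =>
    (exists P, cap_achieving W c K P /\ dispersion P W = v) /\
    (forall P, cap_achieving W c K P -> v <= dispersion P W)).

Definition rint (f : R -> R) (a b : R) : R :=
  epsilon (inhabits 0) (fun l =>
    exists pr : Riemann_integrable f a b, RiemannInt pr = l).

Definition gauss_density (t : R) : R := / sqrt (2 * PI) * exp (- (t * t) / 2).

Definition G (x : R) : R :=
  epsilon (inhabits 0) (fun l =>
    forall eps, 0 < eps -> exists M, forall L, M <= L ->
      Rabs (rint gauss_density (- L) x - l) < eps).

Definition Ginv (e : R) : R := epsilon (inhabits 0) (fun y => G y = e).

(* liminf_n u n >= a  (in the extended reals) *)
Definition liminf_ge (u : nat -> R) (a : R) : Prop :=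
  forall b, b < a -> exists N, forall n, (N <= n)%nat -> b < u n.

Definition Rlimsup (u : nat -> R) : R :=
  epsilon (inhabits 0) (fun l =>
    (forall e, 0 < e -> exists N, forall n, (N <= n)%nat -> u n < l + e) /\
    (forall e, 0 < e -> forall N, exists n, (N <= n)%nat /\ l - e < u n)).

Record code (X Y : finType) (n : nat) := Code {
  csize : nat;
  csize_pos : (0 < csize)%N;
  cenc : 'I_csize -> {ffun 'I_n -> X};
  cdec : 'I_csize -> {set {ffun 'I_n -> Y}};
  cdec_disj : forall i j : 'I_csize, i != j -> [disjoint cdec i & cdec j]
}.

Arguments csize {X Y n} c.
Arguments cenc {X Y n} c i.
Arguments cdec {X Y n} c i.

Definition Wn (X Y : finType) (n : nat) (W : X -> Y -> R)
  (x : {ffun 'I_n -> X}) (y : {ffun 'I_n -> Y}) : R :=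
  \big[Rmult/1]_(i : 'I_n) W (x i) (y i).

Definition Perr (X Y : finType) (n : nat) (W : X -> Y -> R) (C : code X Y n) : R :=
  / INR (csize C) *
  rsum (fun i : 'I_(csize C) =>
          1 - rsum_in (cdec C i) (fun y => Wn W (cenc C i) y)).

Definition code_cost_ok (X Y : finType) (n : nat) (c : X -> R) (K : R)
  (C : code X Y n) : Prop :=
  forall i, rsum (fun t : 'I_n => c (cenc C i t)) <= INR n * K.

Definition code_seq (X Y : finType) := forall n : nat, code X Y n.

Definition admissible (X Y : finType) (c : X -> R) (K : R) (F : code_seq X Y) :=
  forall n, code_cost_ok c K (F n).

Definition rate2 (X Y : finType) (W : X -> Y -> R) (c : X -> R) (K : R)
  (F : code_seq X Y) (n : nat) : R :=
  (ln (INR (csize (F n))) - INR n * capacity W c K) / sqrt (INR n).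

Definition errseq (X Y : finType) (W : X -> Y -> R) (F : code_seq X Y) (n : nat) : R :=
  Perr W (F n).

Definition Cp_DM (X Y : finType) (W : X -> Y -> R) (c : X -> R) (K : R) (a : R) : R :=
  epsilon (inhabits 0) (fun v =>
    (forall F : code_seq X Y, admissible c K F -> liminf_ge (rate2 W c K F) a ->
        v <= Rlimsup (errseq W F)) /\
    (forall e, v < e -> exists F : code_seq X Y, admissible c K F /\
        liminf_ge (rate2 W c K F) a /\ Rlimsup (errseq W F) < e)).

(* C^DM(eps|W,c,K) = sup { liminf rate2 : limsup P_e <= eps }
   (liminf taken in the extended reals, via liminf_ge) *)
Definition C_DM (X Y : finType) (W : X -> Y -> R) (c : X -> R) (K : R) (eps : R) : R :=
  epsilon (inhabits 0) (fun v =>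
    (forall F : code_seq X Y, admissible c K F -> Rlimsup (errseq W F) <= eps ->
        forall b, liminf_ge (rate2 W c K F) b -> b <= v) /\
    (forall b, b < v -> exists F : code_seq X Y, admissible c K F /\
        Rlimsup (errseq W F) <= eps /\ liminf_ge (rate2 W c K F) b)).

(* Main.v *)
(** Only one central limit theorem is needed: a sum of bounded centred
    independent variables is compared with the normal law by Lindeberg's
    telescoping, applied to the explicit heat solution Phi (x / sqrt t), so that
    no Gaussian convolution appears and the error is uniform in the summands.

    Converse.  Let Q be the output law shared by all capacity-achieving inputs.
    By the saddle-point inequality the mean of log W_x/Q^n is at most nC for
    every codeword x of admissible cost.  If the type P of x has I(P,W) near C,
    compactness puts its log-likelihood variance in the vicinity of [V-, V+], and
    the central limit theorem bounds the probability of correct decoding.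
    Otherwise x is tested against one of finitely many output laws that are
    close in relative entropy to any given law, and Chebyshev's inequality
    suffices.

    Achievability.  On the support of an optimal input P, D(W_x||Q) is an affine
    function of the cost.  Hence the i.i.d. words whose cost lies in a window of
    width O(sqrt n) below the mean cost have P^n-probability bounded below, have
    admissible cost and have nearly the right mean and variance; a maximal
    (Feinstein) code inside this set has output law dominated by a multiple of
    Q^n. *)

From Stdlib Require Import Reals ZArith Lra ClassicalEpsilon FunctionalExtensionality.
From Coquelicot Require Import Coquelicot.
From HB Require Import structures.
From mathcomp Require Import all_boot.
Require Import Defs.
Set Implicit Arguments. Unset Strict Implicit. Unset Printing Implicit Defensive.
Local Open Scope R_scope.

(** * Finite sums and product laws *)

(** Since [Phi (a / sqrt t)] is monotone in [t], with a direction given by the sign of [a], its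
    least value over dispersions in [V-, V+] is attained at an endpoint; the candidate value is
    therefore handled as a minimum of two terms and both bounds are proved without splitting on the
    sign of [a]. Several output laws are needed in the converse because a type with I(P,W) below C
    may still have mean log-likelihood nC against Q^n: the excess over n I(P,W) is n D(PW||Q), and
    the variance is then out of control. Against a law close to PW the mean drops by a multiple of
    n. The size of the net is a constant factor, invisible at scale sqrt n. V- > 0 keeps the
    variances near the optimum away from 0. In the direct part, the cost and the mean log-likelihood
    of an i.i.d. word both fluctuate at scale sqrt n, which would enlarge the dispersion and violate
    the cost bound. Confining the cost to a window of an arbitrarily small multiple of sqrt n cures
    both, at the price of a constant factor in the code size. Every quantity of the statement is
    picked by [epsilon], so existence has to be established before a value can be used. *)

Fact RplusA : associative Rplus. Proof. by move=> x y z; ring. Qed.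
Fact RplusC : commutative Rplus. Proof. by move=> x y; ring. Qed.
Fact Rplus0l : left_id 0 Rplus. Proof. by move=> x; ring. Qed.
HB.instance Definition _ := Monoid.isComLaw.Build R 0 Rplus RplusA RplusC Rplus0l.
Fact RmultA : associative Rmult. Proof. by move=> x y z; ring. Qed.
Fact RmultC : commutative Rmult. Proof. by move=> x y; ring. Qed.
Fact Rmult1l : left_id 1 Rmult. Proof. by move=> x; ring. Qed.
HB.instance Definition _ := Monoid.isComLaw.Build R 1 Rmult RmultA RmultC Rmult1l.
Fact Rmult0l : left_zero 0 Rmult. Proof. by move=> x; ring. Qed.
Fact Rmult0r : right_zero 0 Rmult. Proof. by move=> x; ring. Qed.
HB.instance Definition _ := Monoid.isMulLaw.Build R 0 Rmult Rmult0l Rmult0r.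
Fact RmultDl : left_distributive Rmult Rplus. Proof. by move=> x y z; ring. Qed.
Fact RmultDr : right_distributive Rmult Rplus. Proof. by move=> x y z; ring. Qed.
HB.instance Definition _ := Monoid.isAddLaw.Build R Rmult Rplus RmultDl RmultDr.

Lemma exists_INR_gt r : exists N : nat, r < INR N.
Proof.
have [h _] := archimed (Rmax r 0).
exists (Z.to_nat (up (Rmax r 0))); rewrite INR_IZR_INZ Z2Nat.id.
  by apply: Rle_lt_trans (Rmax_l r 0) _.
by apply: le_IZR; have := Rmax_r r 0; lra.
Qed.

Section Sums.
Variable T : finType.
Implicit Types F H : T -> R.

Lemma rsum_ext F H : (forall x, F x = H x) -> rsum F = rsum H.
Proof. by move=> e; apply: eq_bigr => x _. Qed.

Lemma rsum_add F H : rsum (fun x => F x + H x) = rsum F + rsum H.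
Proof. exact: big_split. Qed.

Lemma rsum_mull a F : rsum (fun x => a * F x) = a * rsum F.
Proof. by rewrite /rsum big_distrr. Qed.

Lemma rsum_mulr a F : rsum (fun x => F x * a) = rsum F * a.
Proof. by rewrite /rsum big_distrl. Qed.

Lemma rsum_opp F : rsum (fun x => - F x) = - rsum F.
Proof.
rewrite (_ : - rsum F = -1 * rsum F); last by ring.
by rewrite -rsum_mull; apply: rsum_ext => x; ring.
Qed.

Lemma rsum_sub F H : rsum (fun x => F x - H x) = rsum F - rsum H.
Proof. by rewrite /Rminus -rsum_opp -rsum_add. Qed.

Lemma rsum_0 : rsum (fun _ : T => 0) = 0.
Proof. by rewrite /rsum big1. Qed.

Lemma rsum_const a : rsum (fun _ : T => a) = INR #|T| * a.
Proof.
rewrite /rsum big_const; elim: #|T| => [|n IH]; first by rewrite /=; ring.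
by rewrite iterS IH S_INR; ring.
Qed.

Lemma rsum_le F H : (forall x, F x <= H x) -> rsum F <= rsum H.
Proof.
move=> le; rewrite /rsum; elim/big_ind2: _ => [|x1 x2 y1 y2 h1 h2|i _]; try lra.
exact: le.
Qed.

Lemma rsum_ge0 F : (forall x, 0 <= F x) -> 0 <= rsum F.
Proof. by move=> h; rewrite -[X in X <= _]rsum_0; apply: rsum_le. Qed.

Lemma rsum_D1 (z : T) F : rsum F = F z + \big[Rplus/0]_(x | x != z) F x.
Proof. by rewrite /rsum (bigD1 z). Qed.

Lemma rsum_ge_term (z : T) F : (forall x, 0 <= F x) -> F z <= rsum F.
Proof.
move=> h; rewrite (rsum_D1 z).
suff: 0 <= \big[Rplus/0]_(x | x != z) F x by lra.
by elim/big_ind: _ => [|x y|x _]; try lra; exact: h.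
Qed.

Lemma rsum_eq0 F : (forall x, 0 <= F x) -> rsum F = 0 -> forall x, F x = 0.
Proof. by move=> h e x; have := rsum_ge_term x h; have := h x; lra. Qed.

Lemma Rabs_rsum F : Rabs (rsum F) <= rsum (fun x => Rabs (F x)).
Proof.
rewrite /rsum; elim/big_ind2: _ => [|x1 x2 y1 y2 h1 h2|i _]; last by lra.
  by rewrite Rabs_R0; lra.
by apply: Rle_trans (Rabs_triang _ _) _; lra.
Qed.

Definition ind1 (z x : T) : R := if x == z then 1 else 0.

Lemma rsum_ind1 (z : T) F : rsum (fun x => ind1 z x * F x) = F z.
Proof.
rewrite (rsum_D1 z) /ind1 eqxx big1; first by ring.
by move=> x /negbTE ->; ring.
Qed.

Lemma rsum_pos F : (forall x, 0 <= F x) -> 0 < rsum F -> exists x, 0 < F x.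
Proof.
move=> h pos; apply: NNPP => no.
suff e : rsum F = 0 by lra.
rewrite -rsum_0; apply: rsum_ext => x; have := h x.
by case: (Rlt_dec 0 (F x)) => [hx|]; [case: no; exists x|lra].
Qed.

End Sums.

Lemma rsum_exch (T S : finType) (F : T -> S -> R) :
  rsum (fun x => rsum (fun y => F x y)) = rsum (fun y => rsum (fun x => F x y)).
Proof. exact: exchange_big. Qed.

Lemma rsum_inE (T : finType) (A : {set T}) F :
  rsum_in A F = rsum (fun y => if y \in A then F y else 0).
Proof. exact: big_mkcond. Qed.

Lemma rsum_in_ge0 (T : finType) (A : {set T}) F :
  (forall y, 0 <= F y) -> 0 <= rsum_in A F.
Proof. by move=> h; rewrite rsum_inE; apply: rsum_ge0 => y; case: ifP => _; [exact: h|lra]. Qed.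

(** After the two sums are exchanged, each [y] is counted at most once, because it lies in at most
    one [A i]. *)
Lemma rsum_in_disj (T I : finType) (A : I -> {set T}) F :
  (forall i j, i != j -> [disjoint A i & A j]) -> (forall y, 0 <= F y) ->
  rsum (fun i => rsum_in (A i) F) <= rsum F.
Proof.
move=> dis h.
rewrite (rsum_ext (fun i => rsum_inE (A i) F)) rsum_exch; apply: rsum_le => y.
case: (pickP (fun i => y \in A i)) => [i yi|no].
  rewrite (rsum_D1 i) yi big1; first by lra.
  move=> j ji; case: ifP => // yj.
  by have /pred0P/(_ y) /= := dis _ _ ji; rewrite yi yj.
rewrite (rsum_ext (H := fun _ => 0)); first by rewrite rsum_0; exact: h.
by move=> i; rewrite no.
Qed.

(** * Product laws on words, variance of coordinate sums, Chebyshev's inequality *)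

Section Prod.
Variable T : finType.

Definition prod_law n (p : 'I_n -> T -> R) (y : {ffun 'I_n -> T}) : R :=
  \big[Rmult/1]_(i : 'I_n) p i (y i).

Definition is_prod_distr n (p : 'I_n -> T -> R) := forall i, is_distr (p i).

Definition ffcons n (a : T) (y : {ffun 'I_n -> T}) : {ffun 'I_n.+1 -> T} :=
  [ffun i => oapp y a (unlift ord0 i)].

Lemma ffcons0 n a (y : {ffun 'I_n -> T}) : ffcons a y ord0 = a.
Proof. by rewrite ffunE unlift_none. Qed.

Lemma ffconsS n a (y : {ffun 'I_n -> T}) i : ffcons a y (lift ord0 i) = y i.
Proof. by rewrite ffunE liftK. Qed.

(** Reindexing by the bijection between a word and the pair of its first letter and its tail; the
    inductions on the block length rest on it. *)
Lemma rsum_ffcons n (F : {ffun 'I_n.+1 -> T} -> R) :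
  rsum F = rsum (fun a => rsum (fun y : {ffun 'I_n -> T} => F (ffcons a y))).
Proof.
rewrite /rsum pair_bigA /=.
rewrite (reindex (fun q : T * {ffun 'I_n -> T} => ffcons q.1 q.2)) //=.
exists (fun y : {ffun 'I_n.+1 -> T} => (y ord0, [ffun i => y (lift ord0 i)])).
  move=> [a y] _ /=; rewrite ffcons0; congr pair.
  by apply/ffunP => i; rewrite ffunE ffconsS.
move=> y _ /=; apply/ffunP => i; rewrite ffunE.
by case: unliftP => [j ->|->] //=; rewrite ffunE.
Qed.

Lemma prod_law_ffcons n (p : 'I_n.+1 -> T -> R) a y :
  prod_law p (ffcons a y) = p ord0 a * prod_law (fun i => p (lift ord0 i)) y.
Proof.
rewrite /prod_law big_ord_recl ffcons0; congr Rmult.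
by apply: eq_bigr => i _; rewrite ffconsS.
Qed.

Definition Eprod n (p : 'I_n -> T -> R) (F : {ffun 'I_n -> T} -> R) : R :=
  rsum (fun y => prod_law p y * F y).

Definition coord_sum n (xi : 'I_n -> T -> R) (y : {ffun 'I_n -> T}) : R :=
  rsum (fun i => xi i (y i)).

Lemma prod_law_ge0 n (p : 'I_n -> T -> R) y : is_prod_distr p -> 0 <= prod_law p y.
Proof.
move=> hp; rewrite /prod_law; elim/big_ind: _ => [|u v|i _]; try nra.
by case: (hp i).
Qed.

Lemma prod_law_sum1 n (p : 'I_n -> T -> R) : is_prod_distr p -> rsum (prod_law p) = 1.
Proof.
move=> hp; rewrite /rsum /prod_law -(bigA_distr_bigA (fun i j => p i j)) big1 //.
by move=> i _; case: (hp i).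
Qed.

Lemma prod_law_gt0 n (p : 'I_n -> T -> R) y : is_prod_distr p -> 0 < prod_law p y -> forall i, 0 < p i (y i).
Proof.
move=> hp; rewrite /prod_law => pos i; have [/(_ (y i)) h _] := hp i.
case: (Rle_lt_or_eq_dec _ _ h) => // e; move: pos.
by rewrite (bigD1 i) //= -e; lra.
Qed.

Lemma coord_sum_0 (xi : 'I_0 -> T -> R) y : coord_sum xi y = 0.
Proof. by rewrite /coord_sum /rsum big_ord0. Qed.

Lemma Eprod_S n (p : 'I_n.+1 -> T -> R) F :
  Eprod p F = rsum (fun a => p ord0 a * Eprod (fun i => p (lift ord0 i)) (fun y => F (ffcons a y))).
Proof.
rewrite /Eprod rsum_ffcons; apply: rsum_ext => a; rewrite -rsum_mull.
by apply: rsum_ext => y; rewrite prod_law_ffcons Rmult_assoc.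
Qed.

Lemma rsum_ordS n (F : 'I_n.+1 -> R) : rsum F = F ord0 + rsum (fun i => F (lift ord0 i)).
Proof. by rewrite /rsum big_ord_recl. Qed.

Lemma coord_sum_S n (xi : 'I_n.+1 -> T -> R) a y :
  coord_sum xi (ffcons a y) = xi ord0 a + coord_sum (fun i => xi (lift ord0 i)) y.
Proof. by rewrite /coord_sum rsum_ordS ffcons0; congr Rplus; apply: rsum_ext => i; rewrite ffconsS. Qed.

Lemma Eprod_le n (p : 'I_n -> T -> R) F H : is_prod_distr p ->
  (forall y, 0 < prod_law p y -> F y <= H y) -> Eprod p F <= Eprod p H.
Proof.
move=> hp h; apply: rsum_le => y; case: (Rle_lt_or_eq_dec _ _ (prod_law_ge0 y hp)) => [pos|<-]; last lra.
by apply: Rmult_le_compat_l; [lra|exact: h].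
Qed.

Lemma Eprod_const n (p : 'I_n -> T -> R) a : is_prod_distr p -> Eprod p (fun _ => a) = a.
Proof. by move=> hp; rewrite /Eprod rsum_mulr prod_law_sum1 //; ring. Qed.

Lemma Eprod_ext n (p : 'I_n -> T -> R) F H : (forall y, F y = H y) -> Eprod p F = Eprod p H.
Proof. by move=> e; apply: rsum_ext => y; rewrite e. Qed.

Lemma Eprod_0 (p : 'I_0 -> T -> R) F a : (forall y, F y = a) -> Eprod p F = a.
Proof. by move=> /Eprod_ext ->; rewrite Eprod_const // => -[]. Qed.

Lemma Eprod_mull n (p : 'I_n -> T -> R) a F : Eprod p (fun y => a * F y) = a * Eprod p F.
Proof. by rewrite /Eprod -rsum_mull; apply: rsum_ext => y; ring. Qed.

Lemma Eprod_add n (p : 'I_n -> T -> R) F H : Eprod p (fun y => F y + H y) = Eprod p F + Eprod p H.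
Proof. by rewrite /Eprod -rsum_add; apply: rsum_ext => y; ring. Qed.

Lemma Eprod_sub n (p : 'I_n -> T -> R) F H : Eprod p (fun y => F y - H y) = Eprod p F - Eprod p H.
Proof. by rewrite /Eprod -rsum_sub; apply: rsum_ext => y; ring. Qed.

Definition centered n (p xi : 'I_n -> T -> R) :=
  forall i, rsum (fun a => p i a * xi i a) = 0.

Definition var_sum n (p xi : 'I_n -> T -> R) :=
  rsum (fun i => rsum (fun a => p i a * Rsqr (xi i a))).

(** The offset [s] is there for the induction: fixing the first coordinate shifts it by [xi ord0 a],
    and the resulting cross term vanishes by centering. *)
Lemma Eprod_coord_sum_sqr n (p xi : 'I_n -> T -> R) s : is_prod_distr p -> centered p xi ->
  Eprod p (fun y => Rsqr (s + coord_sum xi y)) = Rsqr s + var_sum p xi.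
Proof.
elim: n p xi s => [|n IH] p xi s hp hc.
  rewrite /var_sum /rsum big_ord0; apply: Eprod_0 => y.
  by rewrite coord_sum_0 !Rplus_0_r.
rewrite Eprod_S.
set v := var_sum (fun i => p (lift ord0 i)) (fun i => xi (lift ord0 i)).
rewrite (rsum_ext (H := fun a => p ord0 a * (Rsqr (s + xi ord0 a) + v))); last first.
  move=> a; congr Rmult; rewrite -IH; last 2 first.
  - by move=> i; exact: hp.
  - by move=> i; exact: hc.
  by apply: Eprod_ext => y; rewrite coord_sum_S Rplus_assoc.
have -> : var_sum p xi = rsum (fun a => p ord0 a * Rsqr (xi ord0 a)) + v.
  by rewrite /var_sum rsum_ordS.
rewrite (rsum_ext (H := fun a => (Rsqr s + v) * p ord0 a + 2 * s * (p ord0 a * xi ord0 a) +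
   p ord0 a * Rsqr (xi ord0 a))); last by move=> a; rewrite /Rsqr; ring.
rewrite !rsum_add !rsum_mull hc; case: (hp ord0) => _ ->; ring.
Qed.

Definition ind (b : bool) : R := if b then 1 else 0.

Lemma ind_01 b : 0 <= ind b <= 1. Proof. by case: b => /=; lra. Qed.

Definition leR (a b : R) : bool := if Rle_dec a b then true else false.

Lemma leRP a b : reflect (a <= b) (leR a b).
Proof. by rewrite /leR; case: Rle_dec => h; constructor. Qed.

Lemma chebyshev n (p xi : 'I_n -> T -> R) s (b : {ffun 'I_n -> T} -> bool) :
  is_prod_distr p -> centered p xi -> 0 < s ->
  (forall y, b y -> s <= Rabs (coord_sum xi y)) ->
  Eprod p (fun y => ind (b y)) <= var_sum p xi / Rsqr s.
Proof.
move=> hp hc s0 h.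
have e := Eprod_coord_sum_sqr 0 hp hc.
rewrite (_ : var_sum p xi / Rsqr s = / Rsqr s * (Rsqr 0 + var_sum p xi)); last first.
  by rewrite /Rsqr; field; lra.
have i0 : 0 < / Rsqr s by apply: Rinv_0_lt_compat; apply: Rlt_0_sqr; lra.
rewrite -e -Eprod_mull; apply: Eprod_le => // y _; rewrite Rplus_0_l.
have hs := Rle_0_sqr (coord_sum xi y).
case: (boolP (b y)) => [/h {}h|_] /=; last by nra.
rewrite (Rsqr_abs (coord_sum xi y)); have: Rsqr s <= Rsqr (Rabs (coord_sum xi y)) by apply: Rsqr_incr_1 => //; [lra|exact: Rabs_pos].
move=> /(Rmult_le_compat_l _ _ _ (Rlt_le _ _ i0)); rewrite Rinv_l; first by [].
by have := Rlt_0_sqr s; lra.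
Qed.

End Prod.

Lemma WnE (X Y : finType) n (W : X -> Y -> R) x (y : {ffun 'I_n -> Y}) :
  Wn W x y = prod_law (fun i => W (x i)) y.
Proof. by []. Qed.

(** * The normal distribution function *)

Section Gauss.

Let e (t : R) := exp (- (t * t) / 2).
Let J (x : R) := RInt e 0 x.
(** Feynman's device for the Gaussian integral: [J * J + B] has derivative 0 and equals pi/2 at 0,
    while [B] decays at infinity, so [B] measures how far [J] is from its limit. *)
Let B (x : R) := RInt (fun t => 2 * exp (- (x * x) * (1 + t * t) / 2) / (1 + t * t)) 0 1.

Let dene t : 1 + t * t <> 0. Proof. by nra. Qed.

Let e_cont t : continuous e t.
Proof. by apply: ex_derive_continuous; rewrite /e; auto_derive. Qed.

Let e_int a b : ex_RInt e a b.
Proof. by apply: ex_RInt_continuous => z _; exact: e_cont. Qed.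

Let J_derive x : is_derive J x (e x).
Proof.
apply: (is_derive_RInt e J 0 x) => //.
by apply: filter_forall => b; apply: RInt_correct.
Qed.

Let B_derive x : is_derive B x (- 2 * e x * J x).
Proof.
rewrite (_ : - 2 * e x * J x = RInt (fun t => Derive (fun u => 2 * exp (- (u * u) * (1 + t * t) / 2) / (1 + t * t)) x) 0 1).
  have D u t : is_derive (fun u => 2 * exp (- (u * u) * (1 + t * t) / 2) / (1 + t * t)) u (- 2 * u * exp (- (u * u) * (1 + t * t) / 2)).
    by auto_derive => //; rewrite /Rdiv; field; exact: dene.
  apply: (@is_derive_RInt_param (fun u t => 2 * exp (- (u * u) * (1 + t * t) / 2) / (1 + t * t)) 0 1 x).
  - by apply: filter_forall => u t _; eexists; exact: D.
  - move=> t _; apply: (@continuity_2d_pt_ext (fun u v => -2 * u * exp (- (u * u) * (1 + v * v) / 2))).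
      by move=> u v; rewrite (is_derive_unique _ _ _ (D u v)).
    apply: continuity_2d_pt_mult.
      by apply: continuity_2d_pt_mult; [exact: continuity_2d_pt_const|exact: continuity_2d_pt_id1].
    apply: (@continuity_1d_2d_pt_comp exp (fun u v => - (u * u) * (1 + v * v) / 2)).
      by apply: derivable_continuous_pt; exact: derivable_pt_exp.
    apply: continuity_2d_pt_mult; last exact: continuity_2d_pt_const.
    apply: continuity_2d_pt_mult.
      by apply: continuity_2d_pt_opp; apply: continuity_2d_pt_mult; exact: continuity_2d_pt_id1.
    apply: continuity_2d_pt_plus; first exact: continuity_2d_pt_const.
    by apply: continuity_2d_pt_mult; exact: continuity_2d_pt_id2.
  - apply: filter_forall => y; apply: ex_RInt_continuous => z _.
    by apply: ex_derive_continuous; auto_derive; exact: dene.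
(* The exponential factors as [e x] times [e (x * t)]; the affine form [x * t + 0] with the factor
   [x] is the shape required by [RInt_comp_lin], whose change of variable produces [J x]. *)
rewrite (@RInt_ext _ _ (fun t => scal (- 2 * e x) (scal x (e (x * t + 0)))) 0 1); last first.
  move=> t _; apply: is_derive_unique.
  have E : -2 * e x * (x * e (x * t + 0)) = - 2 * x * exp (- (x * x) * (1 + t * t) / 2).
    rewrite (_ : - (x * x) * (1 + t * t) / 2 = - (x * x) / 2 + - ((x * t + 0) * (x * t + 0)) / 2); last by field.
    by rewrite exp_plus /e; ring.
  rewrite /scal /= /mult /= E.
  by auto_derive => //; rewrite /Rdiv; field; exact: dene.
rewrite RInt_scal; last first.
  apply: ex_RInt_continuous => z _; apply: ex_derive_continuous.
  by rewrite /e /scal /= /mult /=; auto_derive.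
rewrite RInt_comp_lin; last exact: e_int.
rewrite /scal /= /mult /=; congr Rmult; by rewrite /J; congr RInt; rewrite ?Rmult_0_r ?Rmult_1_r ?Rplus_0_r.
Qed.

Let J0 : J 0 = 0. Proof. by rewrite /J RInt_point. Qed.

Let B0 : B 0 = PI / 2.
Proof.
rewrite /B (_ : PI / 2 = 2 * atan 1 - 2 * atan 0); last by rewrite atan_1 atan_0; field.
apply: is_RInt_unique.
apply: (@is_RInt_derive _ (fun t => 2 * atan t)) => t _.
  auto_derive => //; rewrite (_ : - (0 * 0) * (1 + t * t) / 2 = 0); last by field.
  by rewrite exp_0; field; rewrite /Rsqr; nra.
by apply: ex_derive_continuous; auto_derive; exact: dene.
Qed.

Let JB x : J x * J x + B x = PI / 2.
Proof.
have D u : is_derive (fun u => J u * J u + B u) u 0.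
  rewrite (_ : 0 = (e u * J u + J u * e u) + - 2 * e u * J u); last by ring.
  apply: (@is_derive_plus _ _ (fun u => J u * J u) B).
    by apply: (@is_derive_mult _ J J u (e u) (e u)) => //; move=> a b; exact: Rmult_comm.
  exact: B_derive.
case: (@MVT_gen (fun u => J u * J u + B u) 0 x (fun _ => 0)) => [u _|u _|c [_]].
- exact: D.
- by apply/continuity_pt_filterlim; apply: ex_derive_continuous; exists 0.
- by rewrite J0 B0; lra.
Qed.

Let B_bound x : 0 < B x <= 2 * e x.
Proof.
have I : ex_RInt (fun t => 2 * exp (- (x * x) * (1 + t * t) / 2) / (1 + t * t)) 0 1.
  apply: ex_RInt_continuous => z _.
  by apply: ex_derive_continuous; auto_derive; exact: dene.
split.
  apply: RInt_gt_0; [lra| | ].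
    move=> t _; apply: Rdiv_lt_0_compat; last by nra.
    by have := exp_pos (- (x * x) * (1 + t * t) / 2); lra.
  by move=> t _; apply: ex_derive_continuous; auto_derive; exact: dene.
rewrite (_ : 2 * e x = RInt (fun _ => 2 * e x) 0 1); last first.
  by rewrite RInt_const /scal /= /mult /=; ring.
apply: RInt_le => //; [lra|exact: ex_RInt_const|move=> t [t0 t1]].
have h : exp (- (x * x) * (1 + t * t) / 2) <= e x.
  case: (Req_dec (x * t) 0) => [h|h].
    by right; rewrite /e; congr exp; field_simplify; nra.
  by left; apply: exp_increasing; nra.
have := exp_pos (- (x * x) * (1 + t * t) / 2) => p.
apply: (Rmult_le_reg_r (1 + t * t)); first nra.
by rewrite /Rdiv Rmult_assoc Rinv_l; nra.
Qed.

Definition Phi (x : R) := 1 / 2 + RInt gauss_density 0 x.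

Let s2pi : 0 < sqrt (2 * PI).
Proof. by apply: sqrt_lt_R0; have := PI_RGT_0; lra. Qed.

Lemma gauss_density_pos x : 0 < gauss_density x.
Proof. by apply: Rmult_lt_0_compat; [exact: Rinv_0_lt_compat|exact: exp_pos]. Qed.

Lemma gauss_density_le1 x : gauss_density x <= 1.
Proof.
have h1 : / sqrt (2 * PI) <= 1.
  rewrite -Rinv_1; apply: Rinv_le_contravar; first lra.
  rewrite -sqrt_1; apply: sqrt_le_1_alt; have := PI2_1; lra.
have h2 : exp (- (x * x) / 2) <= 1.
  rewrite -exp_0; case: (Req_dec x 0) => [->|h]; first by right; congr exp; field.
  by left; apply: exp_increasing; nra.
rewrite /gauss_density; have := exp_pos (- (x * x) / 2); have := Rinv_0_lt_compat _ s2pi; nra.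
Qed.

Lemma gauss_density_cont x : continuous gauss_density x.
Proof. by apply: ex_derive_continuous; rewrite /gauss_density; auto_derive. Qed.

Lemma gauss_density_int a b : ex_RInt gauss_density a b.
Proof. by apply: ex_RInt_continuous => z _; exact: gauss_density_cont. Qed.

Lemma Phi_derive x : is_derive Phi x (gauss_density x).
Proof.
rewrite -[gauss_density x]Rplus_0_l.
apply: (@is_derive_plus _ _ (fun _ => 1 / 2)); first exact: is_derive_const.
apply: is_derive_RInt; last exact: gauss_density_cont.
by apply: filter_forall => b; apply: RInt_correct; exact: gauss_density_int.
Qed.

Let PhiJ x : Phi x = 1 / 2 + J x / sqrt (2 * PI).
Proof.
rewrite /Phi (_ : RInt gauss_density 0 x = / sqrt (2 * PI) * J x); first by rewrite /Rdiv (Rmult_comm (J x)).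
exact: (@RInt_scal _ e 0 x (/ sqrt (2 * PI)) (e_int 0 x)).
Qed.

Lemma Phi_0 : Phi 0 = 1 / 2.
Proof. by rewrite PhiJ J0; field; lra. Qed.

(** [JB] rewritten for the normalised integral. As [B] is positive and at most [2 * e x], this one
    identity yields both [0 < Phi < 1] and the decay of the tails. *)
Let PhiB x : Phi x * (1 - Phi x) = B x / (2 * PI).
Proof.
have p := PI_RGT_0.
have q : sqrt (2 * PI) * sqrt (2 * PI) = 2 * PI by apply: sqrt_sqrt; lra.
have h := JB x.
rewrite PhiJ (_ : B x = sqrt (2 * PI) * sqrt (2 * PI) / 4 - J x * J x); last by lra.
rewrite -[X in _ = _ / X]q; field; lra.
Qed.

Lemma Phi_lt x y : x < y -> Phi x < Phi y.
Proof.
move=> xy; case: (@MVT_gen Phi x y gauss_density) => [u _|u _|c [_]].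
- exact: Phi_derive.
- by apply/continuity_pt_filterlim; apply: ex_derive_continuous; eexists; exact: Phi_derive.
- by have := gauss_density_pos c; nra.
Qed.

Lemma Phi_le x y : x <= y -> Phi x <= Phi y.
Proof. by case=> [/Phi_lt|->]; lra. Qed.

Lemma Phi_bound x : 0 < Phi x < 1.
Proof.
have p := PI_RGT_0; have h : 0 < Phi x * (1 - Phi x).
  by rewrite PhiB; apply: Rdiv_lt_0_compat; [case: (B_bound x)|lra].
by nra.
Qed.

Lemma Phi_lip x y : Rabs (Phi x - Phi y) <= Rabs (x - y).
Proof.
case: (@MVT_gen Phi y x gauss_density) => [u _|u _|c [_ ->]].
- exact: Phi_derive.
- by apply/continuity_pt_filterlim; apply: ex_derive_continuous; eexists; exact: Phi_derive.
- rewrite Rabs_mult (Rabs_pos_eq (gauss_density c)); last by have := gauss_density_pos c; lra.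
  by have := gauss_density_le1 c; have := Rabs_pos (x - y); nra.
Qed.

Let tail x : Phi x * (1 - Phi x) <= exp (- (x * x) / 2).
Proof.
rewrite PhiB; have [_ h] := B_bound x; have p := PI2_1; have q := exp_pos (- (x * x) / 2).
rewrite /e in h.
apply: (Rmult_le_reg_r (2 * PI)); first lra.
by rewrite /Rdiv Rmult_assoc Rinv_l; nra.
Qed.

Let tail2 x : exp (- (x * x) / 2) <= 2 / (x * x + 2).
Proof.
rewrite (_ : - (x * x) / 2 = - (x * x / 2)); last by field.
rewrite exp_Ropp; have h := exp_ineq1_le (x * x / 2).
apply: Rle_trans (Rinv_le_contravar _ _ _ h) _; first nra.
right; field; nra.
Qed.

Lemma Phi_tail eta : 0 < eta -> exists L, 0 < L /\ forall x, L <= x -> Phi (- x) <= eta /\ 1 - eta <= Phi x.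
Proof.
move=> h; exists (4 / eta + 1).
have p : 0 < 4 / eta by apply: Rdiv_lt_0_compat; lra.
split; first lra.
move=> x hx.
have k : 2 / (x * x + 2) <= eta / 2.
  apply: (Rmult_le_reg_r (x * x + 2)); first nra.
  rewrite {1}/Rdiv Rmult_assoc Rinv_l; last by nra.
  have : eta * (4 / eta) = 4 by field; lra.
  by nra.
have x0 : 0 < x by lra.
have a1 := Phi_lt (Ropp_lt_gt_0_contravar _ x0); have a2 := Phi_lt x0; rewrite Phi_0 in a1 a2.
have t1 := tail x; have t2 := tail (- x); have t3 := tail2 x; have t4 := tail2 (- x).
rewrite !Rmult_opp_opp in t2 t4.
by have := Phi_bound x; have := Phi_bound (- x); nra.
Qed.

(** The limit property behind the [epsilon] of [G] is satisfied by [Phi x] and by no other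
    number. *)
Lemma GE x : G x = Phi x.
Proof.
have lim l : (forall eps, 0 < eps -> exists M, forall L, M <= L ->
   Rabs (rint gauss_density (- L) x - l) < eps) <-> l = Phi x.
  have ri L : rint gauss_density (- L) x = Phi x - Phi (- L).
    rewrite /rint.
    have ex : exists l, exists pr : Riemann_integrable gauss_density (- L) x, RiemannInt pr = l.
      by exists (RiemannInt (ex_RInt_Reals_0 _ _ _ (gauss_density_int (- L) x))); eexists.
    have [pr <-] := epsilon_spec (inhabits 0) _ ex.
    rewrite -RInt_Reals /Phi -(RInt_Chasles gauss_density (- L) 0 x); try exact: gauss_density_int.
    by rewrite -(opp_RInt_swap gauss_density 0) ?/plus ?/opp /=; [ring|exact: gauss_density_int].
  have L0 eps : 0 < eps -> exists M, forall L, M <= L -> Rabs (rint gauss_density (- L) x - Phi x) < eps.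
    move=> eps0; case: (@Phi_tail (eps / 2)); first lra.
    move=> M [_ hM]; exists M => L /hM [h _]; rewrite ri.
    have := Phi_bound (- L) => b.
    by rewrite (_ : _ - _ = - Phi (- L)); [rewrite Rabs_Ropp Rabs_pos_eq; lra|ring].
  split=> [h|-> //].
  apply: cond_eq => eps eps0.
  case: (h (eps / 2)); first lra. move=> M1 h1.
  case: (L0 (eps / 2)); first lra. move=> M2 h2.
  have := h1 (Rmax M1 M2) (Rmax_l _ _); have := h2 (Rmax M1 M2) (Rmax_r _ _).
  by move: (rint _ _ _) => r; split_Rabs; lra.
apply/lim; rewrite /G; apply: (epsilon_spec (inhabits 0) (fun l => forall eps, 0 < eps -> exists M, forall L, M <= L ->
   Rabs (rint gauss_density (- L) x - l) < eps)); exists (Phi x); exact/lim.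
Qed.

Lemma Phi_Ginv p : 0 < p < 1 -> Phi (Ginv p) = p.
Proof.
move=> hp; rewrite -GE /Ginv; apply: (epsilon_spec (inhabits 0) (fun y => G y = p)).
case: (@Phi_tail (Rmin p (1 - p))); first by apply: Rmin_glb_lt; lra.
move=> L [_ /(_ L (Rle_refl L)) [h1 h2]].
have m1 := Rmin_l p (1 - p); have m2 := Rmin_r p (1 - p).
case: (@IVT_gen Phi (- L) L p) => [x||x [_ <-]].
- by apply/continuity_pt_filterlim; apply: ex_derive_continuous; eexists; exact: Phi_derive.
- by split; [apply: Rle_trans (Rmin_l _ _) _|apply: Rle_trans (Rmax_r _ _)]; lra.
- by exists x; exact: GE.
Qed.

End Gauss.

(** * A uniform central limit theorem *)

Lemma mean_value_bound (f df : R -> R) a h B :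
  (forall u, Rmin 0 h <= u <= Rmax 0 h -> is_derive f (a + u) (df (a + u)) /\ Rabs (df (a + u)) <= B) ->
  Rabs (f (a + h) - f a) <= B * Rabs h.
Proof.
move=> H.
have D u : Rmin a (a + h) <= u <= Rmax a (a + h) -> is_derive f u (df u) /\ Rabs (df u) <= B.
  move=> hu; rewrite (_ : u = a + (u - a)); last by ring.
  by apply: H; move: hu; rewrite /Rmin /Rmax; do !case: Rle_dec; lra.
case: (@MVT_gen f a (a + h) df) => [u hu|u hu|c [hc ->]].
- by apply: (D u _).1; lra.
- by apply/continuity_pt_filterlim; apply: ex_derive_continuous; exists (df u); exact: (D u hu).1.
- rewrite Rabs_mult (_ : a + h - a = h); last by ring.
  by apply: Rmult_le_compat_r; [exact: Rabs_pos|exact: (D c hc).2].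
Qed.

Lemma between_abs h u : Rmin 0 h <= u <= Rmax 0 h -> Rabs u <= Rabs h.
Proof. by rewrite /Rmin /Rmax; do !case: Rle_dec; split_Rabs; lra. Qed.

Lemma between_trans h u w : Rmin 0 h <= u <= Rmax 0 h -> Rmin 0 u <= w <= Rmax 0 u ->
  Rmin 0 h <= w <= Rmax 0 h.
Proof. by rewrite /Rmin /Rmax; do !case: Rle_dec; lra. Qed.

(** The hypotheses are confined to the segment because the lemma is applied in the time variable of
    [heat], where only positive times make sense. The factor 1/2 of the remainder is given away. *)
Lemma taylor1 (g g1 g2 : R -> R) x h M :
  (forall u, Rmin 0 h <= u <= Rmax 0 h -> is_derive g (x + u) (g1 (x + u)) /\
     is_derive g1 (x + u) (g2 (x + u)) /\ Rabs (g2 (x + u)) <= M) ->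
  Rabs (g (x + h) - g x - h * g1 x) <= M * (Rabs h * Rabs h).
Proof.
move=> H.
have M0 : 0 <= M.
  case: (H 0); first by rewrite /Rmin /Rmax; do !case: Rle_dec; lra.
  by move=> _ [_]; apply: Rle_trans; exact: Rabs_pos.
pose f u := g u - u * g1 x.
have -> : g (x + h) - g x - h * g1 x = f (x + h) - f x by rewrite /f; ring.
rewrite -Rmult_assoc; apply: (@mean_value_bound f (fun u => g1 u - g1 x)) => u hu; split.
  apply: (@is_derive_minus _ _ g (fun u => u * g1 x)); first by case: (H u hu).
  by auto_derive => //; ring.
apply: Rle_trans (_ : _ <= M * Rabs u) _; last first.
  by apply: Rmult_le_compat_l => //; exact: between_abs.
apply: (@mean_value_bound g1 g2) => w hw.
by have [_ []] := H w (between_trans hu hw).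
Qed.

Lemma taylor2 (g g1 g2 g3 : R -> R) x h M :
  (forall u, is_derive g u (g1 u)) -> (forall u, is_derive g1 u (g2 u)) ->
  (forall u, is_derive g2 u (g3 u)) -> (forall u, Rabs (g3 u) <= M) ->
  Rabs (g (x + h) - g x - h * g1 x - h * h / 2 * g2 x) <= M * (Rabs h * Rabs h) * Rabs h.
Proof.
move=> D1 D2 D3 B.
pose f u := g u - u * g1 x - (u - x) * (u - x) / 2 * g2 x.
have -> : g (x + h) - g x - h * g1 x - h * h / 2 * g2 x = f (x + h) - f x.
  by rewrite /f; field.
apply: (@mean_value_bound f (fun u => g1 u - g1 x - (u - x) * g2 x)) => u hu; split.
  apply: (@is_derive_minus _ _ (fun u => g u - u * g1 x) (fun u => (u - x) * (u - x) / 2 * g2 x)).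
    apply: (@is_derive_minus _ _ g (fun u => u * g1 x)); first by [].
    by auto_derive => //; ring.
  by auto_derive => //; rewrite /Rdiv; field.
have -> : g1 (x + u) - g1 x - (x + u - x) * g2 x = g1 (x + u) - g1 x - u * g2 x by ring.
apply: Rle_trans (@taylor1 g1 g2 g3 x u M _) _; first by [].
have M0 : 0 <= M by apply: Rle_trans (B 0); exact: Rabs_pos.
apply: Rmult_le_compat_l => //; have := between_abs hu; have := Rabs_pos u; nra.
Qed.

Lemma gauss_density_derive u : is_derive gauss_density u (- u * gauss_density u).
Proof. by rewrite /gauss_density; auto_derive => //; rewrite /Rdiv; field; apply: Rgt_not_eq; apply: sqrt_lt_R0; have := PI_RGT_0; lra. Qed.

Lemma gauss_density_exp u : gauss_density u <= / (exp (u * u / 2)).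
Proof.
rewrite -exp_Ropp /gauss_density (_ : - (u * u / 2) = - (u * u) / 2); last by field.
rewrite -[X in _ <= X]Rmult_1_l; apply: Rmult_le_compat_r; first by left; exact: exp_pos.
by have := gauss_density_le1 0; rewrite /gauss_density (_ : - (0 * 0) / 2 = 0) ?exp_0; [lra|field].
Qed.

Lemma gauss_density_sqr u : u * u * gauss_density u <= 2.
Proof.
have h := exp_ineq1_le (u * u / 2); have p := exp_pos (u * u / 2).
apply: Rle_trans (Rmult_le_compat_l _ _ _ _ (gauss_density_exp u)) _; first nra.
by apply: (Rmult_le_reg_r (exp (u * u / 2))) => //; rewrite Rmult_assoc Rinv_l; nra.
Qed.

Lemma gauss_density_quart u : u * u * (u * u) * gauss_density u <= 16.
Proof.
have h := exp_ineq1_le (u * u / 4); have p := exp_pos (u * u / 2).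
have q : exp (u * u / 2) = exp (u * u / 4) * exp (u * u / 4) by rewrite -exp_plus; congr exp; field.
apply: Rle_trans (Rmult_le_compat_l _ _ _ _ (gauss_density_exp u)) _; first nra.
apply: (Rmult_le_reg_r (exp (u * u / 2))) => //; rewrite Rmult_assoc Rinv_l; last lra.
have k : 0 <= u * u / 4 by nra.
by have : (u * u / 4) * (u * u / 4) <= exp (u * u / 2); [rewrite q; nra|lra].
Qed.

(* A smoothed step function that solves the heat equation [d/dt = 1/2 d^2/dx^2]. *)
Definition heat (t x : R) := Phi (x / sqrt t).

Section Heat.
Variable t : R.
Hypothesis t0 : 0 < t.
Let s0 : 0 < sqrt t. Proof. exact: sqrt_lt_R0. Qed.
Let ss : sqrt t * sqrt t = t. Proof. by apply: sqrt_sqrt; lra. Qed.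

Definition heat1 (t x : R) := gauss_density (x / sqrt t) / sqrt t.
Definition heat2 (t x : R) := - (x / sqrt t) * gauss_density (x / sqrt t) / t.
Definition heat3 (t x : R) :=
  ((x / sqrt t) * (x / sqrt t) - 1) * gauss_density (x / sqrt t) / (t * sqrt t).

Let lin x : is_derive (fun u => u / sqrt t) x (/ sqrt t).
Proof. by auto_derive => //; ring. Qed.

Lemma heat_derive x : is_derive (heat t) x (heat1 t x).
Proof.
rewrite /heat /heat1 (_ : _ / _ = scal (/ sqrt t) (gauss_density (x / sqrt t))); last first.
  by rewrite /scal /= /mult /= Rmult_comm.
by apply: (is_derive_comp Phi (fun u => u / sqrt t)); [exact: Phi_derive|exact: lin].
Qed.

Let gd_lin x : is_derive (fun u => gauss_density (u / sqrt t)) x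
  (- (x / sqrt t) * gauss_density (x / sqrt t) / sqrt t).
Proof.
rewrite (_ : - (x / sqrt t) * gauss_density (x / sqrt t) / sqrt t =
  scal (/ sqrt t) (- (x / sqrt t) * gauss_density (x / sqrt t))); last first.
  by rewrite /scal /= /mult /= /Rdiv; ring.
by apply: (is_derive_comp gauss_density (fun u => u / sqrt t)); [exact: gauss_density_derive|exact: lin].
Qed.

Lemma heat1_derive x : is_derive (heat1 t) x (heat2 t x).
Proof.
rewrite /heat1 /heat2.
rewrite (_ : - (x / sqrt t) * gauss_density (x / sqrt t) / t =
   - (x / sqrt t) * gauss_density (x / sqrt t) / sqrt t * / sqrt t); last first.
  by rewrite -[X in _ / X]ss; field; lra.
exact: (is_derive_scal_l (fun u => gauss_density (u / sqrt t))).
Qed.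

Lemma heat2_derive x : is_derive (heat2 t) x (heat3 t x).
Proof.
rewrite /heat2 /heat3.
have E : ((x / sqrt t) * (x / sqrt t) - 1) * gauss_density (x / sqrt t) / (t * sqrt t) =
   (- / sqrt t * gauss_density (x / sqrt t) + - (x / sqrt t) *
     (- (x / sqrt t) * gauss_density (x / sqrt t) / sqrt t)) * / t.
  by field; split; lra.
rewrite E; apply: (is_derive_scal_l (fun u => - (u / sqrt t) * gauss_density (u / sqrt t))).
apply: (@is_derive_mult _ (fun u => - (u / sqrt t)) (fun u => gauss_density (u / sqrt t))).
- by apply: (@is_derive_opp _ _ (fun u => u / sqrt t)); exact: lin.
- exact: gd_lin.
- by move=> a b; exact: Rmult_comm.
Qed.

Lemma heat3_bound x : Rabs (heat3 t x) <= 3 / (t * sqrt t).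
Proof.
rewrite /heat3 /Rdiv Rabs_mult (Rabs_pos_eq (/ _)); last by left; apply: Rinv_0_lt_compat; nra.
apply: Rmult_le_compat_r; first by left; apply: Rinv_0_lt_compat; nra.
move: (x * / sqrt t) => u.
have := gauss_density_sqr u; have := gauss_density_pos u; have := gauss_density_le1 u => a b c.
have d : 0 <= u * u * gauss_density u by nra.
by rewrite Rmult_minus_distr_r; split_Rabs; lra.
Qed.

(** The second time derivative, by the heat equation a quarter of the fourth space derivative; hence
    the cubic Hermite polynomial. *)
Definition heat_tt (t x : R) :=
  (3 * (x / sqrt t) - (x / sqrt t) * ((x / sqrt t) * (x / sqrt t))) * gauss_density (x / sqrt t) / 4 / (t * t).

Let rt x : is_derive (fun u => x / sqrt u) t (- (x / sqrt t) / 2 / t).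
Proof.
auto_derive; first by do ?split => //; lra.
rewrite -[X in _ = _ / X]ss; field; lra.
Qed.

(** This is the heat equation. It makes a centred random step of variance [v] in space equivalent,
    to leading order, to a step [v] in time. *)
Lemma heat_derive_t x : is_derive (fun u => heat u x) t (1 / 2 * heat2 t x).
Proof.
rewrite /heat /heat2 (_ : _ * _ = scal (- (x / sqrt t) / 2 / t) (gauss_density (x / sqrt t))); last first.
  by rewrite /scal /= /mult /=; field; lra.
by apply: (is_derive_comp Phi (fun u => x / sqrt u)); [exact: Phi_derive|exact: rt].
Qed.

Lemma heat2_derive_t x : is_derive (fun u => 1 / 2 * heat2 u x) t (heat_tt t x).
Proof.
rewrite /heat2 /heat_tt.
pose u := x / sqrt t.
have G1 : is_derive (fun u => gauss_density (x / sqrt u)) t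
   (- (x / sqrt t) / 2 / t * (- (x / sqrt t) * gauss_density (x / sqrt t))).
  by apply: (is_derive_comp gauss_density (fun u => x / sqrt u)); [exact: gauss_density_derive|exact: rt].
have G2 : is_derive (fun u => - (x / sqrt u) / u) t (- (- (x / sqrt t) / 2 / t) / t + - (x / sqrt t) * (- / (t * t))).
  apply: (@is_derive_mult _ (fun u => - (x / sqrt u)) (fun u => / u)).
  - by apply: (@is_derive_opp _ _ (fun u => x / sqrt u)); exact: rt.
  - by auto_derive; [lra|field; lra].
  - by move=> a b; exact: Rmult_comm.
have E0 w : 1 / 2 * (- (x / sqrt w) / w * gauss_density (x / sqrt w)) =
    1 / 2 * (- (x / sqrt w) * gauss_density (x / sqrt w) / w) by rewrite /Rdiv; ring.
apply: (is_derive_ext _ _ _ _ E0).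
have E : (3 * (x / sqrt t) - (x / sqrt t) * ((x / sqrt t) * (x / sqrt t))) * gauss_density (x / sqrt t) / 4 / (t * t) =
  1 / 2 * ((- (- (x / sqrt t) / 2 / t) / t + - (x / sqrt t) * (- / (t * t))) * gauss_density (x / sqrt t) +
    - (x / sqrt t) / t * (- (x / sqrt t) / 2 / t * (- (x / sqrt t) * gauss_density (x / sqrt t)))).
  by field; lra.
rewrite E; apply: (is_derive_scal (fun u => - (x / sqrt u) / u * gauss_density (x / sqrt u))).
by apply: (@is_derive_mult _ (fun u => - (x / sqrt u) / u) (fun u => gauss_density (x / sqrt u))) => // a b; exact: Rmult_comm.
Qed.

(** With [gauss_density_sqr] and [gauss_density_quart] the numerator is at most 3 (1 + 2) + (1 + 16)
    = 26, and 26 / 4 <= 7. *)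
Lemma heat_tt_bound x : Rabs (heat_tt t x) <= 7 / (t * t).
Proof.
rewrite /heat_tt /Rdiv Rabs_mult (Rabs_pos_eq (/ (t * t))); last by left; apply: Rinv_0_lt_compat; nra.
apply: Rmult_le_compat_r; first by left; apply: Rinv_0_lt_compat; nra.
move: (x * / sqrt t) => u.
have := gauss_density_sqr u; have := gauss_density_quart u.
have := gauss_density_pos u; have := gauss_density_le1 u => a b c d.
have h1 : Rabs u <= 1 + u * u by split_Rabs; nra.
have h2 : Rabs (u * (u * u)) <= 1 + u * u * (u * u).
  by rewrite !Rabs_mult; split_Rabs; nra.
rewrite (Rabs_mult _ (/ 4)) (Rabs_mult _ (gauss_density u)) (Rabs_pos_eq (gauss_density u)) ?(Rabs_pos_eq (/ 4)); try lra.
have h3 : Rabs (3 * u - u * (u * u)) <= 3 * (1 + u * u) + (1 + u * u * (u * u)) by split_Rabs; lra.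
by have := Rmult_le_compat_r _ _ _ (Rlt_le _ _ b) h3; lra.
Qed.

End Heat.

(** * Lindeberg's replacement of summands by time *)

Section Lindeberg.
Variables (T : finType) (eps m : R).
Hypotheses (eps0 : 0 < eps) (m0 : 0 <= m).

(** The cost of trading one summand for time: the third-order remainder in space for steps bounded
    by [m], plus the second-order remainder in time, where the step is at most [m * m]. Times stay
    above [eps]. *)
Definition lind_const := 3 / (eps * sqrt eps) * (m * m * m) + 7 / (eps * eps) * (m * m * (m * m)).

(** Both quantities agree with [heat t x + v / 2 * heat2 t x] up to their Taylor remainders: the
    space expansion by centering, the time expansion by the heat equation. *)
Lemma lindeberg_step (p xi : T -> R) t x : is_distr p -> eps <= t ->
  (forall a, 0 < p a -> Rabs (xi a) <= m) -> rsum (fun a => p a * xi a) = 0 ->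
  Rabs (rsum (fun a => p a * heat t (x + xi a)) -
        heat (t + rsum (fun a => p a * Rsqr (xi a))) x) <= lind_const.
Proof.
move=> [p0 p1] et hm hc.
set v := rsum (fun a => p a * Rsqr (xi a)); have t0 : 0 < t by lra.
have se : 0 < sqrt eps by exact: sqrt_lt_R0.
have st : sqrt eps <= sqrt t by exact: sqrt_le_1_alt.
have v0 : 0 <= v by apply: rsum_ge0 => a; apply: Rmult_le_pos => //; exact: Rle_0_sqr.
have vm : v <= m * m.
  rewrite -[m * m]Rmult_1_r -p1 -rsum_mull; apply: rsum_le => a.
  rewrite Rmult_comm; case: (Rle_lt_or_eq_dec _ _ (p0 a)) => [pa|<-]; last lra.
  apply: Rmult_le_compat_r; first exact: p0.
  rewrite Rsqr_abs; have := hm a pa; have := Rabs_pos (xi a) => q1 q2.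
  by apply: Rmult_le_compat.
have m30 : 0 <= m * m * m by do !apply: Rmult_le_pos.
have h1 : Rabs (rsum (fun a => p a * heat t (x + xi a)) - (heat t x + v / 2 * heat2 t x)) <=
    3 / (eps * sqrt eps) * (m * m * m).
  rewrite (_ : heat t x + v / 2 * heat2 t x =
     rsum (fun a => p a * (heat t x + xi a * heat1 t x + xi a * xi a / 2 * heat2 t x))); last first.
    rewrite (@rsum_ext _ _ (fun a => heat t x * p a + heat1 t x * (p a * xi a) + heat2 t x / 2 * (p a * Rsqr (xi a)))).
      by rewrite !rsum_add !rsum_mull p1 hc -/v; field.
    by move=> a; rewrite /Rsqr; field.
  rewrite -rsum_sub; apply: Rle_trans (Rabs_rsum _) _.
  rewrite -[X in _ <= X]Rmult_1_r -p1 -rsum_mull; apply: rsum_le => a.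
  rewrite -Rmult_minus_distr_l Rabs_mult (Rabs_pos_eq (p a)) // Rmult_comm.
  case: (Rle_lt_or_eq_dec _ _ (p0 a)) => [pa|<-]; last by lra.
  apply: Rmult_le_compat_r => //.
  have -> : heat t (x + xi a) - (heat t x + xi a * heat1 t x + xi a * xi a / 2 * heat2 t x) =
      heat t (x + xi a) - heat t x - xi a * heat1 t x - xi a * xi a / 2 * heat2 t x by ring.
  apply: Rle_trans (@taylor2 (heat t) (heat1 t) (heat2 t) (heat3 t) x (xi a) (3 / (t * sqrt t)) _ _ _ _) _.
  - by move=> u; exact: heat_derive.
  - by move=> u; exact: heat1_derive.
  - by move=> u; exact: heat2_derive.
  - by move=> u; exact: heat3_bound.
  rewrite Rmult_assoc; apply: Rmult_le_compat.
  - by left; apply: Rdiv_lt_0_compat; [lra|apply: Rmult_lt_0_compat; lra].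
  - by do !apply: Rmult_le_pos; exact: Rabs_pos.
  - rewrite /Rdiv; apply: Rmult_le_compat_l; first lra.
    by apply: Rinv_le_contravar; [apply: Rmult_lt_0_compat; lra|apply: Rmult_le_compat; lra].
  - have := hm a pa; have := Rabs_pos (xi a) => q r.
    by apply: Rmult_le_compat => //; [nra|apply: Rmult_le_compat].
have h2 : Rabs (heat (t + v) x - heat t x - v * (1 / 2 * heat2 t x)) <= 7 / (eps * eps) * (m * m * (m * m)).
  apply: Rle_trans (@taylor1 (fun u => heat u x) (fun u => 1 / 2 * heat2 u x) (fun u => heat_tt u x) t v (7 / (eps * eps)) _) _.
    rewrite Rmin_left // Rmax_right // => u [u0 u1]; split; last split.
    - by apply: heat_derive_t; lra.
    - by apply: heat2_derive_t; lra.
    - apply: Rle_trans (heat_tt_bound _ _) _; first lra.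
      rewrite /Rdiv; apply: Rmult_le_compat_l; first lra.
      by apply: Rinv_le_contravar; nra.
  rewrite Rabs_pos_eq //; apply: Rmult_le_compat_l.
    by left; apply: Rdiv_lt_0_compat; nra.
  by nra.
rewrite /lind_const.
move: h1 h2; move: (rsum _) (heat (t + v) x) (heat t x) (heat2 t x) => r1 r2 r3 r4.
move: (3 / _ * _) (7 / _ * _) => c1 c2; have -> : v / 2 * r4 = v * (1 / 2 * r4) by field.
by split_Rabs; lra.
Qed.

(** Given the first coordinate, the induction hypothesis turns the variance of the others into time;
    [lindeberg_step] then treats the first coordinate at the later time [t + v'], which is still at
    least [eps]. *)
Lemma lindeberg n (p xi : 'I_n -> T -> R) t x : is_prod_distr p -> centered p xi -> eps <= t ->
  (forall i a, 0 < p i a -> Rabs (xi i a) <= m) ->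
  Rabs (Eprod p (fun y => heat t (x + coord_sum xi y)) - heat (t + var_sum p xi) x) <= INR n * lind_const.
Proof.
elim: n p xi x => [|n IH] p xi x hp hc et hm.
  rewrite (@Eprod_0 _ _ _ (heat t x)); last by move=> y; rewrite coord_sum_0 Rplus_0_r.
  rewrite /var_sum /rsum big_ord0 Rplus_0_r Rminus_diag Rabs_R0 /=; lra.
pose p' i := p (lift ord0 i); pose xi' i := xi (lift ord0 i).
have hp' : is_prod_distr p' by move=> i; exact: hp.
have hc' : centered p' xi' by move=> i; exact: hc.
have -> : var_sum p xi = rsum (fun a => p ord0 a * Rsqr (xi ord0 a)) + var_sum p' xi'.
  by rewrite /var_sum rsum_ordS.
set v' := var_sum p' xi'.
have v'0 : 0 <= v'.
  apply: rsum_ge0 => i; apply: rsum_ge0 => a.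
  by have [h _] := hp' i; apply: Rmult_le_pos => //; exact: Rle_0_sqr.
have [p0 p1] := hp ord0.
have h1 : Rabs (Eprod p (fun y => heat t (x + coord_sum xi y)) -
    rsum (fun a => p ord0 a * heat (t + v') (x + xi ord0 a))) <= INR n * lind_const.
  rewrite Eprod_S -rsum_sub; apply: Rle_trans (Rabs_rsum _) _.
  rewrite -[X in _ <= X]Rmult_1_r -p1 -rsum_mull; apply: rsum_le => a.
  rewrite -Rmult_minus_distr_l Rabs_mult (Rabs_pos_eq (p ord0 a)) // Rmult_comm.
  apply: Rmult_le_compat_r => //.
  rewrite (@Eprod_ext _ _ _ _ (fun y => heat t (x + xi ord0 a + coord_sum xi' y))); last first.
    by move=> y; rewrite coord_sum_S Rplus_assoc.
  by apply: IH => // i b; exact: hm.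
have h2 : Rabs (rsum (fun a => p ord0 a * heat (t + v') (x + xi ord0 a)) -
    heat (t + v' + rsum (fun a => p ord0 a * Rsqr (xi ord0 a))) x) <= lind_const.
  by apply: lindeberg_step => //; [lra|exact: hm].
rewrite S_INR (_ : t + (_ + v') = t + v' + rsum (fun a => p ord0 a * Rsqr (xi ord0 a))); last by ring.
by rewrite Rmult_plus_distr_r; split_Rabs; lra.
Qed.
End Lindeberg.

Lemma inv_sqrt_lip v0 s t : 0 < v0 -> v0 <= s -> v0 <= t ->
  Rabs (/ sqrt s - / sqrt t) <= Rabs (s - t) / (v0 * sqrt v0).
Proof.
move=> h0 hs ht.
have a0 : 0 < sqrt v0 by exact: sqrt_lt_R0.
have as_ : sqrt v0 <= sqrt s by exact: sqrt_le_1_alt.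
have at_ : sqrt v0 <= sqrt t by exact: sqrt_le_1_alt.
have es : sqrt s * sqrt s = s by apply: sqrt_sqrt; lra.
have et : sqrt t * sqrt t = t by apply: sqrt_sqrt; lra.
have e0 : sqrt v0 * sqrt v0 = v0 by apply: sqrt_sqrt; lra.
have -> : / sqrt s - / sqrt t = (t - s) * / (sqrt s * sqrt t * (sqrt s + sqrt t)).
  have -> : t - s = (sqrt t - sqrt s) * (sqrt t + sqrt s) by nra.
  by field; lra.
have p1 : v0 <= sqrt s * sqrt t by rewrite -e0; apply: Rmult_le_compat; lra.
rewrite Rabs_mult Rabs_minus_sym /Rdiv; apply: Rmult_le_compat_l; first exact: Rabs_pos.
rewrite Rabs_pos_eq; last by left; apply: Rinv_0_lt_compat; nra.
apply: Rinv_le_contravar; first nra.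
by apply: Rmult_le_compat; lra.
Qed.

Theorem uniform_clt (T : finType) (M v0 b eta : R) : 0 <= M -> 0 < v0 -> 0 < eta ->
  exists N : nat, forall n, (N <= n)%N -> forall p xi : 'I_n -> T -> R,
    is_prod_distr p -> centered p xi -> (forall i a, 0 < p i a -> Rabs (xi i a) <= M) ->
    INR n * v0 <= var_sum p xi ->
    Rabs (Eprod p (fun y => ind (leR (coord_sum xi y) (b * sqrt (INR n)))) -
          Phi (b / sqrt (var_sum p xi / INR n))) <= eta.
Proof.
move=> M0 v00 eta0.
have [|L [L0 /(_ L (Rle_refl L)) [tl1 tl2]]] := @Phi_tail (eta / 3); first lra.
have sv0 : 0 < sqrt v0 by exact: sqrt_lt_R0.
have vv : 0 < v0 * sqrt v0 by nra.
(* [d * K0] will bound, in [near], the change of [Phi] when the variance grows by [eps] and the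
   threshold moves by at most [kap]. *)
pose K0 := Rabs b / (v0 * sqrt v0) + L / sqrt v0 + 1.
have q1 : 0 <= Rabs b / (v0 * sqrt v0) by apply: Rmult_le_pos; [exact: Rabs_pos|left; exact: Rinv_0_lt_compat].
have q2 : 0 <= L / sqrt v0 by apply: Rmult_le_pos; [lra|left; exact: Rinv_0_lt_compat].
have K00 : 1 <= K0 by rewrite /K0; lra.
have [d [d0 d1 dK]] : exists d, [/\ 0 < d, d <= 1 & d * K0 <= eta / 3].
  exists (Rmin 1 (eta / 3 / K0)); split; [|exact: Rmin_l|].
    by apply: Rmin_glb_lt; [lra|apply: Rdiv_lt_0_compat; lra].
  apply: Rle_trans (Rmult_le_compat_r K0 _ _ _ (Rmin_r _ _)) _; first lra.
  by right; field; lra.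
(* [heat eps] is a step of width [sqrt eps = d]. Shifting its threshold by [kap = d * L] makes it at
   least [Phi L] on the event, or at most [Phi (- L)] off it. The thirds of [eta] go to this
   smoothing, to the Lindeberg error and to [near]. *)
pose eps := d * d; pose kap := d * L.
have eps0 : 0 < eps by rewrite /eps; nra.
have seps : sqrt eps = d by rewrite /eps sqrt_square; lra.
pose c1 := 3 / (eps * sqrt eps) * (M * M * M); pose c2 := 7 / (eps * eps) * (M * M * (M * M)).
have c10 : 0 <= c1.
  apply: Rmult_le_pos; last by do !apply: Rmult_le_pos.
  by left; apply: Rdiv_lt_0_compat; [lra|rewrite seps; nra].
have c20 : 0 <= c2.
  apply: Rmult_le_pos; last by do !apply: Rmult_le_pos.
  by left; apply: Rdiv_lt_0_compat; [lra|nra].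
pose r := 3 * (c1 + c2) / eta.
have r0 : 0 <= r by apply: Rmult_le_pos; [lra|left; exact: Rinv_0_lt_compat].
have [N hN] := exists_INR_gt (r * r + 1).
exists N => n /leP/le_INR Nn p xi hp hc hm hv.
have n1 : 1 <= INR n by nra.
have sn1 : 1 <= sqrt (INR n) by rewrite -sqrt_1; exact: sqrt_le_1_alt.
have snn : sqrt (INR n) * sqrt (INR n) = INR n by apply: sqrt_sqrt; lra.
have rn : r <= sqrt (INR n).
  by rewrite -(sqrt_square r) //; apply: sqrt_le_1_alt; lra.
set s := sqrt (INR n) in sn1 snn rn *.
set tau := var_sum p xi / INR n.
have tauv : v0 <= tau.
  by apply: (Rmult_le_reg_r (INR n)); [lra|rewrite /tau /Rdiv Rmult_assoc Rinv_l; lra].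
(* The sign is reversed so that [heat eps (b + coord_sum zeta y)] approximates the indicator of
   [coord_sum xi y <= b * s]. After division by [s] the total Lindeberg error is
   [c1 / s + c2 / (s * s)]. *)
pose zeta i a := - (/ s * xi i a).
have hcz : centered p zeta.
  move=> i; rewrite (@rsum_ext _ _ (fun a => - / s * (p i a * xi i a))); last by move=> a; rewrite /zeta; ring.
  by rewrite rsum_mull hc; ring.
have hmz i a : 0 < p i a -> Rabs (zeta i a) <= M / s.
  move=> /hm h; rewrite /zeta Rabs_Ropp Rabs_mult Rmult_comm (Rabs_pos_eq (/ s)); last by left; apply: Rinv_0_lt_compat; lra.
  by apply: Rmult_le_compat_r => //; left; apply: Rinv_0_lt_compat; lra.
have hvz : var_sum p zeta = tau.
  rewrite /tau /var_sum /Rdiv -rsum_mulr; apply: rsum_ext => i; rewrite -rsum_mulr; apply: rsum_ext => a.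
  by rewrite /zeta /Rsqr -snn; field; lra.
have hsz y : coord_sum zeta y = - (coord_sum xi y / s).
  rewrite /coord_sum /zeta rsum_opp rsum_mull /Rdiv; ring.
have ms0 : 0 <= M / s by apply: Rmult_le_pos => //; left; apply: Rinv_0_lt_compat; lra.
have Lind x := lindeberg eps0 ms0 x hp hcz (Rle_refl eps) hmz.
have err : INR n * lind_const eps (M / s) <= eta / 3.
  have -> : INR n * lind_const eps (M / s) = c1 / s + c2 / (s * s).
    by rewrite /lind_const -snn -/c1 /c1 /c2; field; rewrite seps; lra.
  have h3 : c2 / (s * s) <= c2 / s.
    by apply: Rmult_le_compat_l => //; apply: Rinv_le_contravar; nra.
  apply: Rle_trans (_ : _ <= (c1 + c2) / s) _; first by rewrite /Rdiv in h3 *; lra.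
  apply: (Rmult_le_reg_r s); first lra.
  rewrite /Rdiv Rmult_assoc Rinv_l; last by lra.
  have : eta * r = 3 * (c1 + c2) by rewrite /r; field; lra.
  by nra.
rewrite hvz in Lind.
have near k : Rabs k <= kap -> Rabs (Phi ((b + k) / sqrt (eps + tau)) - Phi (b / sqrt tau)) <= eta / 3.
  move=> hk; apply: Rle_trans (Phi_lip _ _) _; apply: Rle_trans dK.
  have -> : (b + k) / sqrt (eps + tau) - b / sqrt tau =
     b * (/ sqrt (eps + tau) - / sqrt tau) + k * / sqrt (eps + tau) by rewrite /Rdiv; ring.
  apply: Rle_trans (Rabs_triang _ _) _; rewrite !Rabs_mult.
  have i1 : / sqrt (eps + tau) <= / sqrt v0.
    by apply: Rinv_le_contravar => //; apply: sqrt_le_1_alt; lra.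
  have i0 : 0 < / sqrt (eps + tau) by apply: Rinv_0_lt_compat; apply: sqrt_lt_R0; lra.
  have i2 : Rabs (/ sqrt (eps + tau) - / sqrt tau) <= eps / (v0 * sqrt v0).
    have := @inv_sqrt_lip v0 (eps + tau) tau v00.
    rewrite (_ : eps + tau - tau = eps); last by ring.
    by rewrite (Rabs_pos_eq eps); [apply; lra|lra].
  have j1 : Rabs b * Rabs (/ sqrt (eps + tau) - / sqrt tau) <= Rabs b / (v0 * sqrt v0) * eps.
    apply: Rle_trans (Rmult_le_compat_l _ _ _ (Rabs_pos b) i2) _; right; field; lra.
  have j2 : Rabs k * Rabs (/ sqrt (eps + tau)) <= L / sqrt v0 * d.
    rewrite (Rabs_pos_eq (/ _)); last by lra.
    apply: Rle_trans (Rmult_le_compat _ _ _ _ (Rabs_pos k) (Rlt_le _ _ i0) hk i1) _.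
    by rewrite /kap; right; field; lra.
  have j3 : Rabs b / (v0 * sqrt v0) * eps <= Rabs b / (v0 * sqrt v0) * d.
    by apply: Rmult_le_compat_l => //; rewrite /eps; nra.
  by rewrite /K0; nra.
have heatL : forall x, heat eps x = Phi (x / d) by move=> x; rewrite /heat seps.
pose P := Eprod p (fun y => ind (leR (coord_sum xi y) (b * s))).
have P01 : 0 <= P <= 1.
  split.
    by rewrite -(Eprod_const 0 hp); apply: Eprod_le => // y _; case: (ind_01 (leR (coord_sum xi y) (b * s))).
  by rewrite -(Eprod_const 1 hp); apply: Eprod_le => // y _; case: (ind_01 (leR (coord_sum xi y) (b * s))).
have kd : kap / d = L by rewrite /kap; field; lra.
have id0 : 0 < / d by exact: Rinv_0_lt_compat.
have up : Phi L * P <= Eprod p (fun y => heat eps (b + kap + coord_sum zeta y)).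
  rewrite -Eprod_mull; apply: Eprod_le => // y _; rewrite heatL hsz.
  case: leRP => h /=; last by have := Phi_bound ((b + kap + - (coord_sum xi y / s)) / d); lra.
  rewrite Rmult_1_r -kd; apply: Phi_le; rewrite /Rdiv; apply: Rmult_le_compat_r; first lra.
  suff : coord_sum xi y / s <= b by rewrite /Rdiv; lra.
  by apply: (Rmult_le_reg_r s); [lra|rewrite /Rdiv Rmult_assoc Rinv_l; lra].
have lo : Eprod p (fun y => heat eps (b - kap + coord_sum zeta y)) <= P + Phi (- L).
  rewrite -(Eprod_const (Phi (- L)) hp) -Eprod_add; apply: Eprod_le => // y _; rewrite heatL hsz.
  case: leRP => h /=.
    by have := Phi_bound ((b - kap + - (coord_sum xi y / s)) / d); have := Phi_bound (- L); lra.
  rewrite Rplus_0_l -kd; apply: Phi_le; rewrite /Rdiv (Ropp_mult_distr_l kap); apply: Rmult_le_compat_r; first lra.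
  suff : b <= coord_sum xi y / s by rewrite /Rdiv; lra.
  by apply: (Rmult_le_reg_r s); [lra|rewrite /Rdiv Rmult_assoc Rinv_l; lra].
have kap0 : 0 <= kap by rewrite /kap; nra.
have near1 : Rabs (heat (eps + tau) (b + kap) - Phi (b / sqrt tau)) <= eta / 3.
  by apply: near; rewrite Rabs_pos_eq; lra.
have near2 : Rabs (heat (eps + tau) (b - kap) - Phi (b / sqrt tau)) <= eta / 3.
  by apply: near; rewrite Rabs_Ropp Rabs_pos_eq; lra.
have l1 := Rle_trans _ _ _ (Lind (b + kap)) err; have l2 := Rle_trans _ _ _ (Lind (b - kap)) err.
have tb := Phi_bound L.
have PL : P <= Phi L * P + eta / 3 by nra.
by apply: Rabs_le; move: near1 near2 l1 l2; rewrite -/P; split_Rabs; lra.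
Qed.

(** * Relative entropy and compactness *)

Lemma ln_le_sub1 z : 0 < z -> ln z <= z - 1.
Proof. by move=> z0; have := exp_ineq1_le (ln z); rewrite exp_ln //; lra. Qed.

Lemma ln_eq_sub1 z : 0 < z -> ln z = z - 1 -> z = 1.
Proof.
move=> z0 e; case: (Req_dec (ln z) 0) => [h|h]; first lra.
by have := exp_ineq1 _ h; rewrite exp_ln //; lra.
Qed.

Lemma outdist_distr (X Y : finType) (W : X -> Y -> R) P :
  is_channel W -> is_distr P -> is_distr (outdist W P).
Proof.
move=> HW [p0 p1]; split.
  by move=> y; apply: rsum_ge0 => x; apply: Rmult_le_pos => //; case: (HW x).
rewrite /outdist rsum_exch -p1; apply: rsum_ext => x; rewrite rsum_mull.
by case: (HW x) => _ ->; ring.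
Qed.

Lemma distr_le1 (T : finType) (P : T -> R) x : is_distr P -> P x <= 1.
Proof. by move=> [p0 p1]; rewrite -p1; exact: rsum_ge_term. Qed.

(** Absolute continuity. [relent] is real-valued: where [S] vanishes and [Q] does not, its term is a
    default value instead of plus infinity, and this case must be excluded. *)
Definition dominated (T : finType) (Q S : T -> R) := forall y, 0 < Q y -> 0 < S y.

Section Gibbs.
Variables (Y : finType) (Q S : Y -> R).
Hypotheses (Q0 : forall y, 0 <= Q y) (S0 : forall y, 0 <= S y) (dom : dominated Q S).

(** From [ln z <= z - 1] at [z = S y / Q y]. The termwise form is kept because its equality case
    identifies the two laws in [gibbs_eq]. *)
Lemma gibbs_term y : Q y - S y <= Q y * ln (Q y / S y).
Proof.
case: (Rle_lt_or_eq_dec _ _ (Q0 y)) => [q|<-]; last by have := S0 y; lra.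
have s := dom q; have h := ln_le_sub1 (Rdiv_lt_0_compat _ _ s q).
have -> : ln (Q y / S y) = - ln (S y / Q y) by rewrite !ln_div //; ring.
have := Rmult_le_compat_l _ _ _ (Rlt_le _ _ q) h.
by rewrite Rmult_minus_distr_l (_ : Q y * (S y / Q y) = S y); [lra|field; lra].
Qed.

Lemma gibbs : rsum S <= rsum Q -> 0 <= relent Q S.
Proof.
move=> h; apply: Rle_trans (rsum_le gibbs_term); rewrite rsum_sub; lra.
Qed.

Lemma gibbs_eq : rsum S = rsum Q -> relent Q S = 0 -> forall y, Q y = S y.
Proof.
move=> h e y.
have z : Q y * ln (Q y / S y) - (Q y - S y) = 0.
  apply: (@rsum_eq0 _ (fun y => Q y * ln (Q y / S y) - (Q y - S y))).
    by move=> u; have := gibbs_term u; lra.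
  by rewrite !rsum_sub -/(relent Q S) e h; lra.
case: (Rle_lt_or_eq_dec _ _ (Q0 y)) => [q|q]; last by rewrite -q in z *; lra.
have s := dom q; have r := Rdiv_lt_0_compat _ _ s q.
have : ln (S y / Q y) = S y / Q y - 1.
  have -> : ln (S y / Q y) = - ln (Q y / S y) by rewrite !ln_div //; ring.
  by apply: (Rmult_eq_reg_l (Q y)); [field_simplify; lra|lra].
move=> /(ln_eq_sub1 r) w.
by rewrite (_ : S y = S y / Q y * Q y); [rewrite w; ring|field; lra].
Qed.
End Gibbs.

Section Comp.
Variables (X Y : finType) (W : X -> Y -> R).
Hypothesis HW : is_channel W.
Let W0 x y : 0 <= W x y. Proof. by case: (HW x). Qed.

Lemma outdist_pos P x y : is_distr P -> 0 < P x -> 0 < W x y -> 0 < outdist W P y.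
Proof.
move=> [p0 _] px wxy; apply: Rlt_le_trans (_ : P x * W x y <= _); first exact: Rmult_lt_0_compat.
by apply: (@rsum_ge_term _ x (fun x => P x * W x y)) => z; exact: Rmult_le_pos.
Qed.

Lemma mutinfE P : mutinf P W = expect P (fun x => relent (W x) (outdist W P)).
Proof. by []. Qed.

(** The compensation identity: ln (W/S) splits as ln (W/PW) + ln (PW/S), and the last term depends
    on the output only. *)
Lemma compensation P S : is_distr P -> dominated (outdist W P) S ->
  expect P (fun x => relent (W x) S) = mutinf P W + relent (outdist W P) S.
Proof.
move=> hP dom; have [p0 _] := hP.
have -> : relent (outdist W P) S =
    rsum (fun x => rsum (fun y => P x * W x y * ln (outdist W P y / S y))).
  by rewrite rsum_exch; apply: rsum_ext => y; rewrite rsum_mulr.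
rewrite /mutinf -rsum_add; apply: rsum_ext => x.
rewrite /relent -!rsum_mull -rsum_add; apply: rsum_ext => y.
case: (Rle_lt_or_eq_dec _ _ (p0 x)) => [px|<-]; last by ring.
case: (Rle_lt_or_eq_dec _ _ (W0 x y)) => [wxy|<-]; last by ring.
have o := outdist_pos hP px wxy; have s := dom _ o.
by rewrite !ln_div //; ring.
Qed.

Definition xlnx u := u * ln u.

(** A form in which continuity in [P] is visible: the logarithm of the output law appears only
    inside [xlnx], which is continuous on the closed half-line, up to zero. *)
Lemma mutinf_entropy P : is_distr P ->
  mutinf P W = rsum (fun x => P x * rsum (fun y => xlnx (W x y))) - rsum (fun y => xlnx (outdist W P y)).
Proof.
move=> hP; have [p0 _] := hP.
have -> : rsum (fun y => xlnx (outdist W P y)) =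
    rsum (fun x => rsum (fun y => P x * W x y * ln (outdist W P y))).
  by rewrite rsum_exch; apply: rsum_ext => y; rewrite rsum_mulr.
rewrite /mutinf -rsum_sub; apply: rsum_ext => x.
rewrite /relent -!rsum_mull -rsum_sub; apply: rsum_ext => y.
case: (Rle_lt_or_eq_dec _ _ (p0 x)) => [px|<-]; last by ring.
case: (Rle_lt_or_eq_dec _ _ (W0 x y)) => [wxy|<-]; last by rewrite /xlnx; ring.
have o := outdist_pos hP px wxy.
by rewrite ln_div // /xlnx; ring.
Qed.
End Comp.

(** * Sequential limits and compactness of the cube *)

Lemma is_lim_rsum (T : finType) (u : nat -> T -> R) (l : T -> R) :
  (forall x, is_lim_seq (fun k => u k x) (l x)) -> is_lim_seq (fun k => rsum (u k)) (rsum l).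
Proof.
move=> h; rewrite /rsum; elim: (index_enum T) => [|x s IH].
  by rewrite big_nil; apply: (is_lim_seq_ext (fun _ => 0)) => [k|]; [rewrite big_nil|exact: is_lim_seq_const].
rewrite big_cons; apply: (is_lim_seq_ext (fun k => u k x + \big[Rplus/0]_(j <- s) u k j)).
  by move=> k; rewrite big_cons.
exact: is_lim_seq_plus'.
Qed.

(** Write [ln u] as [- 2 * ln (/ sqrt u)] and apply [ln z <= z - 1] to [/ sqrt u]. *)
Lemma xlnx_small u : 0 <= u <= 1 -> Rabs (xlnx u) <= 2 * sqrt u.
Proof.
move=> [u0 u1]; case: (Rle_lt_or_eq_dec _ _ u0) => [p|<-]; last first.
  by rewrite /xlnx Rmult_0_l Rabs_R0 sqrt_0; lra.
have s0 := sqrt_lt_R0 _ p; have ss : sqrt u * sqrt u = u by apply: sqrt_sqrt.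
have e : ln u = - (2 * ln (/ sqrt u)) by rewrite ln_Rinv // -{1}ss ln_mult //; ring.
have h := ln_le_sub1 (Rinv_0_lt_compat _ s0).
have l : ln u <= 0 by rewrite -ln_1; case: u1 => [q|->]; [left; exact: ln_increasing|lra].
rewrite /xlnx Rabs_left1; last by nra.
have i : sqrt u * / sqrt u = 1 by field; lra.
rewrite -{1}ss e; nra.
Qed.

Lemma is_lim_xlnx (u : nat -> R) (l : R) : (forall k, 0 <= u k) -> is_lim_seq u l ->
  is_lim_seq (fun k => xlnx (u k)) (xlnx l).
Proof.
move=> u0 hl.
have l0 : 0 <= l.
  have := @is_lim_seq_le (fun _ => 0) u 0 l (fun k => u0 k) (is_lim_seq_const 0) hl.
  by [].
case: (Rle_lt_or_eq_dec _ _ l0) => [p|e].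
  apply: (is_lim_seq_continuous xlnx) => //.
  apply/continuity_pt_filterlim; apply: ex_derive_continuous.
  by rewrite /xlnx; auto_derive.
rewrite -e in hl *; rewrite {2}/xlnx Rmult_0_l.
have hs : is_lim_seq (fun k => 2 * sqrt (u k)) 0.
  rewrite (_ : 0 = 2 * sqrt 0); last by rewrite sqrt_0; ring.
  apply: (is_lim_seq_scal_l _ 2 (sqrt 0)); apply: (is_lim_seq_continuous sqrt) => //.
  exact: continuity_pt_sqrt (Rle_refl 0).
apply/is_lim_seq_abs_0.
apply: (is_lim_seq_le_le_loc (fun _ => 0) _ (fun k => 2 * sqrt (u k))) => //; last exact: is_lim_seq_const.
have [N hN] : eventually (fun k => u k < 1).
  by apply: (hl (fun v => v < 1)); exact: (open_lt 1 0 Rlt_0_1).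
exists N => k /hN h; split; first exact: Rabs_pos.
by apply: xlnx_small; have := u0 k; lra.
Qed.

(** The condition [k <= s k] replaces strict monotonicity: it sends [s k] to infinity, is easy to
    obtain by choice, and is stable under composition. *)
Lemma subseq_lim (u : nat -> R) (l : R) (s : nat -> nat) : (forall k, (k <= s k)%N) ->
  is_lim_seq u l -> is_lim_seq (fun k => u (s k)) l.
Proof.
move=> hs hl; apply: (is_lim_seq_subseq u l s) => // A [N hN].
exists N => k hk; apply: hN; apply: PeanoNat.Nat.le_trans hk _; exact/leP.
Qed.

Lemma is_lim_seq_invS : is_lim_seq (fun k => / (INR k + 1)) 0.
Proof.
apply: (is_lim_seq_inv _ p_infty) => //.
apply: (is_lim_seq_plus _ _ p_infty 1) => //; [exact: is_lim_seq_INR|exact: is_lim_seq_const].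
Qed.

Lemma invS_pos k : 0 < / (INR k + 1).
Proof. by apply: Rinv_0_lt_compat; have := pos_INR k; lra. Qed.

Lemma choose_seq (A : Type) (R0 : nat -> A -> Prop) : (forall k, exists a, R0 k a) ->
  exists s : nat -> A, forall k, R0 k (s k).
Proof.
move=> h; exists (fun k => proj1_sig (constructive_indefinite_description _ (h k))) => k.
by case: constructive_indefinite_description.
Qed.

Lemma unit_bounded_subseq (u : nat -> R) : (forall k, 0 <= u k <= 1) ->
  exists s : nat -> nat, (forall k, (k <= s k)%N) /\ exists l : R, is_lim_seq (fun k => u (s k)) l.
Proof.
move=> hu; have [l hl] := @Bolzano_Weierstrass u _ (compact_P3 0 1) hu.
have /choose_seq [s hs] : forall k, exists p, (k <= p)%N /\ Rabs (u p - l) < / (INR k + 1).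
  move=> k; have [|p [kp hp]] := hl (fun v => Rabs (v - l) < / (INR k + 1)) k.
    by exists (mkposreal _ (invS_pos k)).
  by exists p; split=> //; exact/leP.
exists s; split; first by move=> k; case: (hs k).
exists l.
apply: (is_lim_seq_ext (fun k => (u (s k) - l) + l)); first by move=> k; ring.
rewrite -[X in is_lim_seq _ (Rbar.Finite X)]Rplus_0_l; apply: is_lim_seq_plus'; last exact: is_lim_seq_const.
apply/is_lim_seq_abs_0; apply: (is_lim_seq_le_le (fun _ => 0) _ (fun k => / (INR k + 1))).
- by move=> k; split; [exact: Rabs_pos|left; case: (hs k)].
- exact: is_lim_seq_const.
- exact: is_lim_seq_invS.
Qed.

(** Subsequences are extracted one letter at a time; the limits already obtained survive by
    [subseq_lim]. *)
Lemma cube_compact (X : finType) (P : nat -> X -> R) : (forall k x, 0 <= P k x <= 1) ->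
  exists s : nat -> nat, (forall k, (k <= s k)%N) /\
  exists L : X -> R, forall x, is_lim_seq (fun k => P (s k) x) (L x).
Proof.
move=> hP.
suff [s [hs H]] : exists s : nat -> nat, (forall k, (k <= s k)%N) /\
    forall x, x \in enum X -> exists l : R, is_lim_seq (fun k => P (s k) x) l.
  exists s; split=> //.
  exists (fun x => proj1_sig (constructive_indefinite_description _ (H x (mem_enum _ x)))) => x.
  by case: constructive_indefinite_description.
elim: (enum X) => [|z r [s [hs H]]]; first by exists id.
have [s' [hs' [l hl]]] := @unit_bounded_subseq (fun k => P (s k) z) (fun k => hP (s k) z).
exists (fun k => s (s' k)); split; first by move=> k; exact: leq_trans (hs' k) (hs _).
move=> x; rewrite inE => /orP[/eqP ->|/H [m hm]]; first by exists l.
by exists m; exact: (subseq_lim hs' hm).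
Qed.

Definition seq_closed (X : finType) (S : (X -> R) -> Prop) :=
  forall (P : nat -> X -> R) (L : X -> R), (forall k, S (P k)) ->
    (forall x, is_lim_seq (fun k => P k x) (L x)) -> S L.

Definition seq_cont (X : finType) (S : (X -> R) -> Prop) (f : (X -> R) -> R) :=
  forall (P : nat -> X -> R) (L : X -> R), (forall k, S (P k)) ->
    (forall x, is_lim_seq (fun k => P k x) (L x)) -> is_lim_seq (fun k => f (P k)) (f L).

Lemma compact_max (X : finType) (S : (X -> R) -> Prop) (f : (X -> R) -> R) :
  (forall P, S P -> forall x, 0 <= P x <= 1) -> seq_closed S -> seq_cont S f ->
  (exists P, S P) -> exists P, S P /\ forall Q, S Q -> f Q <= f P.
Proof.
move=> hb hc hf [P0 hP0].
have ext (P : nat -> X -> R) : (forall k, S (P k)) -> exists s : nat -> nat, exists L,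
    [/\ forall k, (k <= s k)%N, S L & is_lim_seq (fun k => f (P (s k))) (f L)].
  move=> hP; have [s [hs [L hL]]] := cube_compact (fun k => hb _ (hP k)).
  by exists s, L; split=> //; [exact: (hc (fun k => P (s k)) L (fun k => hP _) hL)|exact: (hf (fun k => P (s k)) L (fun k => hP _) hL)].
pose E v := exists P, S P /\ v = f P.
have bd : bound E.
  apply: NNPP => nb.
  have /choose_seq [P hP] : forall k, exists P, S P /\ INR k < f P.
    move=> k; apply: NNPP => no; apply: nb; exists (INR k) => v [P [sP ->]].
    by case: (Rle_lt_dec (f P) (INR k)) => // h; case: no; exists P.
  have [s [L [hs _ hl]]] := ext P (fun k => (hP k).1).
  have := @is_lim_seq_le INR _ p_infty _ _ is_lim_seq_INR hl; apply => k.
  have [_ h] := hP (s k); have := le_INR _ _ (leP (hs k)); lra.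
have [m [ub lub]] : {m | is_lub E m} by apply: completeness => //; exists (f P0), P0.
have /choose_seq [P hP] : forall k, exists P, S P /\ m - / (INR k + 1) < f P.
  move=> k; apply: NNPP => no.
  have : m <= m - / (INR k + 1).
    apply: lub => v [P [sP ->]].
    by case: (Rle_lt_dec (f P) (m - / (INR k + 1))) => // h; case: no; exists P.
  by have := invS_pos k; lra.
have [s [L [hs sL hl]]] := ext P (fun k => (hP k).1).
exists L; split=> // Q sQ; apply: Rle_trans (ub _ (ex_intro _ Q (conj sQ erefl))) _.
have hm : is_lim_seq (fun k => m - / (INR k + 1)) m.
  rewrite -[X in is_lim_seq _ (Rbar.Finite X)]Rminus_0_r.
  by apply: is_lim_seq_minus'; [exact: is_lim_seq_const|exact: is_lim_seq_invS].
apply: (@is_lim_seq_le (fun k => m - / (INR (s k) + 1)) (fun k => f (P (s k))) m (f L)) => //.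
  by move=> k; have [_] := hP (s k); lra.
exact: (subseq_lim hs hm).
Qed.

(** * Capacity, saddle point and dispersion *)

Lemma is_lim_ge (u : nat -> R) (l a : R) : (forall k, a <= u k) -> is_lim_seq u l -> a <= l.
Proof. by move=> h hl; exact: (@is_lim_seq_le (fun _ => a) u a l h (is_lim_seq_const a) hl). Qed.

Lemma is_lim_le (u : nat -> R) (l a : R) : (forall k, u k <= a) -> is_lim_seq u l -> l <= a.
Proof. by move=> h hl; exact: (@is_lim_seq_le u (fun _ => a) l a h hl (is_lim_seq_const a)). Qed.

Lemma is_lim_const_eq (u : nat -> R) (l a : R) : (forall k, u k = a) -> is_lim_seq u l -> l = a.
Proof. by move=> h hl; apply: Rle_antisym; [apply: is_lim_le hl|apply: is_lim_ge hl] => k; rewrite h; lra. Qed.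

Lemma is_lim_expect (X : finType) (P : nat -> X -> R) (L f : X -> R) :
  (forall x, is_lim_seq (fun k => P k x) (L x)) ->
  is_lim_seq (fun k => expect (P k) f) (expect L f).
Proof.
move=> h; apply: is_lim_rsum => x.
by apply: (is_lim_seq_mult' (fun k => P k x) (fun _ => f x) (L x) (f x)); [exact: h|exact: is_lim_seq_const].
Qed.

Lemma expect_le (X : finType) (P f g : X -> R) : (forall x, 0 <= P x) ->
  (forall x, 0 < P x -> f x <= g x) -> expect P f <= expect P g.
Proof.
move=> p0 h; apply: rsum_le => x.
case: (Rle_lt_or_eq_dec _ _ (p0 x)) => [px|<-]; last lra.
by apply: Rmult_le_compat_l; [lra|exact: h].
Qed.

Section Cap.
Variables (X Y : finType) (W : X -> Y -> R) (c : X -> R) (K : R).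
Hypothesis HW : is_channel W.
Hypothesis Hfeas : exists P : X -> R, feasible c K P.

Let W0 x y : 0 <= W x y. Proof. by case: (HW x). Qed.

Lemma feasible_bound P : feasible c K P -> forall x, 0 <= P x <= 1.
Proof. by move=> [hP _] x; split; [case: hP|exact: distr_le1]. Qed.

Lemma feasible_closed : seq_closed (feasible c K).
Proof.
move=> P L hP hL; split; first split.
- by move=> x; apply: (is_lim_ge _ (hL x)) => k; case: (hP k) => -[].
- by apply: (@is_lim_const_eq (fun k => rsum (P k))); [move=> k; case: (hP k) => -[]|exact: is_lim_rsum].
- by apply: (@is_lim_le (fun k => expect (P k) c)); [move=> k; case: (hP k)|exact: is_lim_expect].
Qed.

Lemma mutinf_cont : seq_cont (feasible c K) (fun P => mutinf P W).
Proof.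
move=> P L hP hL; have hLf := feasible_closed hP hL.
have ho y : is_lim_seq (fun k => outdist W (P k) y) (outdist W L y).
  exact: (@is_lim_expect X P L (fun x => W x y) hL).
rewrite mutinf_entropy //; last by case: hLf.
apply: (is_lim_seq_ext (fun k => expect (P k) (fun x => rsum (fun y => xlnx (W x y))) -
    rsum (fun y => xlnx (outdist W (P k) y)))).
  by move=> k; rewrite mutinf_entropy //; case: (hP k).
apply: is_lim_seq_minus'; first exact: is_lim_expect.
apply: is_lim_rsum => y; apply: is_lim_xlnx => // k.
by have [h _] := hP k; case: (outdist_distr HW h).
Qed.

Lemma capacity_spec :
  (exists P, feasible c K P /\ mutinf P W = capacity W c K) /\
  (forall P, feasible c K P -> mutinf P W <= capacity W c K).
Proof.
apply: (epsilon_spec (inhabits 0) (fun C =>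
    (exists P, feasible c K P /\ mutinf P W = C) /\
    (forall P, feasible c K P -> mutinf P W <= C))).
have [P [hP hm]] := compact_max feasible_bound feasible_closed mutinf_cont Hfeas.
by exists (mutinf P W); split=> //; exists P.
Qed.

Definition mix (t : R) (P Q : X -> R) (x : X) := (1 - t) * P x + t * Q x.

Lemma expect_mix t P Q f : expect (mix t P Q) f = (1 - t) * expect P f + t * expect Q f.
Proof. by rewrite /expect -!rsum_mull -rsum_add; apply: rsum_ext => x; rewrite /mix; ring. Qed.

Lemma mix_feasible t P Q : 0 <= t <= 1 -> feasible c K P -> feasible c K Q -> feasible c K (mix t P Q).
Proof.
move=> ht [[p0 p1] pc] [[q0 q1] qc]; split; first split.
- by move=> x; rewrite /mix; have := p0 x; have := q0 x; nra.
- by rewrite /mix rsum_add !rsum_mull p1 q1; ring.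
- by rewrite expect_mix; nra.
Qed.

Lemma outdist_mix t P Q y : outdist W (mix t P Q) y = (1 - t) * outdist W P y + t * outdist W Q y.
Proof. exact: expect_mix. Qed.

Lemma distr_feasible P : feasible c K P -> is_distr P. Proof. by case. Qed.

Section CapPoint.
Variable P0 : X -> R.
Hypothesis hP0 : cap_achieving W c K P0.
Let f0 : feasible c K P0. Proof. by case: hP0. Qed.
Let d0 := distr_feasible f0.

Lemma mix_dominated t P : 0 < t < 1 -> feasible c K P ->
  dominated (outdist W P) (outdist W (mix t P0 P)) /\ dominated (outdist W P0) (outdist W (mix t P0 P)).
Proof.
move=> ht hP.
have [o1 _] := outdist_distr HW d0; have [o2 _] := outdist_distr HW (distr_feasible hP).
by split=> y; rewrite outdist_mix; have := o1 y; have := o2 y; nra.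
Qed.

(* Optimality of P0 along the segment towards P. *)
Lemma segment_bound t P : 0 < t < 1 -> feasible c K P ->
  mutinf P W + relent (outdist W P) (outdist W (mix t P0 P)) <= capacity W c K.
Proof.
move=> ht hP; have [dom1 dom2] := mix_dominated ht hP.
have hM : feasible c K (mix t P0 P) by apply: mix_feasible => //; lra.
have [_ /(_ _ hM)] := capacity_spec.
rewrite mutinfE expect_mix (compensation HW d0 dom2) (compensation HW (distr_feasible hP) dom1).
have [_ ->] := hP0.
have [o1 s1] := outdist_distr HW d0; have [o2 s2] := outdist_distr HW (distr_feasible hM).
have := gibbs o1 o2 dom2; rewrite s1 s2 => /(_ (Rle_refl 1)); nra.
Qed.

(** If the law of [P0] missed an output [y0] reached by [P], the mixture would give it mass [t * w],
    and the divergence in [segment_bound] would grow like [w * ln (/ t)] as [t] tends to 0. *)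
Lemma capacity_dominated P : feasible c K P -> dominated (outdist W P) (outdist W P0).
Proof.
move=> hP y0 w0; have [o1 s1] := outdist_distr HW d0; have [o2 s2] := outdist_distr HW (distr_feasible hP).
case: (Rle_lt_or_eq_dec _ _ (o1 y0)) => // e; exfalso.
set w := outdist W P y0 in w0.
(* At [t = exp (- B)] the left side of [segment_bound] is at least [A + w * B], because the mixture
   has mass at most 1 at every other output. [B] is chosen so that this exceeds the capacity. *)
pose A := mutinf P W + rsum (fun y => xlnx (outdist W P y)).
pose B := (Rabs (capacity W c K - A) + 1) / w.
have B0 : 0 < B by apply: Rdiv_lt_0_compat => //; have := Rabs_pos (capacity W c K - A); lra.
have t1 : exp (- B) < 1 by rewrite -exp_0; apply: exp_increasing; lra.
have t0 := exp_pos (- B).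
have sb := segment_bound (conj t0 t1) hP.
suff : rsum (fun y => xlnx (outdist W P y)) + w * B <=
    relent (outdist W P) (outdist W (mix (exp (- B)) P0 P)).
  have : w * B = Rabs (capacity W c K - A) + 1 by rewrite /B; field; lra.
  have := Rle_abs (capacity W c K - A).
  by rewrite {1}/A; lra.
have xw : xlnx w <= 0.
  have := ln_le_sub1 w0; have := distr_le1 y0 (outdist_distr HW (distr_feasible hP)).
  by rewrite -/w /xlnx; nra.
rewrite /relent -(rsum_ind1 y0 (fun y => outdist W P y * B)) -rsum_add; apply: rsum_le => y.
case: (Rle_lt_or_eq_dec _ _ (o2 y)) => [wy|<-]; last by rewrite /xlnx; lra.
have my : 0 < outdist W (mix (exp (- B)) P0 P) y.
  by rewrite outdist_mix; have := o1 y; nra.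
rewrite ln_div //.
rewrite /ind1; case: eqP => [->|_].
  by rewrite outdist_mix -e -/w Rmult_0_r Rplus_0_l ln_mult // ln_exp; lra.
have m1 : outdist W (mix (exp (- B)) P0 P) y <= 1.
  by rewrite outdist_mix; have := distr_le1 y (outdist_distr HW d0); have := distr_le1 y (outdist_distr HW (distr_feasible hP)); nra.
have := ln_le_sub1 my; rewrite /xlnx; nra.
Qed.

(** [segment_bound] in the limit of small [t]: [ln z <= z - 1] shows that replacing the mixture by
    the law of [P0] raises the divergence by at most [t * rsum r]. *)
Lemma saddle P : feasible c K P ->
  expect P (fun x => relent (W x) (outdist W P0)) <= capacity W c K.
Proof.
move=> hP; have dom := capacity_dominated hP.
rewrite (compensation HW (distr_feasible hP) dom).
have [o1 s1] := outdist_distr HW d0; have [o2 s2] := outdist_distr HW (distr_feasible hP).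
pose r y := outdist W P y * (outdist W P y / outdist W P0 y).
have key t : 0 < t < 1 -> mutinf P W + relent (outdist W P) (outdist W P0) <= capacity W c K + t * rsum r.
  move=> ht; have := segment_bound ht hP; suff : relent (outdist W P) (outdist W P0) <=
     relent (outdist W P) (outdist W (mix t P0 P)) + t * rsum r by lra.
  rewrite -rsum_mull /relent -rsum_add; apply: rsum_le => y; rewrite /r.
  case: (Rle_lt_or_eq_dec _ _ (o2 y)) => [wy|<-]; last by lra.
  have q := dom _ wy; have [dm _] := mix_dominated ht hP; have my := dm _ wy.
  suff : ln (outdist W P y / outdist W P0 y) <=
     ln (outdist W P y / outdist W (mix t P0 P) y) + t * (outdist W P y / outdist W P0 y) by nra.
  rewrite !ln_div //.
  have := ln_le_sub1 (Rdiv_lt_0_compat _ _ my q); rewrite ln_div // outdist_mix.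
  have -> : ((1 - t) * outdist W P0 y + t * outdist W P y) / outdist W P0 y - 1 =
     t * (outdist W P y / outdist W P0 y) - t by field; lra.
  by lra.
have r0 : 0 <= rsum r.
  apply: rsum_ge0 => y; rewrite /r.
  case: (Rle_lt_or_eq_dec _ _ (o2 y)) => [wy|<-]; last by lra.
  have q := dom _ wy; have := Rdiv_lt_0_compat _ _ wy q; nra.
apply: Rnot_lt_le => lt.
pose g := mutinf P W + relent (outdist W P) (outdist W P0) - capacity W c K.
have g0 : 0 < g by rewrite /g; lra.
pose t := Rmin (1 / 2) (g / (2 * (rsum r + 1))).
have t0 : 0 < t by apply: Rmin_glb_lt; [lra|apply: Rdiv_lt_0_compat; lra].
have t1 : t <= 1 / 2 := Rmin_l _ _.
have t2 : t <= g / (2 * (rsum r + 1)) := Rmin_r _ _.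
have := key t; have : t * rsum r <= g / (2 * (rsum r + 1)) * rsum r by apply: Rmult_le_compat_r.
have : g / (2 * (rsum r + 1)) * rsum r <= g / 2.
  by apply: (Rmult_le_reg_r (2 * (rsum r + 1))); [lra|field_simplify; nra].
by rewrite /g in g0 *; lra.
Qed.

(** At the midpoint, optimality leaves no room for the two divergences from the mixture; both
    vanish, and [gibbs_eq] equates both output laws with that of the mixture. *)
Lemma cap_outdist P : cap_achieving W c K P -> outdist W P = outdist W P0.
Proof.
move=> [hP hI]; apply: functional_extensionality.
have ht : 0 < 1 / 2 < 1 by lra.
have [dom1 dom2] := mix_dominated ht hP.
have hM : feasible c K (mix (1 / 2) P0 P) by apply: mix_feasible => //; lra.
have [_ /(_ _ hM)] := capacity_spec.
rewrite mutinfE expect_mix (compensation HW d0 dom2) (compensation HW (distr_feasible hP) dom1) hI.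
have [_ ->] := hP0.
have [o1 s1] := outdist_distr HW d0; have [o2 s2] := outdist_distr HW (distr_feasible hM).
have [o3 s3] := outdist_distr HW (distr_feasible hP).
have g1 := gibbs o1 o2 dom2; have g2 := gibbs o3 o2 dom1.
rewrite s1 s2 in g1; rewrite s3 s2 in g2.
have {}g1 := g1 (Rle_refl 1); have {}g2 := g2 (Rle_refl 1) => h.
move=> y; rewrite (gibbs_eq o1 o2 dom2 _ _ y) ?(gibbs_eq o3 o2 dom1 _ _ y) ?s1 ?s2 ?s3 //; lra.
Qed.

Definition Dx x := relent (W x) (outdist W P0).
(** The variance of one letter against the common output law. Since that law no longer depends on
    the input, the dispersion is linear on the set of optimal inputs. *)
Definition Vx x := rsum (fun y => W x y * Rsqr (ln (W x y / outdist W P0 y) - Dx x)).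

Lemma cap_mutinf P : cap_achieving W c K P -> expect P Dx = capacity W c K.
Proof. by move=> hP; have [_ <-] := hP; rewrite mutinfE (cap_outdist hP). Qed.

Lemma cap_dispersion P : cap_achieving W c K P -> dispersion P W = expect P Vx.
Proof. by move=> hP; rewrite /dispersion (cap_outdist hP). Qed.

Lemma cap_closed : seq_closed (cap_achieving W c K).
Proof.
move=> P L hP hL.
have hf k : feasible c K (P k) by case: (hP k).
split; first exact: (feasible_closed hf hL).
by apply: (is_lim_const_eq _ (mutinf_cont hf hL)) => k; case: (hP k).
Qed.

(** The factor [s] lets [compact_max] provide the maximum ([s = 1]) and the minimum ([s = -1]). *)
Lemma dispersion_cont s : seq_cont (cap_achieving W c K) (fun P => s * dispersion P W).
Proof.
move=> P L hP hL; have hLc := cap_closed hP hL.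
rewrite (cap_dispersion hLc); apply: (is_lim_seq_ext (fun k => s * expect (P k) Vx)).
  by move=> k; rewrite cap_dispersion.
by apply: (is_lim_seq_scal_l _ s (expect L Vx)); exact: is_lim_expect.
Qed.

Let cap_bound P : cap_achieving W c K P -> forall x, 0 <= P x <= 1.
Proof. by move=> [/feasible_bound]. Qed.

Lemma Vplus_spec_at :
  (exists P, cap_achieving W c K P /\ dispersion P W = Vplus W c K) /\
  (forall P, cap_achieving W c K P -> dispersion P W <= Vplus W c K).
Proof.
apply: (epsilon_spec (inhabits 0) (fun v =>
    (exists P, cap_achieving W c K P /\ dispersion P W = v) /\
    (forall P, cap_achieving W c K P -> dispersion P W <= v))).
have [P [hP hm]] := compact_max cap_bound cap_closed (@dispersion_cont 1) (ex_intro _ P0 hP0).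
exists (dispersion P W); split; first by exists P.
by move=> Q /hm; lra.
Qed.

Lemma Vminus_spec_at :
  (exists P, cap_achieving W c K P /\ dispersion P W = Vminus W c K) /\
  (forall P, cap_achieving W c K P -> Vminus W c K <= dispersion P W).
Proof.
apply: (epsilon_spec (inhabits 0) (fun v =>
    (exists P, cap_achieving W c K P /\ dispersion P W = v) /\
    (forall P, cap_achieving W c K P -> v <= dispersion P W))).
have [P [hP hm]] := compact_max cap_bound cap_closed (@dispersion_cont (-1)) (ex_intro _ P0 hP0).
exists (dispersion P W); split; first by exists P.
by move=> Q /hm; lra.
Qed.

(** A sequence of counterexamples would accumulate at an optimal input with dispersion outside
    [V-, V+]. The variance is taken against the law of [P0], with which such types are tested, so it
    is not [dispersion P W] when [P] is not optimal. *)
Lemma near_optimal d : 0 < d -> exists d', 0 < d' /\ forall P, feasible c K P ->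
  capacity W c K - d' < mutinf P W -> Vminus W c K - d <= expect P Vx <= Vplus W c K + d.
Proof.
move=> d_gt0; apply: NNPP => no.
have /choose_seq [P hP] : forall k, exists P, [/\ feasible c K P,
    capacity W c K - / (INR k + 1) < mutinf P W &
    ~ (Vminus W c K - d <= expect P Vx <= Vplus W c K + d)].
  move=> k; apply: NNPP => no'; apply: no; exists (/ (INR k + 1)); split; first exact: invS_pos.
  by move=> P hP hI; apply: NNPP => nv; apply: no'; exists P.
have hf k : feasible c K (P k) by case: (hP k).
have [s [hs [L hL]]] := cube_compact (fun k => feasible_bound (hf k)).
have hLf : feasible c K L := feasible_closed (fun k => hf (s k)) hL.
have hLI : mutinf L W = capacity W c K.
  apply: Rle_antisym; first by apply: capacity_spec.2.
  apply: (@is_lim_seq_le (fun k => capacity W c K - / (INR (s k) + 1)) (fun k => mutinf (P (s k)) W) (capacity W c K) (mutinf L W)).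
  - by move=> k; case: (hP (s k)) => _; lra.
  - apply: (@subseq_lim (fun k => capacity W c K - / (INR k + 1)) _ s hs).
    rewrite -[X in is_lim_seq _ (Rbar.Finite X)]Rminus_0_r.
    by apply: is_lim_seq_minus'; [exact: is_lim_seq_const|exact: is_lim_seq_invS].
  - exact: (mutinf_cont (fun k => hf (s k)) hL).
have hLc : cap_achieving W c K L by [].
have h1 := Vplus_spec_at.2 L hLc; have h2 := Vminus_spec_at.2 L hLc.
rewrite (cap_dispersion hLc) in h1 h2.
have lV : is_lim_seq (fun k => expect (P (s k)) Vx) (expect L Vx) by exact: is_lim_expect.
have [N hN] : eventually (fun k => Rabs (expect (P (s k)) Vx - expect L Vx) < d).
  by apply: (lV (fun v => Rabs (v - expect L Vx) < d)); exists (mkposreal _ d_gt0).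
have := hN N (le_n N); case: (hP (s N)) => _ _ nv; split_Rabs; lra.
Qed.

(* Costs can be traded between letters of the support without changing the mean cost, so [Dx] is an affine function of the cost there. *)
Lemma Dx_affine : exists lam, forall x, 0 < P0 x -> Dx x = capacity W c K + lam * (c x - expect P0 c).
Proof.
have [p0 p1] := d0.
(* A direction inside the support, of zero mass and zero cost, can be followed a short way from [P0]
   in both senses; [saddle] makes the change of the mean of [Dx] nonpositive each time. *)
have dir (u : X -> R) : (forall x, P0 x <= 0 -> u x = 0) -> rsum u = 0 -> expect u c = 0 -> expect u Dx = 0.
  move=> hu su sc.
  have half (v : X -> R) : (forall x, P0 x <= 0 -> v x = 0) -> rsum v = 0 -> expect v c = 0 -> expect v Dx <= 0.
    move=> hv sv vc.
    have [t [t0 ht]] : exists t, 0 < t /\ forall x, 0 <= P0 x + t * v x.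
      have fin (r : seq X) : exists t, 0 < t /\ forall x, x \in r -> 0 <= P0 x + t * v x.
        elim: r => [|z r [t [t0 ht]]]; first by exists 1; split=> //; lra.
        have [tz [tz0 htz]] : exists t, 0 < t /\ forall s, 0 <= s <= t -> 0 <= P0 z + s * v z.
          case: (Rle_lt_or_eq_dec _ _ (p0 z)) => [pz|e].
            exists (P0 z / (Rabs (v z) + 1)); split.
              by apply: Rdiv_lt_0_compat => //; have := Rabs_pos (v z); lra.
            move=> s [s0 hs].
            have q := Rabs_pos (v z).
            have : s * (Rabs (v z) + 1) <= P0 z.
              apply: Rle_trans (Rmult_le_compat_r _ _ _ _ hs) _; first lra.
              by right; field; lra.
            by split_Rabs; nra.
          by exists 1; split; [lra|move=> s _; rewrite hv -?e; lra].
        exists (Rmin t tz); split; first exact: Rmin_glb_lt.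
        have m0 : 0 < Rmin t tz by exact: Rmin_glb_lt.
        have m1 := Rmin_l t tz; have m2 := Rmin_r t tz.
        move=> x; rewrite inE => /orP[/eqP ->|xr]; first by apply: htz; lra.
        have := ht x xr; have := p0 x; move: (Rmin t tz) m0 m1 m2 => m m0 m1 _ a b.
        case: (Rle_lt_dec 0 (v x)) => hvx; first by nra.
        by nra.
      have [t [t0 ht]] := fin (enum X); exists t; split=> // x; apply: ht; exact: mem_enum.
    have ex f : expect (fun x => P0 x + t * v x) f = expect P0 f + t * expect v f.
      by rewrite /expect -rsum_mull -rsum_add; apply: rsum_ext => x; ring.
    have hF : feasible c K (fun x => P0 x + t * v x).
      split; first split=> //; last by rewrite ex vc; case: f0; lra.
      by rewrite rsum_add rsum_mull p1 sv; ring.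
    have := saddle hF; rewrite ex -/Dx (cap_mutinf hP0); nra.
  have h1 := half u hu su sc.
  have := half (fun x => - u x).
  have -> : expect (fun x => - u x) Dx = - expect u Dx.
    by rewrite /expect -rsum_opp; apply: rsum_ext => x; ring.
  have -> : expect (fun x => - u x) c = - expect u c.
    by rewrite /expect -rsum_opp; apply: rsum_ext => x; ring.
  rewrite rsum_opp su sc Ropp_0 => h2.
  by have := h2 (fun x hx => ltac:(by rewrite hu //; ring)) erefl erefl; lra.
have ind_exp z f : expect (ind1 z) f = f z by exact: rsum_ind1.
have sum_ind z : rsum (ind1 z) = 1.
  by rewrite -(rsum_ind1 z (fun _ => 1)); apply: rsum_ext => x; ring.
have comb a b d x1 x2 x3 : 0 < P0 x1 -> 0 < P0 x2 -> 0 < P0 x3 -> a + b + d = 0 ->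
    a * c x1 + b * c x2 + d * c x3 = 0 -> a * Dx x1 + b * Dx x2 + d * Dx x3 = 0.
  move=> h1 h2 h3 s1 s2.
  pose u x := a * ind1 x1 x + b * ind1 x2 x + d * ind1 x3 x.
  have eu f : expect u f = a * f x1 + b * f x2 + d * f x3.
    rewrite -!ind_exp /expect -!rsum_mull -!rsum_add; apply: rsum_ext => x; rewrite /u; ring.
  rewrite -eu; apply: dir; [|by rewrite /u !rsum_add !rsum_mull !sum_ind; lra|by rewrite eu].
  by move=> x hx; rewrite /u /ind1; do !case: eqP => [?|_]; subst; lra.
(* Averaging under [P0] replaces the reference letter [x1] by the means, that of [Dx] being the
   capacity. *)
have avg lam x1 : 0 < P0 x1 -> (forall x, 0 < P0 x -> Dx x = Dx x1 + lam * (c x - c x1)) ->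
    forall x, 0 < P0 x -> Dx x = capacity W c K + lam * (c x - expect P0 c).
  move=> h1 h x hx.
  have e : expect P0 Dx = expect P0 (fun x => Dx x1 + lam * (c x - c x1)).
    apply: Rle_antisym; apply: expect_le => // z /h ->; lra.
  have e2 : expect P0 (fun x => Dx x1 + lam * (c x - c x1)) = Dx x1 + lam * (expect P0 c - c x1).
    rewrite /expect (@rsum_ext _ _ (fun x => (Dx x1 - lam * c x1) * P0 x + lam * (P0 x * c x))); last by move=> z; ring.
    by rewrite rsum_add !rsum_mull p1; ring.
  by rewrite (h x hx) -(cap_mutinf hP0) e e2; ring.
have [x1 h1] : exists x, 0 < P0 x by apply: rsum_pos => //; rewrite p1; lra.
case: (classic (exists x2, 0 < P0 x2 /\ c x2 <> c x1)) => [[x2 [h2 ne]]|no].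
  (* Two support letters of different cost fix the slope, and the coefficients below have zero sum
     and zero cost for any third letter. When all support letters cost the same, slope 0 is
     taken. *)
  exists ((Dx x2 - Dx x1) / (c x2 - c x1)); apply: (avg _ x1) => // x hx.
  have := comb (c x2 - c x1) (c x1 - c x) (c x - c x2) x x2 x1 hx h2 h1 ltac:(ring) ltac:(ring) => e.
  by apply: (Rmult_eq_reg_l (c x2 - c x1)); [field_simplify; lra|lra].
exists 0; apply: (avg _ x1) => // x hx.
have cx : c x = c x1 by apply: NNPP => ne; apply: no; exists x.
by have := comb 1 (-1) 0 x x1 x1 hx h1 h1 ltac:(ring) ltac:(rewrite cx; ring); lra.
Qed.

End CapPoint.
End Cap.

(** The laws proportional to [k y + 1] with [k y <= m]. Rounding [INR m * S y] down to [k y] gives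
    [S y / T y <= Z / m <= 1 + #|Y| / m]; the added 1 keeps the law positive and dominates the
    rounded part. *)
Lemma relent_net (Y : finType) d : 0 < d -> exists (J : finType) (T : J -> Y -> R),
  [/\ forall j y, 0 < T j y, forall j, is_distr (T j) &
      forall S, is_distr S -> exists j, relent S (T j) <= d].
Proof.
move=> d0; have [m hm] := exists_INR_gt (INR #|Y| / d + 1).
have Y0 := pos_INR #|Y|.
have q0 : 0 <= INR #|Y| / d by apply: Rmult_le_pos => //; left; exact: Rinv_0_lt_compat.
have m0 : 0 < INR m by lra.
pose Z (k : {ffun Y -> 'I_m.+1}) := rsum (fun y => INR (k y) + 1).
pose T (k : {ffun Y -> 'I_m.+1}) y := (INR (k y) + 1) / Z k.
have Zt (k : {ffun Y -> 'I_m.+1}) y : INR (k y) + 1 <= Z k.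
  by apply: (@rsum_ge_term _ y (fun y => INR (k y) + 1)) => z; have := pos_INR (k z); lra.
(* On an empty alphabet the weights cannot be normalised; there is no law to approximate, and an
   empty family does. *)
case: (pickP (fun _ : Y => true)) => [y0 _|no]; last first.
  exists void, (fun _ _ => 0); split=> [[]|[]|S [_]].
  by rewrite /rsum big_pred0 // => /esym; lra.
have Z0 k : 0 < Z k by have := Zt k y0; have := pos_INR (k y0); lra.
have T0 k y : 0 < T k y by apply: Rdiv_lt_0_compat => //; have := pos_INR (k y); lra.
exists {ffun Y -> 'I_m.+1}, T; split=> //.
  move=> k; split; first by move=> y; left.
  by rewrite /T /Rdiv rsum_mulr -/(Z k) Rinv_r //; have := Z0 k; lra.
move=> S hS; have [s0 s1] := hS.
have fl y : exists i : 'I_m.+1, INR i <= INR m * S y < INR i + 1.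
  have [|i [i1 i2]] := nfloor_ex (INR m * S y); first by have := s0 y; nra.
  have im : (i < m.+1)%N.
    by rewrite ltnS; apply/leP; apply: INR_le; have := distr_le1 y hS; nra.
  by exists (Ordinal im).
pose k := [ffun y => proj1_sig (constructive_indefinite_description _ (fl y))].
have hk y : INR (k y) <= INR m * S y < INR (k y) + 1.
  by rewrite ffunE; case: constructive_indefinite_description.
have Zm : Z k <= INR m + INR #|Y|.
  have -> : INR m + INR #|Y| = rsum (fun y => INR m * S y + 1).
    by rewrite rsum_add rsum_mull s1 rsum_const; ring.
  by apply: rsum_le => y; have := hk y; lra.
exists k; rewrite -[d]Rmult_1_r -s1 -rsum_mull; apply: rsum_le => y.
case: (Rle_lt_or_eq_dec _ _ (s0 y)) => [sy|<-]; last by lra.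
rewrite Rmult_comm; apply: Rmult_le_compat_r; first lra.
apply: Rle_trans (ln_le_sub1 (Rdiv_lt_0_compat _ _ sy (T0 k y))) _.
have -> : S y / T k y = S y * Z k / (INR (k y) + 1).
  by rewrite /T; field; split; [have := pos_INR (k y)|have := Z0 k]; lra.
have h1 : S y * Z k / (INR (k y) + 1) <= Z k / INR m.
  apply: (Rmult_le_reg_r (INR m * (INR (k y) + 1))).
    by have := pos_INR (k y); nra.
  have := pos_INR (k y) => p; have := hk y; have := Z0 k => a b.
  have -> : S y * Z k / (INR (k y) + 1) * (INR m * (INR (k y) + 1)) = INR m * S y * Z k by field; lra.
  have -> : Z k / INR m * (INR m * (INR (k y) + 1)) = (INR (k y) + 1) * Z k by field; lra.
  by apply: Rmult_le_compat_r; lra.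
have h2 : Z k / INR m <= 1 + INR #|Y| / INR m.
  by apply: (Rmult_le_reg_r (INR m)) => //; field_simplify; lra.
have h3 : INR #|Y| / INR m <= d.
  apply: (Rmult_le_reg_r (INR m)) => //; field_simplify; [|lra].
  by have : d * (INR #|Y| / d) = INR #|Y| by [field; lra]; nra.
by lra.
Qed.

(** * Likelihood ratios and types *)

Definition for_large (A : nat -> Prop) := exists N : nat, forall n, (N <= n)%N -> A n.

Lemma for_large_and (A B : nat -> Prop) : for_large A -> for_large B -> for_large (fun n => A n /\ B n).
Proof.
move=> [N hN] [M hM]; exists (maxn N M) => n; rewrite geq_max => /andP[h1 h2].
by split; [exact: hN|exact: hM].
Qed.

Lemma for_large_impl (A B : nat -> Prop) : (forall n, A n -> B n) -> for_large A -> for_large B.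
Proof. by move=> h [N hN]; exists N => n /hN/h. Qed.

Lemma for_large_fin (J : finType) (A : J -> nat -> Prop) :
  (forall j, for_large (A j)) -> for_large (fun n => forall j, A j n).
Proof.
move=> h.
have [N hN] : exists N : J -> nat, forall j n, (N j <= n)%N -> A j n.
  exists (fun j => proj1_sig (constructive_indefinite_description _ (h j))) => j.
  by case: constructive_indefinite_description.
exists (\max_j N j)%N => n hn j; apply: hN; apply: leq_trans hn; exact: leq_bigmax.
Qed.

Lemma for_large_sqrt r : for_large (fun n => r <= sqrt (INR n)).
Proof.
have [N hN] := exists_INR_gt (r * r); exists N => n /leP/le_INR h.
case: (Rle_lt_dec r 0) => r0; first by have := sqrt_pos (INR n); lra.
by rewrite -(sqrt_square r); [apply: sqrt_le_1_alt; lra|lra].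
Qed.

Lemma for_large_pos : for_large (fun n => 1 <= INR n).
Proof. by exists 1%N => n /leP/le_INR. Qed.

Lemma sqrt_INR_sqr n : sqrt (INR n) * sqrt (INR n) = INR n.
Proof. exact: sqrt_sqrt (pos_INR n). Qed.

Lemma exp_rsum n (f : 'I_n -> R) : exp (rsum f) = \big[Rmult/1]_(i < n) exp (f i).
Proof.
rewrite /rsum; elim/big_ind2: _ => [|x1 x2 y1 y2 <- <-|//]; first exact: exp_0.
exact: exp_plus.
Qed.

Section LikelihoodRatio.
Variables (X Y : finType) (W : X -> Y -> R).
Hypothesis HW : is_channel W.
Variable S : Y -> R.
Hypothesis S0 : forall y, 0 <= S y.

Let W0 x y : 0 <= W x y. Proof. by case: (HW x). Qed.

Definition llr x y := ln (W x y / S y).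
Definition llr_var x := rsum (fun y => W x y * Rsqr (llr x y - relent (W x) S)).
Definition llr_bound := rsum (fun x => rsum (fun y => Rabs (llr x y - relent (W x) S))).

Lemma llr_bound_ge x y : Rabs (llr x y - relent (W x) S) <= llr_bound.
Proof.
apply: Rle_trans (rsum_ge_term y (fun y => Rabs_pos (llr x y - relent (W x) S))) _.
by apply: (@rsum_ge_term _ x (fun x => rsum (fun y => Rabs (llr x y - relent (W x) S)))) => z; apply: rsum_ge0 => w; exact: Rabs_pos.
Qed.

Lemma llr_bound_ge0 : 0 <= llr_bound.
Proof. by do 2 (apply: rsum_ge0 => ?); exact: Rabs_pos. Qed.

Lemma llr_var_bound x : 0 <= llr_var x <= llr_bound * llr_bound.
Proof.
split; first by apply: rsum_ge0 => y; apply: Rmult_le_pos => //; exact: Rle_0_sqr.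
have [_ w1] := HW x; rewrite -[X in _ <= X]Rmult_1_l -w1 -rsum_mulr; apply: rsum_le => y.
apply: Rmult_le_compat_l => //; rewrite Rsqr_abs.
by apply: Rmult_le_compat; try exact: Rabs_pos; exact: llr_bound_ge.
Qed.

Variable n : nat.
Implicit Type x : {ffun 'I_n -> X}.

Lemma channel_prod_distr x : is_prod_distr (fun i => W (x i)). Proof. by move=> i; exact: HW. Qed.

Lemma Wn_ge0 x y : 0 <= Wn W x y. Proof. exact: prod_law_ge0 (channel_prod_distr x). Qed.

Lemma Wn_sum1 x : rsum (Wn W x) = 1. Proof. exact: prod_law_sum1 (channel_prod_distr x). Qed.

Definition Sn (y : {ffun 'I_n -> Y}) := prod_law (fun _ : 'I_n => S) y.

Lemma Sn_ge0 y : 0 <= Sn y.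
Proof. by rewrite /Sn /prod_law; elim/big_ind: _ => [|u v|i _]; [lra|exact: Rmult_le_pos|exact: S0]. Qed.

(* The distribution function of log (W_x / S^n) under W_x, at gamma. *)
Definition LR x gamma := Eprod (fun i => W (x i)) (fun y => ind (leR (Wn W x y) (exp gamma * Sn y))).

Definition llr_dev x (i : 'I_n) y := llr (x i) y - relent (W (x i)) S.
Definition llr_mean x := rsum (fun i => relent (W (x i)) S).

Lemma llr_dev_centered x : centered (fun i => W (x i)) (llr_dev x).
Proof.
move=> i; rewrite /llr_dev (@rsum_ext _ _ (fun y => W (x i) y * llr (x i) y - W (x i) y * relent (W (x i)) S)); last by move=> y; ring.
by rewrite rsum_sub rsum_mulr; case: (HW (x i)) => _ ->; rewrite -/(relent (W (x i)) S); ring.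
Qed.

Lemma llr_dev_var x : var_sum (fun i => W (x i)) (llr_dev x) = rsum (fun i => llr_var (x i)).
Proof. by []. Qed.

(** Taking logarithms is legitimate on outputs of positive probability only; the others do not
    contribute to [LR]. *)
Lemma leR_likelihood x y gamma : (forall i, dominated (W (x i)) S) -> 0 < Wn W x y ->
  leR (Wn W x y) (exp gamma * Sn y) = leR (coord_sum (llr_dev x) y) (gamma - llr_mean x).
Proof.
move=> dom wp.
have wi i : 0 < W (x i) (y i) by exact: (prod_law_gt0 (channel_prod_distr x) wp).
have e : Wn W x y = exp (coord_sum (llr_dev x) y + llr_mean x) * Sn y.
  rewrite /coord_sum /llr_mean -rsum_add exp_rsum /Sn /prod_law -big_split; apply: eq_bigr => i _.
  rewrite /llr_dev /llr (_ : forall u v, u - v + v = u); last by move=> u v; ring.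
  have s := dom i _ (wi i).
  by rewrite exp_ln; [change (W (x i) (y i) = W (x i) (y i) / S (y i) * S (y i)); field; lra|exact: Rdiv_lt_0_compat].
have sp : 0 < Sn y by have := Sn_ge0 y => -[//|z]; rewrite e -z in wp; lra.
apply/leRP/leRP; rewrite e => h.
  have := Rmult_le_reg_r _ _ _ sp h.
  case/Rle_lt_or_eq_dec => [/exp_lt_inv|/exp_inv]; lra.
apply: Rmult_le_compat_r; first lra.
have : coord_sum (llr_dev x) y + llr_mean x <= gamma by lra.
by case=> [/exp_increasing|->]; lra.
Qed.

Lemma LR_llr x gamma : (forall i, dominated (W (x i)) S) ->
  LR x gamma = Eprod (fun i => W (x i)) (fun y => ind (leR (coord_sum (llr_dev x) y) (gamma - llr_mean x))).
Proof.
move=> dom; apply: Rle_antisym; apply: Eprod_le (channel_prod_distr x) _ => y wp; rewrite leR_likelihood //; lra.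
Qed.

Lemma LR_mono x g g' : g <= g' -> LR x g <= LR x g'.
Proof.
move=> h; apply: Eprod_le (channel_prod_distr x) _ => y _.
have e : exp g * Sn y <= exp g' * Sn y.
  by apply: Rmult_le_compat_r; [exact: Sn_ge0|case: h => [/exp_increasing|->]; lra].
by do 2 case: leRP => ? /=; lra.
Qed.

(** Outputs of [D] above the threshold have total probability at most [1 - LR]; below it, [Wn] is at
    most [exp gamma * Sn]. *)
Lemma success_bound x (D : {set {ffun 'I_n -> Y}}) gamma :
  rsum_in D (Wn W x) <= 1 - LR x gamma + exp gamma * rsum_in D Sn.
Proof.
rewrite -(Wn_sum1 x) !rsum_inE -rsum_mull /LR /Eprod -rsum_sub -rsum_add.
apply: rsum_le => y; have w := Wn_ge0 x y; have s := Sn_ge0 y; have e := exp_pos gamma.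
have es : 0 <= exp gamma * Sn y by nra.
rewrite -WnE; case: ifP => _; case: leRP => h /=; lra.
Qed.

Lemma llr_var_sum_le x : rsum (fun i => llr_var (x i)) <= INR n * (llr_bound * llr_bound).
Proof.
rewrite -[n in INR n](card_ord n) -rsum_const; apply: rsum_le => i; by case: (llr_var_bound (x i)).
Qed.

End LikelihoodRatio.

Section LRLimits.
Variables (X Y : finType) (W : X -> Y -> R).
Hypothesis HW : is_channel W.
Variable S : Y -> R.
Hypothesis S0 : forall y, 0 <= S y.

Lemma LR_clt v0 b eta : 0 < v0 -> 0 < eta ->
  for_large (fun n => forall x : {ffun 'I_n -> X}, (forall i, dominated (W (x i)) S) ->
    INR n * v0 <= rsum (fun i => llr_var W S (x i)) ->
    Rabs (LR W S x (llr_mean W S x + b * sqrt (INR n)) -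
      Phi (b / sqrt (rsum (fun i => llr_var W S (x i)) / INR n))) <= eta).
Proof.
move=> h1 h2; have [N hN] := uniform_clt Y b (llr_bound_ge0 W S) h1 h2.
exists N => n /hN h x dom hv.
rewrite LR_llr // (_ : llr_mean W S x + b * sqrt (INR n) - llr_mean W S x = b * sqrt (INR n)); last by ring.
rewrite -(llr_dev_var W S x); apply: h; [exact: channel_prod_distr|exact: llr_dev_centered| |exact: hv].
by move=> i y _; exact: llr_bound_ge.
Qed.

(** The variance is at most linear in [n] while the margin is linear in [n]. This covers also words
    whose variance vanishes, out of reach of [LR_clt]. *)
Lemma LR_chebyshev d eta : 0 < d -> 0 < eta ->
  for_large (fun n => forall x : {ffun 'I_n -> X}, (forall i, dominated (W (x i)) S) ->
    1 - LR W S x (llr_mean W S x + INR n * d) <= eta).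
Proof.
move=> d0 eta0; pose M := llr_bound W S.
have [N hN] := exists_INR_gt (M * M / (d * d * eta) + 1).
exists N => n /leP/le_INR Nn x dom.
have dd : 0 < d * d * eta by apply: Rmult_lt_0_compat => //; exact: Rmult_lt_0_compat.
have q : 0 <= M * M / (d * d * eta).
  apply: Rmult_le_pos; first by have := llr_bound_ge0 W S; rewrite -/M; nra.
  by left; apply: Rinv_0_lt_compat; nra.
have n0 : 1 <= INR n by lra.
have nd : 0 < INR n * d by nra.
rewrite LR_llr // (_ : llr_mean W S x + INR n * d - llr_mean W S x = INR n * d); last by ring.
rewrite -{1}(Eprod_const 1 (channel_prod_distr HW x)) -Eprod_sub.
apply: Rle_trans (_ : Eprod (fun i => W (x i)) (fun y => ind (~~ leR (coord_sum (llr_dev W S x) y) (INR n * d))) <= _).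
  by apply: Eprod_le (channel_prod_distr HW x) _ => y _; case: leR => /=; lra.
apply: Rle_trans (chebyshev (s := INR n * d) (channel_prod_distr HW x) (llr_dev_centered HW S x) nd _) _.
  by move=> y /leRP h; apply: Rle_trans (Rle_abs _); lra.
rewrite llr_dev_var; have := llr_var_sum_le HW S x; rewrite -/M => hv.
apply: (Rmult_le_reg_r (Rsqr (INR n * d))); first by rewrite /Rsqr; nra.
rewrite /Rdiv Rmult_assoc Rinv_l; last by rewrite /Rsqr; nra.
rewrite Rmult_1_r; apply: Rle_trans hv _.
have : M * M <= INR n * (d * d * eta).
  have -> : M * M = M * M / (d * d * eta) * (d * d * eta) by field; split; lra.
  by apply: Rmult_le_compat_r; lra.
rewrite /Rsqr => h.
have : INR n * (M * M) <= INR n * (INR n * (d * d * eta)) by apply: Rmult_le_compat_l; lra.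
by lra.
Qed.
End LRLimits.

Lemma Phi_scaled_near a v0 eta : 0 < v0 -> 0 < eta -> exists d, 0 < d /\
  forall b s t, Rabs (b - a) <= d -> v0 <= s -> v0 <= t -> Rabs (s - t) <= d ->
  Rabs (Phi (b / sqrt s) - Phi (a / sqrt t)) <= eta.
Proof.
move=> v00 eta0; have sv := sqrt_lt_R0 _ v00.
have vv : 0 < v0 * sqrt v0 by nra.
pose k := / sqrt v0 + Rabs a / (v0 * sqrt v0) + 1.
have k1 : 0 < / sqrt v0 by exact: Rinv_0_lt_compat.
have k2 : 0 <= Rabs a / (v0 * sqrt v0) by apply: Rmult_le_pos; [exact: Rabs_pos|left; exact: Rinv_0_lt_compat].
have k0 : 0 < k by rewrite /k; lra.
exists (eta / k); split; first exact: Rdiv_lt_0_compat.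
move=> b s t hb hs ht hst; apply: Rle_trans (Phi_lip _ _) _.
have -> : b / sqrt s - a / sqrt t = (b - a) * / sqrt s + a * (/ sqrt s - / sqrt t) by rewrite /Rdiv; ring.
apply: Rle_trans (Rabs_triang _ _) _; rewrite !Rabs_mult.
have i1 : / sqrt s <= / sqrt v0 by apply: Rinv_le_contravar => //; exact: sqrt_le_1_alt.
have i0 : 0 < / sqrt s by apply: Rinv_0_lt_compat; apply: sqrt_lt_R0; lra.
have i2 := inv_sqrt_lip v00 hs ht.
have j1 : Rabs (b - a) * Rabs (/ sqrt s) <= eta / k * / sqrt v0.
  by rewrite (Rabs_pos_eq (/ _)); [apply: Rmult_le_compat => //; [exact: Rabs_pos|lra]|lra].
have j2 : Rabs a * Rabs (/ sqrt s - / sqrt t) <= Rabs a * (eta / k / (v0 * sqrt v0)).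
  apply: Rmult_le_compat_l; first exact: Rabs_pos.
  by apply: Rle_trans i2 _; apply: Rmult_le_compat_r => //; left; exact: Rinv_0_lt_compat.
have q0 : 0 < eta / k by exact: Rdiv_lt_0_compat.
have e : eta / k * (/ sqrt v0 + Rabs a / (v0 * sqrt v0) + 1) = eta by rewrite -/k; field; lra.
have e2 : Rabs a * (eta / k / (v0 * sqrt v0)) = eta / k * (Rabs a / (v0 * sqrt v0)) by field; lra.
by move: (eta / k) q0 e e2 j1 j2 => q q0 e e2 j1 j2; lra.
Qed.

Section Types.
Variables (X : finType) (n : nat) (x : {ffun 'I_n -> X}).

Definition ptype (a : X) := rsum (fun i => ind1 (x i) a) / INR n.

Lemma expect_ptype f : expect ptype f = rsum (fun i => f (x i)) / INR n.
Proof.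
rewrite /expect /Rdiv -rsum_mulr.
rewrite (@rsum_ext _ _ (fun a => rsum (fun i => ind1 (x i) a * f a * / INR n))).
  by rewrite rsum_exch; apply: rsum_ext => i; rewrite rsum_mulr rsum_ind1.
by move=> a; rewrite /ptype /Rdiv -!rsum_mulr; apply: rsum_ext => i; ring.
Qed.

Hypothesis n0 : 0 < INR n.

Lemma ptype_distr : is_distr ptype.
Proof.
split.
  move=> a; apply: Rmult_le_pos; last by left; exact: Rinv_0_lt_compat.
  by apply: rsum_ge0 => i; rewrite /ind1; case: ifP; lra.
have := expect_ptype (fun _ => 1); rewrite /expect rsum_mulr rsum_const card_ord => e.
by rewrite Rmult_1_r in e; rewrite e; field; lra.
Qed.

Lemma ptype_pos i : 0 < ptype (x i).
Proof.
apply: Rdiv_lt_0_compat => //; apply: Rlt_le_trans (_ : ind1 (x i) (x i) <= _).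
  by rewrite /ind1 eqxx; lra.
by apply: (@rsum_ge_term _ i (fun j => ind1 (x j) (x i))) => j; rewrite /ind1; case: ifP; lra.
Qed.

Lemma ptype_feasible c K : rsum (fun i => c (x i)) <= INR n * K -> feasible c K ptype.
Proof.
move=> h; split; first exact: ptype_distr.
rewrite expect_ptype; apply: (Rmult_le_reg_r (INR n)) => //.
by rewrite /Rdiv Rmult_assoc Rinv_l; lra.
Qed.
End Types.

(** * The converse bound *)

Section Converse.
Variables (X Y : finType) (W : X -> Y -> R) (c : X -> R) (K : R).
Hypothesis HW : is_channel W.
Hypothesis Hfeas : exists P : X -> R, feasible c K P.
Hypothesis HV : 0 < Vminus W c K.

Let C := capacity W c K.
Let Vp := Vplus W c K.
Let Vm := Vminus W c K.

Lemma Vplus_spec :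
  (exists P, cap_achieving W c K P /\ dispersion P W = Vplus W c K) /\
  (forall P, cap_achieving W c K P -> dispersion P W <= Vplus W c K).
Proof. by have [[P0 hP0] _] := capacity_spec HW Hfeas; exact: Vplus_spec_at hP0. Qed.

Lemma Vminus_spec :
  (exists P, cap_achieving W c K P /\ dispersion P W = Vminus W c K) /\
  (forall P, cap_achieving W c K P -> Vminus W c K <= dispersion P W).
Proof. by have [[P0 hP0] _] := capacity_spec HW Hfeas; exact: Vminus_spec_at hP0. Qed.

Lemma Vminus_le_Vplus : Vminus W c K <= Vplus W c K.
Proof. by have [[P [hP <-]] _] := Vminus_spec; exact: Vplus_spec.2. Qed.

(** Both branches of the claimed formula at once: the minimum is attained by [Vplus] for [a >= 0]
    and by [Vminus] for [a < 0]. *)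
Definition opt_err a := Rmin (Phi (a / sqrt (Vplus W c K))) (Phi (a / sqrt (Vminus W c K))).

Lemma opt_err_between a t : Vm <= t <= Vp -> opt_err a <= Phi (a / sqrt t).
Proof.
move=> [h1 h2]; rewrite /opt_err -/Vp -/Vm.
have s1 : sqrt Vm <= sqrt t by exact: sqrt_le_1_alt.
have s2 : sqrt t <= sqrt Vp by exact: sqrt_le_1_alt.
have s0 : 0 < sqrt Vm by exact: sqrt_lt_R0.
have i1 : / sqrt t <= / sqrt Vm by apply: Rinv_le_contravar.
have i2 : / sqrt Vp <= / sqrt t by apply: Rinv_le_contravar => //; lra.
case: (Rle_lt_dec 0 a) => ha.
  apply: Rle_trans (Rmin_l _ _) _; apply: Phi_le; rewrite /Rdiv; nra.
apply: Rle_trans (Rmin_r _ _) _; apply: Phi_le; rewrite /Rdiv; nra.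
Qed.

Lemma success_01 n (x : {ffun 'I_n -> X}) (D : {set {ffun 'I_n -> Y}}) : 0 <= rsum_in D (Wn W x) <= 1.
Proof.
split; first by apply: rsum_in_ge0 => y; exact: Wn_ge0.
rewrite -(Wn_sum1 HW x) rsum_inE; apply: rsum_le => y.
by have := Wn_ge0 HW x y; case: ifP => _; lra.
Qed.

Lemma Perr_01 n (F : code X Y n) : 0 <= Perr W F <= 1.
Proof.
have n0 : 0 < INR (csize F) by apply: lt_0_INR; apply/ltP; exact: csize_pos.
have e : / INR (csize F) * (INR #|'I_(csize F)| * 1) = 1 by rewrite card_ord; field; lra.
have i0 := Rinv_0_lt_compat _ n0.
have h i : 0 <= 1 - rsum_in (cdec F i) (fun y => Wn W (cenc F i) y) <= 1.
  have [h0 h1] : 0 <= rsum_in (cdec F i) (fun y => Wn W (cenc F i) y) <= 1 by exact: success_01.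
  by lra.
split; first by apply: Rmult_le_pos; [lra|apply: rsum_ge0 => i; case: (h i)].
rewrite -[X in _ <= X]e -rsum_const; apply: Rmult_le_compat_l; first lra.
by apply: rsum_le => i; case: (h i).
Qed.

(* Each codeword is tested against the member of a finite family [S] of output laws that suits its type. *)
Lemma Perr_ge n (F : code X Y n) (J : finType) (S : J -> Y -> R) gamma t :
  (forall j, is_distr (S j)) ->
  (forall i, exists j, t <= LR W (S j) (cenc F i) gamma) ->
  t - INR #|J| * (exp gamma / INR (csize F)) <= Perr W F.
Proof.
move=> hS hj.
have [o ho] : exists o : 'I_(csize F) -> J, forall i, t <= LR W (S (o i)) (cenc F i) gamma.
  exists (fun i => proj1_sig (constructive_indefinite_description _ (hj i))) => i.
  by case: constructive_indefinite_description.
have n0 : 0 < INR (csize F) by apply: lt_0_INR; apply/ltP; exact: csize_pos.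
have S0 j y : 0 <= S j y by case: (hS j).
(* Enlarging the chosen law to the sum over all laws costs the factor [INR #|J|]; for each single
   law the disjoint decoding sets have total mass at most 1. *)
have tot : rsum (fun i => rsum_in (cdec F i) (Sn (S (o i)) (n := n))) <= INR #|J|.
  apply: Rle_trans (_ : rsum (fun j => rsum (fun i => rsum_in (cdec F i) (Sn (S j) (n := n)))) <= _).
    rewrite rsum_exch; apply: rsum_le => i.
    apply: (@rsum_ge_term _ (o i) (fun j => rsum_in (cdec F i) (Sn (S j) (n := n)))) => j.
    by apply: rsum_in_ge0; exact: Sn_ge0.
  rewrite -[X in _ <= X]Rmult_1_r -rsum_const; apply: rsum_le => j.
  rewrite -(@prod_law_sum1 _ n (fun _ => S j)) //.
  by apply: rsum_in_disj; [exact: cdec_disj|exact: Sn_ge0].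
have low : rsum (fun i => t - exp gamma * rsum_in (cdec F i) (Sn (S (o i)) (n := n))) <=
    rsum (fun i : 'I_(csize F) => 1 - rsum_in (cdec F i) (fun y => Wn W (cenc F i) y)).
  apply: rsum_le => i; have ht := ho i.
  have hb : rsum_in (cdec F i) (fun y => Wn W (cenc F i) y) <= 1 - LR W (S (o i)) (cenc F i) gamma +
    exp gamma * rsum_in (cdec F i) (Sn (S (o i)) (n := n)) by exact: success_bound.
  by lra.
rewrite rsum_sub rsum_const rsum_mull card_ord in low.
rewrite /Perr; have i0 := Rinv_0_lt_compat _ n0.
apply: Rle_trans (Rmult_le_compat_l _ _ _ (Rlt_le _ _ i0) low).
have -> : t - INR #|J| * (exp gamma / INR (csize F)) =
  / INR (csize F) * (INR (csize F) * t - exp gamma * INR #|J|) by field; lra.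
apply: Rmult_le_compat_l; first lra.
by have := exp_pos gamma; nra.
Qed.

Lemma Perr_converse a eta (F : code_seq X Y) : 0 < eta -> admissible c K F ->
  liminf_ge (rate2 W c K F) a -> for_large (fun n => opt_err a - eta <= errseq W F n).
Proof.
move=> eta0 adm hr.
have [P0 /[dup] hP0 [fP0 _]] := (capacity_spec HW Hfeas).1.
pose Q := outdist W P0; have hQ : is_distr Q := outdist_distr HW (distr_feasible fP0).
have Q0 y : 0 <= Q y by case: hQ.
have [d1 [d10 hd1]] : exists d, 0 < d /\ forall b s t, Rabs (b - a) <= d -> Vm / 2 <= s -> Vm / 2 <= t ->
    Rabs (s - t) <= d -> Rabs (Phi (b / sqrt s) - Phi (a / sqrt t)) <= eta / 4.
  by apply: Phi_scaled_near; rewrite /Vm; lra.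
(* The bound [Vm / 2] keeps the variance of near-optimal types above [Vm / 2], the bound [d1] keeps
   it within reach of [Phi_scaled_near]. *)
pose d := Rmin d1 (Vm / 2); have d0 : 0 < d by apply: Rmin_glb_lt; rewrite /Vm; lra.
have dd1 : d <= d1 := Rmin_l _ _. have dv : d <= Vm / 2 := Rmin_r _ _.
have [d' [d'0 near]] := near_optimal HW Hfeas hP0 d0.
have [|J [T [T0 hT netT]]] := @relent_net Y (d' / 2); first lra.
pose S (j : option J) := if j is Some j then T j else Q.
have hS j : is_distr (S j) by case: j => [j|]; [exact: hT|exact: hQ].
(* The threshold stays [d1 / 2 * sqrt n] below the guaranteed log-size, which makes
   [exp gamma / csize] vanish, while moving [Phi] by at most [eta / 4]. *)
pose b := a - d1.
have E1 : for_large (fun n => forall x : {ffun 'I_n -> X}, (forall i, dominated (W (x i)) Q) ->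
    INR n * (Vm / 2) <= rsum (fun i => llr_var W Q (x i)) ->
    Rabs (LR W Q x (llr_mean W Q x + b * sqrt (INR n)) -
      Phi (b / sqrt (rsum (fun i => llr_var W Q (x i)) / INR n))) <= eta / 4).
  by apply: (LR_clt HW Q0); rewrite /Vm; lra.
have E2 : for_large (fun n => forall j, forall x : {ffun 'I_n -> X}, (forall i, dominated (W (x i)) (T j)) ->
    1 - LR W (T j) x (llr_mean W (T j) x + INR n * (d' / 4)) <= eta / 4).
  by apply: for_large_fin => j; apply: (LR_chebyshev HW); [move=> y; left|lra|lra].
have E3 := for_large_sqrt (Rabs b * 4 / d').
have E4 := for_large_sqrt (4 * INR #|{: option J}| / (d1 * eta)).
have E5 : for_large (fun n => a - d1 / 2 < rate2 W c K F n) by apply: hr; lra.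
apply: for_large_impl (for_large_and (for_large_and (for_large_and E1 E2) (for_large_and E3 E4)) (for_large_and E5 for_large_pos)) => n.
move=> [[[e1 e2] [e3 e4]] [e5 n1]].
have n0 : 0 < INR n by lra.
have s0 : 0 < sqrt (INR n) by exact: sqrt_lt_R0.
have ss := sqrt_INR_sqr n.
pose gamma := INR n * C + b * sqrt (INR n).
have per i : exists j, opt_err a - eta / 2 <= LR W (S j) (cenc (F n) i) gamma.
  set x := cenc (F n) i.
  pose P := ptype x.
  have hP : feasible c K P by apply: ptype_feasible => //; exact: adm.
  have dP : is_distr P := distr_feasible hP.
  have expP f : INR n * expect P f = rsum (fun i => f (x i)).
    by rewrite /P expect_ptype; field; lra.
  case: (Rlt_le_dec (C - d') (mutinf P W)) => hI.
    exists None; rewrite /S -/Q.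
    have dom k : dominated (W (x k)) Q.
      move=> y hy; apply: (capacity_dominated HW Hfeas hP0 hP).
      exact: (outdist_pos HW dP (ptype_pos _ n0 k) hy).
    have [v1 v2] := near P hP hI.
    have eV : rsum (fun i => llr_var W Q (x i)) = INR n * expect P (Vx W P0) by rewrite expP.
    have hm : llr_mean W Q x <= INR n * C.
      rewrite /llr_mean -(expP (fun z => relent (W z) Q)); apply: Rmult_le_compat_l; first lra.
      exact: (saddle HW Hfeas hP0 hP).
    set t := expect P (Vx W P0) in v1 v2 eV.
    have vt : Vm / 2 <= t by rewrite -/Vm in v1; lra.
    have := e1 x dom; rewrite eV => /(_ ltac:(nra)).
    have -> : INR n * t / INR n = t by field; lra.
    have mono : LR W Q x (llr_mean W Q x + b * sqrt (INR n)) <= LR W Q x gamma.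
      by apply: LR_mono => //; rewrite /gamma; lra.
    have := hd1 b t (Rmax Vm (Rmin t Vp)).
    have vv := Vminus_le_Vplus; rewrite -/Vm -/Vp in v1 v2 vv.
    (* [t] is only known to lie within [d] of [Vm, Vp], so it is clamped to the interval before
       [opt_err_between] applies. *)
    have tt : Vm <= Rmax Vm (Rmin t Vp) <= Vp.
      by split; [exact: Rmax_l|apply: Rmax_lub => //; exact: Rmin_r].
    have := opt_err_between a tt.
    have near_t : Rabs (t - Rmax Vm (Rmin t Vp)) <= d1.
      rewrite /Rmin; case: (Rle_dec t Vp) => q1; rewrite /Rmax; case: Rle_dec => q2; split_Rabs; lra.
    move=> h1 h2 h3.
    have {}h2 : Rabs (Phi (b / sqrt t) - Phi (a / sqrt (Rmax Vm (Rmin t Vp)))) <= eta / 4.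
      by apply: h2 => //; [rewrite /b (_ : a - d1 - a = - d1); [rewrite Rabs_Ropp Rabs_pos_eq; lra|ring]|lra].
    by move: h2 h3; split_Rabs; lra.
  (* Here I(P,W) is at most [C - d'] and the net adds at most [d' / 2]. The threshold is thus above
     the mean by at least [n * d' / 4] for large [n], the term [b * sqrt n] being absorbed by the
     rest. *)
  have [j hj] := netT _ (outdist_distr HW dP).
  exists (Some j); rewrite /S.
  have dom k : dominated (W (x k)) (T j) by move=> y _; exact: T0.
  have hm : llr_mean W (T j) x <= INR n * (C - d' / 2).
    rewrite /llr_mean -(expP (fun z => relent (W z) (T j))); apply: Rmult_le_compat_l; first lra.
    by rewrite (compensation HW dP); [lra|move=> y _; exact: T0].
  have := e2 j x dom.
  have mono : LR W (T j) x (llr_mean W (T j) x + INR n * (d' / 4)) <= LR W (T j) x gamma.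
    apply: (LR_mono HW (fun y => Rlt_le _ _ (T0 j y))).
    have : Rabs b * 4 <= sqrt (INR n) * d'.
      have : Rabs b * 4 / d' * d' <= sqrt (INR n) * d' by apply: Rmult_le_compat_r; lra.
      by rewrite (_ : Rabs b * 4 / d' * d' = Rabs b * 4); [|field; lra].
    move=> hb; have : Rabs b * sqrt (INR n) <= INR n * (d' / 4).
      have := Rmult_le_compat_r _ _ _ (Rlt_le _ _ s0) hb.
      have : INR n * d' = sqrt (INR n) * sqrt (INR n) * d' by rewrite ss.
      by lra.
    have := Rle_abs (- b); rewrite Rabs_Ropp /gamma => h1.
    have : - b * sqrt (INR n) <= Rabs b * sqrt (INR n) by apply: Rmult_le_compat_r; lra.
    by lra.
  have : opt_err a <= 1.
    by apply: Rle_trans (Rmin_l _ _) _; have := Phi_bound (a / sqrt (Vplus W c K)); lra.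
  by lra.
rewrite /errseq.
have low : opt_err a - eta / 2 - INR #|{: option J}| * (exp gamma / INR (csize (F n))) <= Perr W (F n).
  exact: (Perr_ge hS per).
have N0 : 0 < INR (csize (F n)) by apply: lt_0_INR; apply/ltP; exact: csize_pos.
have hN : gamma + d1 / 2 * sqrt (INR n) <= ln (INR (csize (F n))).
  move: e5; rewrite /rate2 -/C /gamma /b => e5.
  have : (a - d1 / 2) * sqrt (INR n) <= (ln (INR (csize (F n))) - INR n * C) / sqrt (INR n) * sqrt (INR n).
    by apply: Rmult_le_compat_r; lra.
  by rewrite /Rdiv Rmult_assoc Rinv_l; lra.
(* The ratio is at most [exp (- (d1 / 2) * sqrt n)]; the weak bound [exp z >= 1 + z] suffices
   against the fixed number of laws. *)
have small : INR #|{: option J}| * (exp gamma / INR (csize (F n))) <= eta / 2.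
  have h1 : exp gamma / INR (csize (F n)) <= / (d1 / 2 * sqrt (INR n)).
    have -> : exp gamma / INR (csize (F n)) = exp (- (ln (INR (csize (F n))) - gamma)).
      rewrite (_ : - (_ - _) = gamma + - ln (INR (csize (F n)))); last by ring.
      by rewrite exp_plus exp_Ropp exp_ln.
    rewrite exp_Ropp; apply: Rinv_le_contravar; first by apply: Rmult_lt_0_compat; lra.
    by have := exp_ineq1_le (ln (INR (csize (F n))) - gamma); lra.
  have J0 := pos_INR #|{: option J}|.
  apply: Rle_trans (Rmult_le_compat_l _ _ _ J0 h1) _.
  apply: (Rmult_le_reg_r (d1 / 2 * sqrt (INR n))); first by apply: Rmult_lt_0_compat; lra.
  rewrite Rmult_assoc Rinv_l; last by apply: Rgt_not_eq; apply: Rmult_lt_0_compat; lra.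
  have : 4 * INR #|{: option J}| / (d1 * eta) * (d1 * eta) <= sqrt (INR n) * (d1 * eta).
    by apply: Rmult_le_compat_r; nra.
  by rewrite (_ : 4 * INR #|{: option J}| / (d1 * eta) * (d1 * eta) = 4 * INR #|{: option J}|); [lra|field; lra].
by lra.
Qed.
End Converse.

(** * Maximal codes *)

Section Feinstein.
Variables (X Y : finType) (W : X -> Y -> R) (P : X -> R) (n : nat).
Hypotheses (HW : is_channel W) (HP : is_distr P).
Variables (A : {ffun 'I_n -> X} -> bool) (gamma e0 kap : R).
Let Q := outdist W P.
Let hQ : is_distr Q. Proof. exact: outdist_distr. Qed.
Let Q0 y : 0 <= Q y. Proof. by case: hQ. Qed.
Let muA := Eprod (fun _ : 'I_n => P) (fun x => ind (A x)).

Hypothesis hA : forall x, A x -> LR W Q x gamma <= e0.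

Lemma Sn_output (y : {ffun 'I_n -> Y}) : Sn Q y = Eprod (fun _ : 'I_n => P) (fun x => Wn W x y).
Proof.
rewrite /Sn /prod_law /Q /outdist /rsum (bigA_distr_bigA (fun i a => P a * W a (y i))).
by apply: eq_bigr => x _; rewrite /prod_law /Wn -big_split.
Qed.

Let good (x : {ffun 'I_n -> X}) : {set {ffun 'I_n -> Y}} := [set y | ~~ leR (Wn W x y) (exp gamma * Sn Q y)].

Lemma rsum_in_union (N : nat) (D : nat -> {set {ffun 'I_n -> Y}}) f : (forall y, 0 <= f y) ->
  rsum_in [set y | [exists i : 'I_N, y \in D i]] f <= rsum (fun i : 'I_N => rsum_in (D i) f).
Proof.
move=> f0; rewrite rsum_inE (rsum_ext (fun i : 'I_N => rsum_inE (D i) f)) rsum_exch.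
apply: rsum_le => y; have h0 : forall i : 'I_N, 0 <= (if y \in D i then f y else 0).
  by move=> i; case: ifP => _; [exact: f0|lra].
rewrite inE; case: existsP => [[i yi]|_]; last exact: rsum_ge0.
apply: Rle_trans (rsum_ge_term i h0); rewrite yi; lra.
Qed.

(** If no word could be added, every word of [A] would send mass at least [kap] into the used region
    [U], so Q^n would give [U] at least [muA * kap]. But each used set lies above the threshold and
    has Q^n-mass at most [exp (- gamma)]. *)
Lemma feinstein_step (N : nat) (enc : nat -> {ffun 'I_n -> X}) (D : nat -> {set {ffun 'I_n -> Y}}) :
  INR N < exp gamma * muA * kap ->
  (forall i, (i < N)%N -> D i \subset good (enc i)) ->
  exists x, A x /\ 1 - e0 - kap <=
    rsum_in (good x :\: [set y | [exists i : 'I_N, y \in D i]]) (Wn W x).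
Proof.
move=> hN hD; apply: NNPP => no.
set U := [set y | [exists i : 'I_N, y \in D i]] in no.
have eg := exp_pos gamma.
have up : exp gamma * rsum_in U (Sn Q (n := n)) <= INR N.
  have un : rsum_in U (Sn Q (n := n)) <= rsum (fun i : 'I_N => rsum_in (D i) (Sn Q (n := n))).
    by apply: rsum_in_union; exact: Sn_ge0.
  apply: Rle_trans (Rmult_le_compat_l _ _ _ (Rlt_le _ _ eg) un) _.
  rewrite -rsum_mull -[X in _ <= X]Rmult_1_r -[N in INR N](card_ord N) -rsum_const; apply: rsum_le => i.
  have [_ h1] := success_01 HW (enc i) (D i).
  apply: Rle_trans h1; rewrite !rsum_inE -rsum_mull; apply: rsum_le => y.
  case: ifP => [yD|_]; last lra.
  have := subsetP (hD i (ltn_ord i)) y yD; rewrite inE => /leRP; lra.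
have low : muA * kap <= rsum_in U (Sn Q (n := n)).
  have -> : rsum_in U (Sn Q (n := n)) = Eprod (fun _ : 'I_n => P) (fun x => rsum_in U (Wn W x)).
    rewrite rsum_inE /Eprod.
    rewrite (rsum_ext (H := fun y => rsum (fun x => prod_law (fun _ => P) x * (if y \in U then Wn W x y else 0)))).
      by rewrite rsum_exch; apply: rsum_ext => x; rewrite rsum_mull rsum_inE.
    move=> y; case: ifP => _; first by rewrite Sn_output.
    by rewrite rsum_mulr Rmult_0_r.
  rewrite Rmult_comm /muA -Eprod_mull; apply: Eprod_le => // x _.
  case Ax: (A x); last by rewrite /= Rmult_0_r; case: (success_01 HW x U).
  rewrite /= Rmult_1_r.
  have h1 : rsum_in (good x :\: U) (Wn W x) < 1 - e0 - kap.
    by apply: Rnot_le_lt => h; apply: no; exists x.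
  have h2 : 1 <= LR W Q x gamma + rsum_in (good x :\: U) (Wn W x) + rsum_in U (Wn W x).
    rewrite -{1}(Wn_sum1 HW x) /LR /Eprod !rsum_inE -!rsum_add; apply: rsum_le => y.
    have w := Wn_ge0 HW x y; rewrite -WnE !inE.
    by case: leR => /=; case: existsP => _ /=; lra.
  by have := hA Ax; lra.
have := Rmult_le_compat_l _ _ _ (Rlt_le _ _ eg) low; lra.
Qed.

Lemma feinstein (N : nat) : (0 < N)%N -> INR N - 1 < exp gamma * muA * kap ->
  exists F : code X Y n, [/\ csize F = N, forall i, A (cenc F i) & Perr W F <= e0 + kap].
Proof.
move=> N0 hN.
(* Indexing by [nat] instead of ordinals lets the induction append a word by redefining both
   functions at [N] alone. *)
suff [enc [D [hD [hA' [hg hdis]]]]] : exists (enc : nat -> {ffun 'I_n -> X}) (D : nat -> {set {ffun 'I_n -> Y}}),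
    (forall i, (i < N)%N -> D i \subset good (enc i)) /\
    (forall i, (i < N)%N -> A (enc i)) /\
    (forall i, (i < N)%N -> 1 - e0 - kap <= rsum_in (D i) (Wn W (enc i))) /\
    (forall i j, (i < N)%N -> (j < N)%N -> i != j -> [disjoint D i & D j]).
  have dis : forall i j : 'I_N, i != j -> [disjoint D i & D j].
    by move=> i j ij; apply: hdis.
  exists (@Code X Y n N N0 (fun i => enc i) (fun i => D i) dis); split=> //=.
    by move=> i; exact: hA'.
  rewrite /Perr /=.
  have n0 : 0 < INR N by apply: lt_0_INR; exact/ltP.
  have -> : e0 + kap = / INR N * (INR #|'I_N| * (e0 + kap)) by rewrite card_ord; field; lra.
  apply: Rmult_le_compat_l; first by left; exact: Rinv_0_lt_compat.
  rewrite -rsum_const; apply: rsum_le => i.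
  have aux r : 1 - e0 - kap <= r -> 1 - r <= e0 + kap by lra.
  by apply: aux; exact: hg.
have {}hN : forall M, (M < N)%N -> INR M < exp gamma * muA * kap.
  move=> M /leP/le_INR; rewrite S_INR; lra.
elim: N {N0} hN => [|N IH] hN.
  have [p0 p1] := HP; have [x0 _] : exists x0, 0 < P x0 by apply: rsum_pos => //; rewrite p1; lra.
  by exists (fun _ => [ffun _ => x0]), (fun _ => set0).
have [|enc [D [hD [hA' [hg hdis]]]]] := IH; first by move=> M hM; apply: hN; exact: ltnW.
have [x [Ax hx]] := feinstein_step (hN N (ltnSn N)) hD.
set U := [set y | [exists i : 'I_N, y \in D i]] in hx.
exists (fun i => if i == N then x else enc i), (fun i => if i == N then good x :\: U else D i).
have lt i : (i < N.+1)%N -> i != N -> (i < N)%N by rewrite ltnS leq_eqVlt => /orP[->|].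
have dU i : (i < N)%N -> [disjoint good x :\: U & D i].
  move=> hi; rewrite disjoints_subset; apply/subsetP => y; rewrite !inE => /andP[/existsP no _].
  by apply/negP => yi; apply: no; exists (Ordinal hi).
split; [|split; [|split]].
- by move=> i hi; case: eqP => [_|/eqP ne]; [exact: subsetDl|apply: hD; exact: lt].
- by move=> i hi; case: eqP => [_|/eqP ne] //; apply: hA'; exact: lt.
- by move=> i hi; case: eqP => [_|/eqP ne] //; apply: hg; exact: lt.
- move=> i j hi hj ij; case: eqP => [ei|/eqP ni]; case: eqP => [ej|/eqP nj].
  + by move: ij; rewrite ei ej eqxx.
  + by apply: dU; exact: lt.
  + by rewrite disjoint_sym; apply: dU; exact: lt.
  + by apply: hdis => //; exact: lt.
Qed.
End Feinstein.

(** * Achievability *)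

Section IID.
Variables (X : finType) (P f : X -> R).
Hypothesis HP : is_distr P.

Definition dev (n : nat) (i : 'I_n) a := f a - expect P f.

Lemma iid_prod_distr n : is_prod_distr (fun _ : 'I_n => P). Proof. by []. Qed.

Lemma dev_centered n : centered (fun _ : 'I_n => P) (@dev n).
Proof.
move=> i; rewrite /dev (@rsum_ext _ _ (fun a => P a * f a - P a * expect P f)); last by move=> a; ring.
by rewrite rsum_sub rsum_mulr; case: HP => _ ->; rewrite -/(expect P f); ring.
Qed.

Lemma coord_sum_dev n (x : {ffun 'I_n -> X}) :
  coord_sum (@dev n) x = rsum (fun i => f (x i)) - INR n * expect P f.
Proof. by rewrite /coord_sum /dev rsum_sub rsum_const card_ord. Qed.

Definition variance := expect P (fun a => Rsqr (f a - expect P f)).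

Lemma dev_var n : var_sum (fun _ : 'I_n => P) (@dev n) = INR n * variance.
Proof. by rewrite /var_sum /dev rsum_const card_ord. Qed.

Definition dev_bound := rsum (fun a => Rabs (f a - expect P f)).

Lemma dev_bound_ge a : Rabs (f a - expect P f) <= dev_bound.
Proof. by apply: (@rsum_ge_term _ a (fun a => Rabs (f a - expect P f))) => b; exact: Rabs_pos. Qed.

Lemma dev_bound_ge0 : 0 <= dev_bound.
Proof. by apply: rsum_ge0 => a; exact: Rabs_pos. Qed.

Lemma variance_ge0 : 0 <= variance.
Proof. by apply: rsum_ge0 => a; have [p _] := HP; apply: Rmult_le_pos => //; exact: Rle_0_sqr. Qed.

Lemma lln d eta : 0 < d -> 0 < eta ->
  for_large (fun n => Eprod (fun _ : 'I_n => P) (fun x => ind (~~ leR (Rabs (coord_sum (@dev n) x)) (INR n * d))) <= eta).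
Proof.
move=> d0 eta0.
have dd : 0 < d * d * eta by apply: Rmult_lt_0_compat => //; exact: Rmult_lt_0_compat.
have [N hN] := exists_INR_gt (variance / (d * d * eta) + 1).
exists N => n /leP/le_INR Nn; have v0 := variance_ge0.
have q : 0 <= variance / (d * d * eta) by apply: Rmult_le_pos => //; left; exact: Rinv_0_lt_compat.
have n1 : 1 <= INR n by lra.
have nd : 0 < INR n * d by nra.
have ch := chebyshev (b := fun x => ~~ leR (Rabs (coord_sum (@dev n) x)) (INR n * d)) (@iid_prod_distr n) (@dev_centered n) nd.
apply: Rle_trans (ch _) _; first by move=> y /leRP; lra.
rewrite dev_var; apply: (Rmult_le_reg_r (Rsqr (INR n * d))); first by rewrite /Rsqr; nra.
rewrite /Rdiv Rmult_assoc Rinv_l; last by rewrite /Rsqr; nra.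
have h : variance <= INR n * (d * d * eta).
  have -> : variance = variance / (d * d * eta) * (d * d * eta) by field; split; lra.
  by apply: Rmult_le_compat_r; lra.
have := Rmult_le_compat_l (INR n) _ _ (pos_INR n) h; rewrite /Rsqr; lra.
Qed.

(* By the central limit theorem the centred sum falls in any window of width of order sqrt n below 0 with probability bounded below. *)
Lemma window_prob w : 0 < w -> exists p, 0 < p /\
  for_large (fun n => p <= Eprod (fun _ : 'I_n => P) (fun x =>
     ind (leR (coord_sum (@dev n) x) 0 && ~~ leR (coord_sum (@dev n) x) (- w * sqrt (INR n))))).
Proof.
(* With zero variance every support letter has the mean value and the sum is 0 with probability 1,
   so the central limit theorem is not called for. *)
move=> w0; case: (Rle_lt_or_eq_dec _ _ variance_ge0) => hv; last first.
  exists 1; split; first lra.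
  apply: for_large_impl for_large_pos => n n1.
  have s0 : 0 < sqrt (INR n) by apply: sqrt_lt_R0; lra.
  rewrite -{1}(Eprod_const 1 (@iid_prod_distr n)); apply: (Eprod_le (@iid_prod_distr n)) => x px.
  have z : coord_sum (@dev n) x = 0.
    rewrite /coord_sum (rsum_ext (H := fun _ => 0)) ?rsum_0 // => i; rewrite /dev.
    have pi := prod_law_gt0 (@iid_prod_distr n) px i.
    have [p0 _] := HP.
    have nn a : 0 <= P a * Rsqr (f a - expect P f) by apply: Rmult_le_pos => //; exact: Rle_0_sqr.
    by have := rsum_eq0 nn (esym hv) (x i); case/Rmult_integral; [lra|exact: Rsqr_0_uniq].
  rewrite z; case: leRP => h1 /=; last lra.
  by case: leRP => h2 /=; [nra|lra].
have sv : 0 < sqrt variance by exact: sqrt_lt_R0.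
have neg : - w / sqrt variance < 0 by rewrite /Rdiv; have := Rinv_0_lt_compat _ sv; nra.
have := Phi_lt neg; rewrite Phi_0 => h.
(* The window has Gaussian mass [2 * p]; the two normal approximations lose [p / 2] each. *)
pose p := (1 / 2 - Phi (- w / sqrt variance)) / 2.
have p0 : 0 < p by rewrite /p; lra.
exists p; split=> //.
have p2 : 0 < p / 2 by lra.
have E1 := uniform_clt X 0 dev_bound_ge0 hv p2.
have E2 := uniform_clt X (- w) dev_bound_ge0 hv p2.
apply: for_large_impl (for_large_and (for_large_and E1 E2) for_large_pos) => n [[e1 e2] n1].
have s0 := sqrt_pos (INR n).
have hb : forall (i : 'I_n) a, 0 < P a -> Rabs (@dev n i a) <= dev_bound.
  by move=> i a _; exact: dev_bound_ge.
have hvar : INR n * variance <= var_sum (fun _ : 'I_n => P) (@dev n) by rewrite dev_var; lra.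
have {}e1 := e1 _ _ (@iid_prod_distr n) (@dev_centered n) hb hvar.
have {}e2 := e2 _ _ (@iid_prod_distr n) (@dev_centered n) hb hvar.
move: e1 e2; rewrite dev_var (_ : INR n * variance / INR n = variance); last by field; lra.
rewrite (_ : 0 / sqrt variance = 0); last by field; lra.
rewrite Phi_0 Rmult_0_l.
set a1 := Eprod _ _; set a2 := Eprod _ _ => e1 e2.
suff : a1 - a2 <= Eprod (fun _ : 'I_n => P) (fun x =>
     ind (leR (coord_sum (@dev n) x) 0 && ~~ leR (coord_sum (@dev n) x) (- w * sqrt (INR n)))).
  by rewrite /p in e1 e2 p0 *; move: e1 e2; split_Rabs; lra.
rewrite -Eprod_sub; apply: (Eprod_le (@iid_prod_distr n)) => x _.
by case: leR => /=; case: leR => /=; lra.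
Qed.
End IID.

Section Direct.
Variables (X Y : finType) (W : X -> Y -> R) (c : X -> R) (K : R).
Hypothesis HW : is_channel W.
Hypothesis Hfeas : exists P : X -> R, feasible c K P.
Variable P : X -> R.
Hypothesis hP : cap_achieving W c K P.
Let fP : feasible c K P. Proof. by case: hP. Qed.
Let dP : is_distr P. Proof. exact: distr_feasible fP. Qed.
Let C := capacity W c K.
Let Q := outdist W P.
Let V := dispersion P W.
Hypothesis V0 : 0 < V.

(** The first clause puts every letter in the support of [P], whence domination by [Q]; the last two
    are the mean and the variance entering [LR_clt]. *)
Definition typical n w d (x : {ffun 'I_n -> X}) :=
  [&& ~~ leR (prod_law (fun _ => P) x) 0, leR (rsum (fun i => c (x i))) (INR n * K),
      leR (INR n * C - w * sqrt (INR n)) (llr_mean W Q x) &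
      leR (Rabs (rsum (fun i => llr_var W Q (x i)) - INR n * V)) (INR n * d)].

Lemma typical_prob w d : 0 < w -> 0 < d -> exists p, 0 < p /\
  for_large (fun n => p <= Eprod (fun _ : 'I_n => P) (fun x => ind (typical w d x))).
Proof.
move=> w0 d0.
have [lam hlam] := Dx_affine HW Hfeas hP.
(* By [Dx_affine] a cost deficit below [w1 * sqrt n] lowers the mean by at most
   [Rabs lam * w1 * sqrt n <= w * sqrt n], whatever the sign of [lam]; the [+ 1] allows for slope
   0. *)
pose w1 := w / (Rabs lam + 1).
have l0 := Rabs_pos lam.
have w10 : 0 < w1 by apply: Rdiv_lt_0_compat; lra.
have [p [p0 E1]] := window_prob c dP w10.
have p2 : 0 < p / 2 by lra.
have E2 := lln (Vx W P) dP d0 p2.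
exists (p / 2); split=> //; apply: for_large_impl (for_large_and E1 E2) => n [e1 e2].
have s0 := sqrt_pos (INR n).
set a1 := Eprod _ _ in e1; set a2 := Eprod _ _ in e2.
suff : a1 - a2 <= Eprod (fun _ : 'I_n => P) (fun x => ind (typical w d x)) by lra.
rewrite -Eprod_sub; apply: (Eprod_le (@iid_prod_distr _ _ dP n)) => x px.
case: leRP => h1 /=; last by case: (ind_01 (typical w d x)); case: leR => /=; lra.
case: leRP => h2 /=; first by case: (ind_01 (typical w d x)); case: leR => /=; lra.
case: leRP => h3 /=; last by case: (ind_01 (typical w d x)); lra.
suff -> : typical w d x by rewrite /=; lra.
rewrite coord_sum_dev in h1 h2.
have Kc : expect P c <= K by case: fP.
apply/and4P; split; apply/leRP.
- lra.
- by have := pos_INR n; nra.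
- have -> : llr_mean W Q x = INR n * C + lam * (rsum (fun i => c (x i)) - INR n * expect P c).
    have -> : INR n * C + lam * (rsum (fun i => c (x i)) - INR n * expect P c) =
       rsum (fun i : 'I_n => (C - lam * expect P c) + lam * c (x i)).
      by rewrite rsum_add rsum_mull rsum_const card_ord; ring.
    apply: rsum_ext => i; have := hlam _ (prod_law_gt0 (@iid_prod_distr _ _ dP n) px i).
    by rewrite /Dx -/Q -/C => ->; ring.
  have hl : Rabs lam * w1 <= w.
    have : (Rabs lam + 1) * w1 = w by rewrite /w1; field; lra.
    by lra.
  have hs : Rabs lam * w1 * sqrt (INR n) <= w * sqrt (INR n) by apply: Rmult_le_compat_r.
  move: (rsum _ - _) h1 h2 => r h1 h2.
  have : - (Rabs lam * (w1 * sqrt (INR n))) <= lam * r.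
    have r1 : - r <= w1 * sqrt (INR n) by lra.
    have := Rmult_le_compat_l _ _ _ l0 r1; have := Rle_abs lam; have := Rle_abs (- lam).
    by rewrite Rabs_Ropp; nra.
  by lra.
- by move: h3; rewrite coord_sum_dev -(cap_dispersion HW Hfeas hP hP).
Qed.

Lemma typical_dominated n w d (x : {ffun 'I_n -> X}) i : typical w d x -> dominated (W (x i)) Q.
Proof.
move=> /and4P [/leRP px _ _ _] y hy.
by apply: (outdist_pos HW dP _ hy); apply: (prod_law_gt0 (@iid_prod_distr _ _ dP n)); lra.
Qed.

(** Filler for the block lengths below the range of the construction, since admissibility is
    demanded at every [n]. *)
Definition trivial_code n (x : {ffun 'I_n -> X}) : code X Y n.
Proof.
refine (@Code X Y n 1 isT (fun _ => x) (fun _ => set0) _).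
by move=> i j; rewrite !ord1.
Defined.

Lemma achievability a eta : 0 < eta -> exists F : code_seq X Y,
  [/\ admissible c K F, liminf_ge (rate2 W c K F) a &
      for_large (fun n => errseq W F n <= Phi (a / sqrt V) + eta)].
Proof.
move=> eta0.
have v2 : 0 < V / 2 by lra.
have eta4 : 0 < eta / 4 by lra.
have [d1 [d10 hd1]] := Phi_scaled_near a v2 eta4.
pose d := Rmin d1 (V / 2); have d0 : 0 < d by apply: Rmin_glb_lt; lra.
have dd1 : d <= d1 := Rmin_l _ _. have dv : d <= V / 2 := Rmin_r _ _.
(* [w] is spent twice, once as the possible loss in the mean and once as the excess of [gamma] over
   the target log-size, so the normalised threshold is at most [a + d1]. *)
pose w := d1 / 2; have w0 : 0 < w by rewrite /w; lra.
have [p [p0 E1]] := typical_prob w0 d0.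
have Q0 y : 0 <= Q y by case: (outdist_distr HW dP).
have E2 := LR_clt HW Q0 (a + d1) v2 eta4.
(* The excess factor [exp (w * sqrt n)] in the threshold then outweighs the probability [p] of
   typical words and the slack [eta / 2] in [feinstein]. *)
have E3 := for_large_sqrt (2 / (w * p * eta)).
have [x0 hx0] : exists x0, c x0 <= K.
  apply: NNPP => no; have [[q0 q1] qc] := fP.
  have [z hz] : exists z, 0 < P z by apply: rsum_pos => //; rewrite q1; lra.
  have : 0 < expect P (fun x => c x - K).
    have nn x : 0 <= P x * (c x - K).
      apply: Rmult_le_pos => //; suff : ~ c x <= K by lra.
      by move=> h; apply: no; exists x.
    have := rsum_ge_term z nn; suff : 0 < P z * (c z - K) by rewrite /expect; lra.
    apply: Rmult_lt_0_compat => //; suff : ~ c z <= K by lra.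
    by move=> h; apply: no; exists z.
  rewrite /expect (@rsum_ext _ _ (fun x => P x * c x - P x * K)); last by move=> x; ring.
  by rewrite rsum_sub rsum_mulr q1 -/(expect P c); lra.
have [N hN] : for_large (fun n => exists F : code X Y n, [/\ code_cost_ok c K F,
     INR n * C + a * sqrt (INR n) <= ln (INR (csize F)) & Perr W F <= Phi (a / sqrt V) + eta]).
  apply: for_large_impl (for_large_and (for_large_and E1 E2) (for_large_and E3 for_large_pos)) => n [[e1 e2] [e3 n1]].
  have s0 : 0 < sqrt (INR n) by apply: sqrt_lt_R0; lra.
  pose u := INR n * C + a * sqrt (INR n); pose gamma := u + w * sqrt (INR n).
  have hLR (x : {ffun 'I_n -> X}) : typical w d x -> LR W Q x gamma <= Phi (a / sqrt V) + eta / 2.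
    move=> /[dup] tx /and4P [_ _ /leRP hm /leRP hv].
    have dom i : dominated (W (x i)) Q by exact: (typical_dominated (i := i) tx).
    set T := rsum (fun i => llr_var W Q (x i)) in hv.
    have tt : Rabs (T / INR n - V) <= d.
      rewrite (_ : T / INR n - V = (T - INR n * V) / INR n); last by field; lra.
      rewrite /Rdiv Rabs_mult (Rabs_pos_eq (/ _)); last by left; apply: Rinv_0_lt_compat; lra.
      apply: (Rmult_le_reg_r (INR n)); first lra.
      by rewrite Rmult_assoc Rinv_l; lra.
    have tlow : V / 2 <= T / INR n by move: tt; split_Rabs; lra.
    have Tlow : INR n * (V / 2) <= T.
      have -> : T = INR n * (T / INR n) by field; lra.
      by apply: Rmult_le_compat_l; lra.
    have := e2 x dom Tlow; rewrite -/T => h1.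
    have := hd1 (a + d1) (T / INR n) V; rewrite (_ : a + d1 - a = d1); last by ring.
    rewrite (Rabs_pos_eq d1) => [h2|]; last by lra.
    have {}h2 : Rabs (Phi ((a + d1) / sqrt (T / INR n)) - Phi (a / sqrt V)) <= eta / 4 by apply: h2; lra.
    have : LR W Q x gamma <= LR W Q x (llr_mean W Q x + (a + d1) * sqrt (INR n)).
      by apply: (LR_mono HW Q0); rewrite /gamma /u /w in hm *; lra.
    by move: h1 h2; split_Rabs; lra.
  (* The code gets [k + 1] words, so its log-size is at least [u]; [feinstein] constrains only [k],
     which is at most [exp u]. *)
  have [k [k1 k2]] := nfloor_ex (exp u) (Rlt_le _ _ (exp_pos u)).
  have hk : INR k.+1 - 1 < exp gamma * Eprod (fun _ : 'I_n => P) (fun x => ind (typical w d x)) * (eta / 2).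
    rewrite S_INR; apply: Rle_lt_trans (_ : exp u < _); first by lra.
    set m := Eprod _ _ in e1 *.
    have eu := exp_pos u.
    rewrite /gamma exp_plus.
    have h1 := exp_ineq1_le (w * sqrt (INR n)).
    have h2 : 1 < (1 + w * sqrt (INR n)) * (p * (eta / 2)).
      have pe : 0 < p * eta by nra.
      have h3 : 2 <= sqrt (INR n) * (w * p * eta).
        rewrite (_ : 2 = 2 / (w * p * eta) * (w * p * eta)); last by field; split; [|split]; lra.
        by apply: Rmult_le_compat_r; nra.
      by nra.
    have h4 : (1 + w * sqrt (INR n)) * (p * (eta / 2)) <= exp (w * sqrt (INR n)) * (m * (eta / 2)).
      by apply: Rmult_le_compat; nra.
    have -> : exp u * exp (w * sqrt (INR n)) * m * (eta / 2) = exp u * (exp (w * sqrt (INR n)) * (m * (eta / 2))) by ring.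
    by nra.
  have [F [sF tF eF]] := feinstein HW dP hLR (ltn0Sn k) hk.
  exists F; split.
  - by move=> i; have /and4P [_ /leRP h _ _] := tF i.
  - rewrite sF -/u -(ln_exp u) S_INR; apply: Rcomplements.ln_le; [exact: exp_pos|lra].
  - by lra.
have [F hF] : exists F : code_seq X Y, forall n, code_cost_ok c K (F n) /\ ((N <= n)%N ->
     INR n * C + a * sqrt (INR n) <= ln (INR (csize (F n))) /\ Perr W (F n) <= Phi (a / sqrt V) + eta).
  have each n : exists F : code X Y n, code_cost_ok c K F /\ ((N <= n)%N ->
     INR n * C + a * sqrt (INR n) <= ln (INR (csize F)) /\ Perr W F <= Phi (a / sqrt V) + eta).
    case: (leqP N n) => h; first by have [F [h1 h2 h3]] := hN n h; exists F.
    exists (trivial_code [ffun _ => x0]); split=> // i.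
    rewrite (rsum_ext (H := fun _ => c x0)); last by move=> j; rewrite /= ffunE.
    by rewrite rsum_const card_ord; apply: Rmult_le_compat_l => //; exact: pos_INR.
  exists (fun n => proj1_sig (constructive_indefinite_description _ (each n))) => n.
  by case: constructive_indefinite_description.
exists F; split.
- by move=> n; case: (hF n).
- move=> b hb; have [M hM] := for_large_pos; exists (maxn N M) => n.
  rewrite geq_max => /andP[/(proj2 (hF n)) [h _] /hM n1].
  have s0 : 0 < sqrt (INR n) by apply: sqrt_lt_R0; lra.
  apply: Rlt_le_trans hb _; rewrite /rate2 -/C.
  by apply: (Rmult_le_reg_r (sqrt (INR n))) => //; rewrite /Rdiv Rmult_assoc Rinv_l; lra.
- by exists N => n /(proj2 (hF n)) [].
Qed.
End Direct.

(** * Second-order asymptotics *)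

Section Limsup.
Variable u : nat -> R.
Hypothesis hu : forall n, 0 <= u n <= 1.

(** Values in [0, 1] force the extended upper limit to be finite, which is what the [epsilon] of
    [Rlimsup] needs. *)
Lemma Rlimsup_spec :
  (forall e, 0 < e -> exists N, forall n, (N <= n)%nat -> u n < Rlimsup u + e) /\
  (forall e, 0 < e -> forall N, exists n, (N <= n)%nat /\ Rlimsup u - e < u n).
Proof.
apply: (epsilon_spec (inhabits 0) (fun l =>
    (forall e, 0 < e -> exists N, forall n, (N <= n)%nat -> u n < l + e) /\
    (forall e, 0 < e -> forall N, exists n, (N <= n)%nat /\ l - e < u n))).
have [[l| |] hl] := ex_LimSup_seq u.
- exists l; split=> e e0; have [h1 h2] := hl (mkposreal e e0).
    by have [N hN] := h2; exists N => n /leP; exact: hN.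
  by move=> N; have [n [/leP hn h]] := h1 N; exists n.
- by have [n [_ h]] := hl 1 0%N; have := hu n; lra.
- by have [N hN] := hl 0; have := hN N (le_n N); have := hu N; lra.
Qed.

Lemma Rlimsup_le t : (forall e, 0 < e -> for_large (fun n => u n <= t + e)) -> Rlimsup u <= t.
Proof.
move=> h; apply: le_epsilon => e e0; have e2 : 0 < e / 2 by lra.
have [N hN] := h _ e2; have [n [hn]] := Rlimsup_spec.2 _ e2 N.
by have := hN n hn; lra.
Qed.

Lemma Rlimsup_ge t : (forall e, 0 < e -> for_large (fun n => t - e <= u n)) -> t <= Rlimsup u.
Proof.
move=> h; apply: le_epsilon => e e0; have e2 : 0 < e / 2 by lra.
have [N hN] := h _ e2; have [M hM] := Rlimsup_spec.1 _ e2.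
by have := hN _ (leq_maxl N M); have := hM _ (leq_maxr N M); lra.
Qed.
End Limsup.

Section Main.
Variables (X Y : finType) (W : X -> Y -> R) (c : X -> R) (K : R).
Hypothesis HW : is_channel W.
Hypothesis Hfeas : exists P : X -> R, feasible c K P.
Hypothesis HV : 0 < Vminus W c K.

Let errseq_01 F n : 0 <= errseq W F n <= 1.
Proof. exact: Perr_01. Qed.

Lemma converse_limsup a F : admissible c K F -> liminf_ge (rate2 W c K F) a ->
  opt_err W c K a <= Rlimsup (errseq W F).
Proof.
by move=> adm hr; apply: Rlimsup_ge => // e e0; exact: Perr_converse.
Qed.

Lemma achievability_limsup P a e : cap_achieving W c K P -> Phi (a / sqrt (dispersion P W)) < e ->
  exists F : code_seq X Y, [/\ admissible c K F, liminf_ge (rate2 W c K F) a &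
    Rlimsup (errseq W F) < e].
Proof.
move=> hP he.
have V0 : 0 < dispersion P W by have := (Vminus_spec HW Hfeas).2 P hP; lra.
have [|F [h1 h2 h3]] := achievability HW Hfeas hP V0 a (eta := (e - Phi (a / sqrt (dispersion P W))) / 2).
  by lra.
exists F; split=> //.
apply: Rle_lt_trans (_ : (e + Phi (a / sqrt (dispersion P W))) / 2 < e); last by lra.
apply: Rlimsup_le => // d d0; apply: for_large_impl h3 => n; lra.
Qed.

Lemma achievability_opt_err a e : opt_err W c K a < e ->
  exists F : code_seq X Y, [/\ admissible c K F, liminf_ge (rate2 W c K F) a &
    Rlimsup (errseq W F) < e].
Proof.
rewrite /opt_err /Rmin; case: Rle_dec => _.
  by have [[P [hP <-]] _] := Vplus_spec HW Hfeas; exact: achievability_limsup.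
by have [[P [hP <-]] _] := Vminus_spec HW Hfeas; exact: achievability_limsup.
Qed.

(** The predicate behind [Cp_DM] has only one solution: of two, the smaller would provide codes with
    error below the larger, against the lower-bound clause. *)
Lemma Cp_DM_opt_err a : Cp_DM W c K a = opt_err W c K a.
Proof.
set spec := fun v : R =>
    (forall F : code_seq X Y, admissible c K F -> liminf_ge (rate2 W c K F) a ->
        v <= Rlimsup (errseq W F)) /\
    (forall e, v < e -> exists F : code_seq X Y, admissible c K F /\
        liminf_ge (rate2 W c K F) a /\ Rlimsup (errseq W F) < e).
have h : spec (opt_err W c K a).
  split; first by move=> F; exact: converse_limsup.
  by move=> e /achievability_opt_err [F [h1 h2 h3]]; exists F.
have [g1 g2] : spec (Cp_DM W c K a) by apply: (epsilon_spec (inhabits 0) spec); eexists; exact: h.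
have [h1 h2] := h.
apply: Rle_antisym; apply: Rnot_lt_le.
  by case/h2 => F [f1 [f2 f3]]; have := g1 F f1 f2; lra.
by case/g2 => F [f1 [f2 f3]]; have := h1 F f1 f2; lra.
Qed.

Let sp : 0 < sqrt (Vplus W c K).
Proof. by apply: sqrt_lt_R0; have := Vminus_le_Vplus HW Hfeas; lra. Qed.
Let sm : 0 < sqrt (Vminus W c K). Proof. exact: sqrt_lt_R0. Qed.
Let smp : / sqrt (Vplus W c K) <= / sqrt (Vminus W c K).
Proof. by apply: Rinv_le_contravar => //; apply: sqrt_le_1_alt; exact: Vminus_le_Vplus. Qed.

Lemma opt_err_ge0 a : 0 <= a -> opt_err W c K a = Phi (a / sqrt (Vplus W c K)).
Proof. by move=> a0; rewrite /opt_err Rmin_left //; apply: Phi_le; rewrite /Rdiv; nra. Qed.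

Lemma opt_err_lt0 a : a < 0 -> opt_err W c K a = Phi (a / sqrt (Vminus W c K)).
Proof. by move=> a0; rewrite /opt_err Rmin_right //; apply: Phi_le; rewrite /Rdiv; nra. Qed.

(** The second hypothesis is strict because [achievability_opt_err] reaches only errors strictly
    above [opt_err]. *)
Lemma C_DM_char eps v : (forall b, opt_err W c K b <= eps -> b <= v) ->
  (forall b, b < v -> opt_err W c K b < eps) -> C_DM W c K eps = v.
Proof.
move=> hc hd.
set spec := fun v : R =>
    (forall F : code_seq X Y, admissible c K F -> Rlimsup (errseq W F) <= eps ->
        forall b, liminf_ge (rate2 W c K F) b -> b <= v) /\
    (forall b, b < v -> exists F : code_seq X Y, admissible c K F /\
        Rlimsup (errseq W F) <= eps /\ liminf_ge (rate2 W c K F) b).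
have h : spec v.
  split.
    move=> F adm le b hb; apply: hc; exact: Rle_trans (converse_limsup adm hb) le.
  by move=> b /hd/achievability_opt_err [F [h1 h2 h3]]; exists F; split=> //; split=> //; lra.
have [g1 g2] : spec (C_DM W c K eps) by apply: (epsilon_spec (inhabits 0) spec); eexists; exact: h.
have [h1 h2] := h.
(* A supremum is approached only by rates strictly below it, so two candidate values are separated
   at their midpoint. *)
have mid p q : p < q -> p < (p + q) / 2 < q by move=> ?; lra.
apply: Rle_antisym; apply: Rnot_lt_le => /mid [m1 m2].
  by have [F [f1 [f2 f3]]] := g2 _ m2; have := h1 F f1 f2 _ f3; lra.
by have [F [f1 [f2 f3]]] := h2 _ m2; have := g1 F f1 f2 _ f3; lra.
Qed.

Lemma Phi_inv_le x y : Phi x <= Phi y -> x <= y.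
Proof. by move=> h; apply: Rnot_lt_le => /Phi_lt; lra. Qed.

Lemma C_DM_eq eps : 0 < eps < 1 -> C_DM W c K eps =
  if Rle_dec (1 / 2) eps then sqrt (Vplus W c K) * Ginv eps else sqrt (Vminus W c K) * Ginv eps.
Proof.
move=> he; have hg := Phi_Ginv he; set g := Ginv eps in hg *.
have scale s b : 0 < s -> b / s * s = b by move=> s0; field; lra.
case: Rle_dec => h12; apply: C_DM_char => b.
- have g0 : 0 <= g by apply: Phi_inv_le; rewrite hg Phi_0.
  case: (Rle_lt_dec 0 b) => hb; last by move=> _; nra.
  rewrite opt_err_ge0 // -hg => /Phi_inv_le h.
  by rewrite -(scale _ b sp) Rmult_comm; apply: Rmult_le_compat_l; lra.
(* Bounding one member of the minimum is enough, so the sign of [b] is irrelevant here. *)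
- move=> hb; apply: Rle_lt_trans (Rmin_l _ _) _; rewrite -hg; apply: Phi_lt.
  by apply: (Rmult_lt_reg_r (sqrt (Vplus W c K))) => //; rewrite scale //; lra.
- have g0 : g < 0 by apply: Rnot_le_lt => /Phi_le; rewrite hg Phi_0; lra.
  (* A nonnegative [b] would force an error of at least 1/2, above [eps]. *)
  case: (Rle_lt_dec 0 b) => hb.
    rewrite opt_err_ge0 // => h; exfalso; apply: h12; apply: Rle_trans h.
    rewrite -Phi_0; apply: Phi_le; apply: Rmult_le_pos => //; left; exact: Rinv_0_lt_compat.
  rewrite opt_err_lt0 // -hg => /Phi_inv_le h.
  by rewrite -(scale _ b sm) Rmult_comm; apply: Rmult_le_compat_l; lra.
- move=> hb; apply: Rle_lt_trans (Rmin_r _ _) _; rewrite -hg; apply: Phi_lt.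
  by apply: (Rmult_lt_reg_r (sqrt (Vminus W c K))) => //; rewrite scale //; lra.
Qed.

End Main.

Theorem mainTheorem2 (X Y : finType) (W : X -> Y -> R) (c : X -> R) (K : R)
  (HW : is_channel W)
  (Hfeas : exists P : X -> R, feasible c K P)
  (HV : 0 < Vminus W c K) :
  (forall a : R,
     Cp_DM W c K a =
       (if Rle_dec 0 a then G (a / sqrt (Vplus W c K))
        else G (a / sqrt (Vminus W c K)))) /\
  (forall eps : R, 0 < eps < 1 ->
     C_DM W c K eps =
       (if Rle_dec (1/2) eps then sqrt (Vplus W c K) * Ginv eps
        else sqrt (Vminus W c K) * Ginv eps)).
Proof.
split=> [a|eps]; last exact: C_DM_eq.
rewrite Cp_DM_opt_err // !GE; case: Rle_dec => ha.
  exact: opt_err_ge0.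
by apply: opt_err_lt0 => //; lra.
Qed.
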